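(* Let $m\ge2$, let $\mu$ be a partition of $m$ and let $\nu$ be a partition of $n$. Set $\kappa=\nu'$ if $m$ is even and $\kappa=\nu$ if $m$ is odd. (i) There is a unique partition $\lambda$, maximal in the dominance order on partitions, such that $S^\lambda$ is a summand of $H_\mu^\nu$ if and only if either $\nu=(n)$, or $\mu$ is rectangular and $\nu$ has exactly two parts. (ii) There is a unique partition $\lambda$, minimal in the dominance order on partitions, such that $S^\lambda$ is a summand of $H_\mu^\nu$ if and only if either $\kappa=(1^n)$, or $\mu$ is rectangular and $\kappa=(2^c,1^d)$ for some integers $c\ge1$ and $d\ge0$. (Maximal/minimal means maximal/minimal among the partitions labelling Specht module summands of $H_\mu^\nu$.)
   Context: A partition is rectangular if it is of the form $(a^b)$ for some positive integers $a,b$. $\nu'$ is the conjugate of $\nu$. $S^\lambda$ is the Specht module over $\mathbb{Q}$ labelled by the partition $\lambda$ (irreducible, with $S^{(r)}$ the trivial $\mathbb{Q}S_r$-module). The wreath product $S_m\wr S_n$ acts as a transitive imprimitive subgroup of $S_{mn}$. For a $\mathbb{Q}S_m$-module $W$ and a $\mathbb{Q}S_n$-module $Z$, $W\oslash Z$ is the $\mathbb{Q}(S_m\wr S_n)$-module $W^{\otimes n}\otimes Z$, where $S_m^n$ acts factorwise on $W^{\otimes n}$ and trivially on $Z$, and $S_n$ acts by permuting the tensor factors of $W^{\otimes n}$ (no signs) and by its given action on $Z$. The generalized Foulkes module is $H_\mu^\nu=(S^\mu\oslash S^\nu)\uparrow_{S_m\wr S_n}^{S_{mn}}$. *)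

(* Defs.v *)
From mathcomp Require Import all_boot all_order all_algebra all_fingroup.
From mathcomp Require Import mxrepresentation.

Set Implicit Arguments.
Unset Strict Implicit.
Unset Printing Implicit Defensive.

Import GroupScope GRing.Theory.
Local Open Scope ring_scope.

(* Modules for S_n are right modules: permutations compose from left to right *)
(* ((s * t) i = t (s i)), and a matrix representation acts on row vectors by  *)
(* right multiplication.                                                      *)

Definition is_partition (n : nat) (la : seq nat) : bool :=
  [&& sorted geq la, 0%N \notin la & sumn la == n].

Definition conj_partition (la : seq nat) : seq nat :=
  [seq count (leq j) la | j <- iota 1 (head 0%N la)].

(* [take k] returns the whole sequence for large k, as if the partition were *)
(* padded with zeros.                                                        *)
Definition dominated (la mu : seq nat) : Prop :=
  forall k, (sumn (take k la) <= sumn (take k mu))%N.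

Definition rectangular (mu : seq nat) : Prop :=
  exists a b, [/\ (0 < a)%N, (0 < b)%N & mu = nseq b a].

(* The partition (n); for n = 0 it is the empty partition. *)
Definition row_partition (n : nat) : seq nat := nseq (0 < n) n.

Section FunMx.
Variables (F : fieldType) (T : finType).

Definition fun_mx (f : T -> T -> F) : 'M[F]_#|T| :=
  \matrix_(i, j) f (enum_val i) (enum_val j).

Lemma fun_mxM (f g : T -> T -> F) :
  fun_mx f *m fun_mx g = fun_mx (fun x z => \sum_y f x y * g y z).
Proof.
apply/matrixP=> i k; rewrite !mxE [RHS](reindex (@enum_val T T)) /=; last first.
  exact/onW_bij/enum_val_bij.
by apply: eq_bigr => j _; rewrite !mxE.
Qed.

Lemma fun_mx1 (f : T -> T -> F) :
  (forall x y, f x y = (x == y)%:R) -> fun_mx f = 1%:M.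
Proof.
by move=> f1; apply/matrixP=> i j; rewrite !mxE f1 (inj_eq enum_val_inj).
Qed.

Lemma eq_fun_mx (f g : T -> T -> F) : f =2 g -> fun_mx f = fun_mx g.
Proof. by move=> fg; apply/matrixP=> i j; rewrite !mxE fg. Qed.

End FunMx.

Lemma sum_pair (R : nmodType) (I J : finType) (f : I * J -> R) :
  \sum_x f x = \sum_i \sum_j f (i, j).
Proof. by rewrite pair_bigA; apply: eq_bigr => -[]. Qed.

Section Cosets.
Variables (gT : finGroupType) (H : {group gT}).

Definition right_coset := {A : {set gT} | A \in rcosets H [set: gT]}.

Lemma coset_of_elt_subproof x : H :* x \in rcosets H [set: gT].
Proof. by rewrite mem_rcosets mulSGid ?subsetT // inE. Qed.

Definition coset_of_elt x : right_coset := Sub (H :* x) (coset_of_elt_subproof x).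

Lemma coset_act_subproof (A : right_coset) g :
  val A :* g \in rcosets H [set: gT].
Proof.
case: A => _ /= /rcosetsP[x _ ->].
by rewrite -rcosetM coset_of_elt_subproof.
Qed.

Definition coset_act (A : right_coset) g : right_coset :=
  Sub (val A :* g) (coset_act_subproof A g).

Lemma coset_actM A g h : coset_act A (g * h)%g = coset_act (coset_act A g) h.
Proof. by apply: val_inj; rewrite /= rcosetM. Qed.

Lemma coset_act1 A : coset_act A 1%g = A.
Proof. by apply: val_inj; rewrite /= rcoset1. Qed.

Lemma coset_of_eltM x g : coset_act (coset_of_elt x) g = coset_of_elt (x * g)%g.
Proof. by apply: val_inj; rewrite /= rcosetM. Qed.

Lemma coset_repr (A : right_coset) : val A = H :* repr (val A).
Proof. by case: A => _ /= /rcosetsP[x _ ->]; rewrite rcoset_repr. Qed.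

Lemma mem_coset_repr (A B : right_coset) g :
  (repr (val A) * g * (repr (val B))^-1 \in H)%g = (coset_act A g == B).
Proof.
rewrite -mem_rcoset -coset_repr -val_eqE /= [in RHS]coset_repr -rcosetM.
rewrite [val B]coset_repr; apply/idP/eqP=> [/rcoset_eqP // | <-].
exact: rcoset_refl.
Qed.

Section CosetRepr.
Variable F : fieldType.

Definition coset_mx (g : gT) : 'M[F]_#|{: right_coset}| :=
  fun_mx (fun A B => (coset_act A g == B)%:R).

Lemma coset_mx_repr : mx_repr [set: gT] coset_mx.
Proof.
split=> [|g h _ _]; first by apply: fun_mx1 => A B; rewrite coset_act1.
rewrite fun_mxM; apply: eq_fun_mx => A C.
rewrite (bigD1 (coset_act A g)) //= eqxx mul1r big1 ?addr0 -?coset_actM //.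
by move=> B; rewrite eq_sym => /negPf->; rewrite mul0r.
Qed.

Definition coset_repr_mx := MxRepresentation coset_mx_repr.

(* The module V (x)_{FH} FG, where G is the whole group: it has basis the     *)
(* e_i (x) r, where r runs over representatives of the right cosets of H, and *)
(* (e_i (x) r) g = e_i h (x) r' where r g = h r' with h \in H.                *)
Variables (d : nat) (rV : mx_representation F H d).

Definition induced_mx (g : gT) : 'M[F]_#|{: right_coset * 'I_d}| :=
  fun_mx (fun Ai Bj =>
    let h := (repr (val Ai.1) * g * (repr (val Bj.1))^-1)%g in
    if h \in H then rV h Ai.2 Bj.2 else 0).

Lemma induced_mx_repr : mx_repr [set: gT] induced_mx.
Proof.
split=> [|g h _ _].
  apply: fun_mx1 => -[A i] [B j] /=.
  rewrite mem_coset_repr coset_act1 xpair_eqE; case: eqP => //= ->.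
  by rewrite mulg1 mulgV repr_mx1 mxE.
rewrite fun_mxM; apply: eq_fun_mx => -[A i] [C k] /=.
rewrite sum_pair /=.
rewrite (bigD1 (coset_act A g)) //= [X in _ + X]big1 => [|B nAB]; last first.
  rewrite big1 // => j _.
  by rewrite mem_coset_repr eq_sym (negPf nAB) mul0r.
set B := coset_act A g; rewrite addr0.
have HB: (repr (val A) * g * (repr (val B))^-1 \in H)%g by rewrite mem_coset_repr.
rewrite HB; set a := repr (val A); set b := repr (val B); set c := repr (val C).
have Dabc: (a * (g * h) * c^-1 = (a * g * b^-1) * (b * h * c^-1))%g.
  by rewrite !mulgA mulgKV.
have [Hbc|nHbc] := boolP (b * h * c^-1 \in H)%g; last first.
  rewrite big1 => [|j _]; last by rewrite mulr0.
  by rewrite Dabc groupMl // (negPf nHbc).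
by rewrite Dabc groupM // repr_mxM // mxE.
Qed.

Definition induced_repr := MxRepresentation induced_mx_repr.

End CosetRepr.
End Cosets.

(* A tableau of shape la is a permutation t : 'S_n, sending the c-th cell of  *)
(* the Young diagram of la, in reading order, to its entry. S_n acts on the   *)
(* entries, i.e., by right multiplication. The c-th cell is in row            *)
(* [reshape_index la c] and column [reshape_offset la c].                     *)

Section FiberStab.
Variables (n : nat) (f : nat -> nat).

Definition fiber_stab : {set 'S_n} := [set s : 'S_n | [forall c, f (s c) == f c]].

Lemma fiber_stab_group_set : group_set fiber_stab.
Proof.
apply/group_setP; split=> [|s t]; rewrite !inE.
  by apply/forallP=> c; rewrite perm1.
move=> /forallP fs /forallP ft; apply/forallP=> c.
by rewrite permM (eqP (ft _)).
Qed.

Definition fiber_stab_group : {group 'S_n} := group fiber_stab_group_set.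

End FiberStab.

Section Specht.
Variables (n : nat) (la : seq nat).

(* The permutations of the cells that preserve each row, resp. column. *)
Definition row_group := fiber_stab_group n (reshape_index la).
Definition column_group := fiber_stab_group n (reshape_offset la).

(* The tableaux that are row-equivalent to t are the r * t with r in the row  *)
(* group, so a tabloid is a right coset of the row group.                     *)
Definition tabloid := right_coset row_group.

Definition tabloid_of (t : 'S_n) : tabloid := coset_of_elt row_group t.

Definition tabloid_repr :
    mx_representation rat [set: 'S_n] #|{: tabloid}| :=
  coset_repr_mx row_group rat.

Definition tabloid_vect (A : tabloid) : 'rV[rat]_#|{: tabloid}| :=
  delta_mx 0 (enum_rank A).

(* The column stabiliser of t is the conjugate of the column group by t, as  *)
(* it permutes entries rather than cells.                                    *)
Definition polytabloid (t : 'S_n) : 'rV[rat]_#|{: tabloid}| :=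
  \sum_(p in column_group :^ t)
    (-1) ^+ (odd_perm p) *: tabloid_vect (coset_act (tabloid_of t) p).

Definition specht_mx : 'M[rat]_#|{: tabloid}| :=
  (\sum_(t : 'S_n) <<polytabloid t>>)%MS.

Lemma tabloid_vect_repr A g :
  tabloid_vect A *m tabloid_repr g = tabloid_vect (coset_act A g).
Proof.
rewrite /tabloid_vect -rowE; apply/rowP=> j; rewrite !mxE enum_rankK eqxx /=.
by rewrite -(can_eq enum_rankK) enum_valK eq_sym.
Qed.

Lemma polytabloid_repr t g :
  polytabloid t *m tabloid_repr g = polytabloid (t * g)%g.
Proof.
rewrite /polytabloid mulmx_suml conjsgM [RHS](reindex_inj (conjg_inj g)) /=.
apply: eq_big => [p|p _]; first by rewrite memJ_conjg.
rewrite -scalemxAl tabloid_vect_repr odd_permJ; congr (_ *: tabloid_vect _).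
by rewrite /tabloid_of -!coset_actM !coset_of_eltM conjgE !mulgA mulgK.
Qed.

Lemma specht_module : mxmodule tabloid_repr specht_mx.
Proof.
apply/mxmoduleP=> g _; rewrite sumsmxMr; apply/sumsmx_subP=> t _.
rewrite (eqmxMr _ (genmxE _)) polytabloid_repr.
by apply: (sumsmx_sup (t * g)%g); rewrite ?genmxE.
Qed.

Definition specht : mx_representation rat [set: 'S_n] (\rank specht_mx) :=
  submod_repr specht_module.

End Specht.

Section Wreath.
Variables m n : nat.

(* The set of size m * n is split into n blocks of size m; [cell k i] is the *)
(* k-th element of block i.                                                  *)
Definition cell (k : 'I_m) (i : 'I_n) : 'I_(m * n) := mxvec_index k i.

Definition cell_inv (x : 'I_(m * n)) : 'I_m * 'I_n :=
  enum_val (cast_ord (esym (mxvec_cast m n)) x).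

Lemma cellK k i : cell_inv (cell k i) = (k, i).
Proof. by rewrite /cell_inv cast_ordK enum_rankK. Qed.

Lemma cell_invK x : cell (cell_inv x).1 (cell_inv x).2 = x.
Proof. by case/mxvec_indexP: x => k i; rewrite cellK. Qed.

(* Apply f i to block i for each i, then permute the blocks by s. *)
Definition wreath_fun (f : {ffun 'I_n -> 'S_m}) (s : 'S_n) x :=
  let ki := cell_inv x in cell (f ki.2 ki.1) (s ki.2).

Lemma wreath_fun_inj f s : injective (wreath_fun f s).
Proof.
move=> x y /(congr1 cell_inv); rewrite !cellK => -[].
move=> + /perm_inj E; rewrite E => /perm_inj E'.
by rewrite -[x]cell_invK E E' cell_invK.
Qed.

Definition wreath_perm f s : 'S_(m * n) := perm (@wreath_fun_inj f s).

Lemma wreath_permE f s k i : wreath_perm f s (cell k i) = cell (f i k) (s i).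
Proof. by rewrite permE /wreath_fun cellK. Qed.

Definition wreath : {set 'S_(m * n)} :=
  [set wreath_perm fs.1 fs.2 | fs : {ffun 'I_n -> 'S_m} * 'S_n].

Lemma wreathP g : reflect (exists f s, g = wreath_perm f s) (g \in wreath).
Proof.
apply: (iffP imsetP) => [[[f s] _ ->]|[f [s ->]]]; first by exists f, s.
by exists (f, s).
Qed.

Lemma perm_cellP (g h : 'S_(m * n)) :
  (forall k i, g (cell k i) = h (cell k i)) -> g = h.
Proof. by move=> gh; apply/permP=> x; rewrite -[x]cell_invK gh. Qed.

Lemma wreath_perm1 : wreath_perm [ffun=> 1%g] 1 = 1%g.
Proof. by apply: perm_cellP => k i; rewrite wreath_permE ffunE !perm1. Qed.

Lemma wreath_permM f s f' s' :
  (wreath_perm f s * wreath_perm f' s')%g =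
    wreath_perm [ffun i => f i * f' (s i)]%g (s * s').
Proof. by apply: perm_cellP => k i; rewrite permM !wreath_permE ffunE !permM. Qed.

Lemma wreath_group_set : group_set wreath.
Proof.
apply/group_setP; split=> [|g h].
  by apply/wreathP; exists [ffun=> 1%g], 1%g; rewrite wreath_perm1.
move=> /wreathP[f [s ->]] /wreathP[f' [s' ->]]; rewrite wreath_permM.
by apply/wreathP; do 2!eexists.
Qed.

Definition wreath_group : {group 'S_(m * n)} := group wreath_group_set.

(* The components of an element of the wreath product. They are determined   *)
(* by the element, except that when m = 0 the block permutation is not, and  *)
(* is then taken to be the identity.                                         *)
Definition wreath_base (g : 'S_(m * n)) : {ffun 'I_n -> 'S_m} :=
  odflt [ffun=> 1%g] [pick f | [exists s, g == wreath_perm f s]].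

Definition wreath_top (g : 'S_(m * n)) : 'S_n :=
  odflt 1%g [pick s | (0 < m)%N && [exists f, g == wreath_perm f s]].

Lemma wreath_baseE f s : wreath_base (wreath_perm f s) = f.
Proof.
rewrite /wreath_base; case: pickP => [f' /existsP[s' /eqP/permP E]|] /=.
  apply/ffunP=> i; apply/permP=> k; move/(_ (cell k i)): E.
  by rewrite !wreath_permE => /(congr1 cell_inv); rewrite !cellK => -[].
by move=> /(_ f)/existsP[]; exists s.
Qed.

Lemma wreath_topE f s :
  wreath_top (wreath_perm f s) = if (0 < m)%N then s else 1%g.
Proof.
rewrite /wreath_top; case: ltnP => [m_gt0 | _] /=; last by case: pickP.
case: pickP => [s' /existsP[f' /eqP/permP E]|] /=.
  apply/permP=> i; move/(_ (cell (Ordinal m_gt0) i)): E.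
  by rewrite !wreath_permE => /(congr1 cell_inv); rewrite !cellK => -[].
by move=> /(_ s)/existsP[]; exists f.
Qed.

Section Oslash.
Variables (F : fieldType) (d e : nat).
Variables (rW : mx_representation F [set: 'S_m] d).
Variables (rZ : mx_representation F [set: 'S_n] e).

(* The basis vector e_{a 0} (x) ... (x) e_{a (n-1)} (x) z_p is indexed by the *)
(* pair (a, p). The i-th factor e_{a i} is acted on by the i-th component of  *)
(* the base group and then becomes the (s i)-th factor.                       *)
Definition oslash_mx (g : 'S_(m * n)) : 'M[F]_#|{: {ffun 'I_n -> 'I_d} * 'I_e}| :=
  let f := wreath_base g in let s := wreath_top g in
  fun_mx (fun ap bq : {ffun 'I_n -> 'I_d} * 'I_e =>
    (\prod_(i < n) rW (f i) (ap.1 i) (bq.1 (s i))) * rZ s ap.2 bq.2).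

Lemma oslash_mx_repr : mx_repr wreath_group oslash_mx.
Proof.
have top1: wreath_top 1 = 1%g by rewrite -wreath_perm1 wreath_topE if_same.
have base1: wreath_base 1 = [ffun=> 1%g] by rewrite -wreath_perm1 wreath_baseE.
split=> [|g h /wreathP[f [s ->]] /wreathP[f' [s' ->]]].
  apply: fun_mx1 => -[a p] [b q] /=; rewrite top1 base1 repr_mx1 mxE xpair_eqE.
  case: (altP (a =P b)) => [<-|nab] /=.
    by rewrite big1 ?mul1r // => i _; rewrite ffunE perm1 repr_mx1 mxE eqxx.
  have [i nabi] : exists i, a i != b i.
    apply/existsP; apply: contraR nab; rewrite negb_exists => /forallP ab.
    by apply/eqP/ffunP=> i; apply/eqP; rewrite -[_ == _]negbK ab.
  by rewrite (bigD1 i) //= ffunE perm1 repr_mx1 mxE (negPf nabi) !mul0r.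
rewrite /oslash_mx wreath_permM !wreath_baseE !wreath_topE fun_mxM.
apply: eq_fun_mx => -[a p] [c r] /=.
set t := if _ then s else _; set t' := if _ then s' else _.
have ->: (if (0 < m)%N then s * s' else 1)%g = (t * t')%g.
  by rewrite /t /t'; case: ifP; rewrite ?mulg1.
have Ef i : [ffun i0 => f i0 * f' (s i0)]%g i = (f i * f' (t i))%g.
  rewrite ffunE /t; case: ifPn => //; rewrite -eqn0Ngt => m0; congr (_ * _)%g.
  by apply/permP=> -[k lt_km]; exfalso; rewrite (eqP m0) in lt_km.
rewrite sum_pair /=.
rewrite repr_mxM ?inE // mxE.
under eq_bigr do rewrite Ef repr_mxM ?inE // mxE permM.
rewrite bigA_distr_bigA /= big_distrl /=.
rewrite (reindex (fun b : {ffun 'I_n -> 'I_d} => [ffun i => b (t i)])) /=; last first.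
  exists (fun b : {ffun 'I_n -> 'I_d} => [ffun i => b (t^-1 i)%g]) => b _;
  by apply/ffunP=> i; rewrite !ffunE ?permKV ?permK.
apply: eq_bigr => b _; rewrite mulr_sumr; apply: eq_bigr => q _.
rewrite [X in _ = _ * (X * _)](reindex_inj (@perm_inj _ t)) /= mulrACA -big_split /=.
by congr (_ * _); apply: eq_bigr => i _; rewrite ffunE.
Qed.

Definition oslash := MxRepresentation oslash_mx_repr.

End Oslash.
End Wreath.

Definition foulkes (m n : nat) (mu nu : seq nat) :=
  induced_repr (oslash (specht m mu) (specht n nu)).

Definition is_summand (F : fieldType) (gT : finGroupType) (G : {group gT})
    (d e : nat) (rU : mx_representation F G e) (rV : mx_representation F G d) :=
  exists (U K : 'M[F]_d) (modU : mxmodule rV U),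
    [/\ mxmodule rV K, (U + K == 1%:M)%MS, mxdirect (U + K)
      & mx_rsim (submod_repr modU) rU].

Definition specht_summand (m n : nat) (mu nu la : seq nat) : Prop :=
  is_partition (m * n) la /\ is_summand (specht (m * n) la) (foulkes m n mu nu).

Definition maximal_summand (m n : nat) (mu nu la : seq nat) : Prop :=
  specht_summand m n mu nu la /\
  forall la', specht_summand m n mu nu la' -> dominated la la' -> la' = la.

Definition minimal_summand (m n : nat) (mu nu la : seq nat) : Prop :=
  specht_summand m n mu nu la /\
  forall la', specht_summand m n mu nu la' -> dominated la' la -> la' = la.

(* Main.v *)
(* The weight c of a module X of S_n, for a colouring c of {1..n}, is present *)
(* when the Young subgroup of c has a nonzero fixed vector in X. A weight     *)
(* present in S^la is dominated by la, and la itself is present, so X has a   *)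
(* unique maximal summand if and only if its weights have a maximum.          *)
(*   Highest weight theory needs that every irreducible module is a Specht    *)
(* module. If v is fixed by the row group R of la and killed by all operators *)
(* that move a box to a higher row, then straightening gives v g R = c_g v    *)
(* for scalars c_g that depend on neither v nor the module. Computing in      *)
(* S^la shows that the resulting scalar of C^- R is nonzero, hence v C^- is   *)
(* nonzero and spans a copy of S^la.                                          *)
(*   By Mackey's formula the weights of the Foulkes module are those of the   *)
(* plethystic tableaux: fillings of the n blocks by basis vectors of weight   *)
(* spaces of S^mu, such that the multiplicities of these entries form a       *)
(* weight of S^nu. If all occurrences of an entry of a maximum tableau are    *)
(* traded for an unused entry, then the weight must not increase.             *)
(* Unless nu = (n), or mu is rectangular and nu has two parts, this is        *)
(* contradicted by an entry obtained from the highest weight mu by a single   *)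
(* box move at another corner (mu not rectangular), or by a double box move   *)
(* (mu rectangular, where the two highest weight spaces are lines). Minimal   *)
(* summands reduce to maximal ones by twisting with the sign character.       *)

Require Import Defs.
From mathcomp Require Import all_boot all_order all_algebra all_fingroup.
From mathcomp Require Import pgroup mxrepresentation zify ring.
From Stdlib Require Import Classical.
Set Implicit Arguments.
Unset Strict Implicit.
Unset Printing Implicit Defensive.


(** * Modules over the rationals *)

(** A weight of a module is a colouring whose Young subgroup [stab c] has a nonzero fixed vector.
    Every irreducible module is a Specht module ([irr_specht]), and the weights of S^la are
    dominated by la, which is one of them. So a unique maximal summand exists exactly when one
    weight dominates all others ([unique_maximal_summandP]). The irreducibility of S^la and its
    universal property both rest on [straightening], whose scalars can be evaluated in S^la and then
    used in any module.

    By [foulkes_rfixP] the weights of the Foulkes module are the total contents of plethystic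
    tableaux. Block i carries a content [C i] and the index of a basis vector of that weight space
    of S^mu, and these labels must form a weight of S^nu. The content mu ([top]) has a
    one-dimensional weight space, so at most nu_1 blocks carry it. If nu = (n), all blocks can carry
    it and this is the maximum. If mu is rectangular, every other content places a box below the
    rows of mu, and the highest such content is mu with its last corner moved to a new row; with two
    rows in nu these two contents give a maximum ([rect_two_rows_maximum]).

    If mu has two corners, box moves at the two corners make incompatible demands
    ([corners_not_maximum]). If mu is rectangular, trading for a double box move shows that only the
    two highest contents occur; both weight spaces are lines, so nu has at most two rows
    ([rect_maximum_tall], [rect_maximum_flat]).

    For minimal summands, the sign twist conjugates the labels and reverses dominance. The twisted
    Foulkes module has the weights of the one with inner label mu' and outer label nu' for odd m, nu
    for even m ([rfix_twisted_foulkes]), which is where kappa comes from. *)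

Section Modules.
Import GroupScope GRing.Theory Num.Theory.
Local Open Scope ring_scope.
Variables (gT : finGroupType) (G : {group gT}).

Definition intertwines (e d : nat) (rU : mx_representation rat G e)
    (rV : mx_representation rat G d) (f : 'M_(e, d)) :=
  forall x, x \in G -> rU x *m f = f *m rV x.

Lemma pgroup_rat : [pchar rat]^'.-group G.
Proof. by apply: sub_pgroup (pgroup_pi G) => p _; rewrite inE /= pchar_num. Qed.

Lemma rfix_neq0P (d : nat) (rV : mx_representation rat G d) (K : {set gT}) :
  reflect (exists2 v : 'rV_d, v != 0 & forall x, x \in K -> v *m rV x = v)
          (rfix_mx rV K != 0).
Proof.
apply: (iffP rowV0Pn) => [[v /rfix_mxP vK nzv]|[v nzv vK]]; first by exists v.
by exists v => //; apply/rfix_mxP.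
Qed.

Lemma intertwines_free (e d : nat) (rU : mx_representation rat G e)
    (rV : mx_representation rat G d) f :
  mx_irreducible rU -> intertwines rU rV f -> f != 0 -> row_free f.
Proof.
move=> /mx_irrP[_ irrU] homf nzf; rewrite -kermx_eq0; apply: contraR nzf => nzK.
have modK: mxmodule rU (kermx f).
  apply/mxmoduleP=> x Gx; apply/sub_kermxP.
  by rewrite -mulmxA homf // mulmxA mulmx_ker mul0mx.
have:= irrU _ modK nzK; rewrite -sub1mx => /sub_kermxP.
by rewrite mul1mx => ->.
Qed.

Lemma irr_intertwines_rsim (e d : nat) (rU : mx_representation rat G e)
    (rV : mx_representation rat G d) f :
  mx_irreducible rU -> mx_irreducible rV -> intertwines rU rV f -> f != 0 ->
  mx_rsim rU rV.
Proof.
move=> irrU /mx_irrP[_ irrV] homf nzf.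
have freef := intertwines_free irrU homf nzf; exists f => //.
have modf: mxmodule rV <<f>>%MS.
  apply/mxmoduleP=> x Gx; rewrite !(eqmxMr _ (genmxE _)) genmxE -homf //.
  exact: submxMl.
have:= irrV _ modf; rewrite -mxrank_eq0 genmxE mxrank_eq0 => /(_ nzf).
rewrite /row_full genmxE => /eqP <-; exact/esym/eqP.
Qed.

Lemma summand_intertwines (e d : nat) (rU : mx_representation rat G e)
    (rV : mx_representation rat G d) :
  is_summand rU rV -> exists2 f, intertwines rU rV f & row_free f.
Proof.
case=> U [K [modU [_ _ _ /mx_rsim_sym[B eqr freeB homB]]]].
exists (val_submod B) => [x Gx|]; last first.
  by rewrite /row_free mxrankMfree ?row_base_free.
by rewrite -val_submodJ // -homB // [in LHS]val_submodE [RHS]val_submodE mulmxA.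
Qed.

Lemma intertwines_summand (e d : nat) (rU : mx_representation rat G e)
    (rV : mx_representation rat G d) f :
  mx_irreducible rU -> intertwines rU rV f -> f != 0 -> is_summand rU rV.
Proof.
move=> irrU homf nzf; have freef := intertwines_free irrU homf nzf.
have modf: mxmodule rV <<f>>%MS.
  apply/mxmoduleP=> x Gx; rewrite !(eqmxMr _ (genmxE _)) genmxE -homf //.
  exact: submxMl.
have [K modK defK dxK] := mx_Maschke_pchar rV pgroup_rat modf (submx1 _).
exists <<f>>%MS, K, modf; split=> //; first exact/eqmxP.
apply: mx_rsim_sym; have sf: (f <= <<f>>)%MS by rewrite genmxE.
exists (in_submod <<f>>%MS f) => [||x Gx].
- by rewrite genmxE; apply/esym/eqP.
- by rewrite /row_free mxrank_in_submod.
- rewrite -in_submodJ // -homf //; rewrite [LHS](_ : _ = in_submod _ (rU x *m f)) //.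
  by rewrite in_submodE mulmxA -in_submodE.
Qed.

Lemma rank_rfix_rsim (e d : nat) (rU : mx_representation rat G e)
    (rV : mx_representation rat G d) (K : {set gT}) :
  K \subset G -> mx_rsim rU rV -> \rank (rfix_mx rU K) = \rank (rfix_mx rV K).
Proof.
suff le (e' d' : nat) (rU' : mx_representation rat G e')
    (rV' : mx_representation rat G d') :
  K \subset G -> mx_rsim rU' rV' ->
  (\rank (rfix_mx rU' K) <= \rank (rfix_mx rV' K))%N.
  by move=> sKG UV; apply/eqP; rewrite eqn_leq !le //; apply: mx_rsim_sym.
move=> sKG [f _ freef homf]; rewrite -(mxrankMfree _ freef) mxrankS //.
apply/rfix_mxP=> x Kx; rewrite -mulmxA -homf ?(subsetP sKG) // mulmxA.
by rewrite rfix_mx_id.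
Qed.

Lemma rfix_neq0_rsim (e d : nat) (rU : mx_representation rat G e)
    (rV : mx_representation rat G d) (K : {set gT}) :
  K \subset G -> mx_rsim rU rV -> (rfix_mx rU K != 0) = (rfix_mx rV K != 0).
Proof. by move=> sKG sim; rewrite -!mxrank_eq0 (rank_rfix_rsim sKG sim). Qed.

Lemma rfix_intertwines (e d : nat) (rU : mx_representation rat G e)
    (rV : mx_representation rat G d) (K : {set gT}) f :
  K \subset G -> intertwines rU rV f -> row_free f ->
  rfix_mx rU K != 0 -> rfix_mx rV K != 0.
Proof.
move=> sKG homf freef /rfix_neq0P[v nzv vK]; apply/rfix_neq0P.
exists (v *m f) => [|x Kx]; last by rewrite -mulmxA -homf ?(subsetP sKG) // mulmxA vK.
by rewrite -mxrank_eq0 mxrankMfree // mxrank_eq0.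
Qed.

(* The sum over K maps the whole module, hence some simple submodule, onto    *)
(* nonzero K-fixed vectors.                                                   *)
Lemma rfix_irr (d : nat) (rV : mx_representation rat G d) (K : {group gT}) :
  K \subset G -> rfix_mx rV K != 0 ->
  exists (e : nat) (rU : mx_representation rat G e) (f : 'M_(e, d)),
    [/\ mx_irreducible rU, intertwines rU rV f, row_free f & rfix_mx rU K != 0].
Proof.
move=> sKG /rfix_neq0P[v nzv vK].
apply: NNPP => noU.
have redV := mx_Maschke_pchar rV pgroup_rat.
have := mx_reducible_semisimple (mxmodule1 rV) redV.
suff noss: mxsemisimple rV 1%:M -> False by 
  by move=> /(_ false) /(_ (fun s => False_ind _ (noss s))).
case=> I U /= simU defU _.
case: noU.
pose E := \sum_(g in K) rV g.
have [i nzUE]: exists i, U i *m E != 0.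
  apply/existsP; apply: contraR nzv => /existsPn UE0.
  have: (1%:M <= kermx E)%MS.
    rewrite -defU; apply/sumsmx_subP=> i _; apply/sub_kermxP/eqP.
    by have:= UE0 i; rewrite negbK.
  move=> /sub_kermxP; rewrite mul1mx => E0.
  have: v *m E = v *+ #|K|.
    by rewrite mulmx_sumr (eq_bigr (fun=> v)) ?sumr_const.
  rewrite E0 mulmx0 => /eqP; rewrite eq_sym -scaler_nat scaler_eq0.
  by rewrite pnatr_eq0 (negPf (lt0n_neq0 (cardG_gt0 K))).
have [modU nzU _] := simU i.
exists (\rank (U i)), (submod_repr modU), (val_submod 1%:M); split.
- exact/submod_mx_irr.
- by move=> x Gx; rewrite -val_submodJ // mul1mx [RHS]val_submodE.
- by rewrite /row_free val_submod1.
have [j nzj]: exists j, row j (U i *m E) != 0.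
  apply/existsP; apply: contraR nzUE => /existsPn r0; apply/eqP/row_matrixP=> j.
  by have:= r0 j; rewrite negbK row0 => /eqP.
set w := row j _ in nzj.
have Uw: (w <= U i)%MS.
  rewrite (submx_trans (row_sub _ _)) // mulmx_sumr summx_sub // => g Kg.
  by rewrite (mxmoduleP modU) // (subsetP sKG).
apply/rfix_neq0P; exists (in_submod (U i) w) => [|x Kx].
  by apply: contraNneq nzj => w0; rewrite -(in_submodK Uw) w0 linear0.
rewrite -in_submodJ ?(subsetP sKG) //; congr in_submod.
rewrite /w row_mul -!mulmxA; congr (_ *m _).
rewrite mulmx_suml [RHS](reindex_acts 'R _ Kx) ?astabsR //=.
by apply: eq_bigr => g Kg; rewrite -repr_mxM ?(subsetP sKG).
Qed.

End Modules.

(** * Colourings and the cells of a partition *)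

Section Stab.
Variables (n : nat) (T : eqType).
Implicit Types c : 'I_n -> T.

(** The Young subgroup of the colour classes. Colours may be of any type, since pairs of a content
    and an index serve as colours later. *)
Definition stab c : {set 'S_n} := [set s : 'S_n | [forall x, c (s x) == c x]].

Lemma stabP c (s : 'S_n) : reflect (forall x, c (s x) = c x) (s \in stab c).
Proof. by rewrite inE; apply: (iffP forallP) => cs x; apply/eqP/cs. Qed.

Lemma stab_group_set c : group_set (stab c).
Proof.
apply/group_setP; split=> [|s t /stabP cs /stabP ct]; apply/stabP=> x.
  by rewrite perm1.
by rewrite permM ct cs.
Qed.

Canonical stab_group c := group (stab_group_set c).

Lemma tperm_stab c x y : c x = c y -> tperm x y \in stab c.
Proof. by move=> cxy; apply/stabP=> z; case: tpermP => // ->. Qed.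

Lemma stab_conj c (g s : 'S_n) : (s \in stab c :^ g)%g = (s \in stab (c \o (g^-1)%g)).
Proof.
apply/imsetP/stabP => [[h /stabP ch -> x]|cs].
  by rewrite /= conjgE !permM permK ch.
exists (s ^ g^-1)%g; last by rewrite conjgKV.
apply/stabP=> x; have /= := cs (g x).
by rewrite conjgE invgK !permM permK.
Qed.

End Stab.

Lemma eq_stab n (T U : eqType) (c : 'I_n -> T) (c' : 'I_n -> U) :
  (forall x y, (c x == c y) = (c' x == c' y)) -> stab c = stab c'.
Proof. by move=> cc'; apply/setP=> s; rewrite !inE; apply: eq_forallb. Qed.

Section Partition.
Variables (n : nat) (la : seq nat).
Hypothesis part_la : is_partition n la.

Lemma sumn_partition : sumn la = n.
Proof. by case/and3P: part_la => _ _ /eqP. Qed.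

Lemma nth_partition_gt0 i : (0 < nth 0 la i) = (i < size la).
Proof.
case/and3P: part_la => _ la0 _; have [lt_i|le_i] := ltnP i (size la).
  by rewrite lt0n; apply: contraNneq la0 => <-; rewrite mem_nth.
by rewrite nth_default.
Qed.

Lemma nth_partition_le i j : i <= j -> nth 0 la j <= nth 0 la i.
Proof.
case/and3P: part_la => sla _ _ le_ij.
have [lt_j|le_j] := ltnP j (size la); last by rewrite nth_default.
have geq_tr : transitive geq by move=> y x z /=; lia.
have geq_refl : reflexive geq by move=> x /=.
by apply: (sorted_leq_nth geq_tr geq_refl 0 sla); rewrite ?inE //; lia.
Qed.

Definition cell_row (x : 'I_n) := reshape_index la x.
Definition cell_col (x : 'I_n) := reshape_offset la x.

Lemma ltn_sumn (x : 'I_n) : x < sumn la.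
Proof. by rewrite sumn_partition. Qed.

Lemma row_lt x : cell_row x < size la.
Proof. exact/reshape_indexP/ltn_sumn. Qed.

Lemma col_lt x : cell_col x < nth 0 la (cell_row x).
Proof. exact/reshape_offsetP/ltn_sumn. Qed.

Lemma cell_inj x y : cell_row x = cell_row y -> cell_col x = cell_col y -> x = y.
Proof.
move=> rxy cxy; apply: val_inj.
by rewrite /= -(reshape_indexK la x) -(reshape_indexK la y); congr flatten_index.
Qed.

Lemma cell_ex r c : c < nth 0 la r -> exists2 x, cell_row x = r & cell_col x = c.
Proof.
move=> lt_c; have lt_x: flatten_index la r c < n.
  by rewrite -sumn_partition; apply: flatten_indexP.
by exists (Ordinal lt_x); rewrite /cell_row /cell_col /= ?flatten_indexKl ?flatten_indexKr.
Qed.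

Lemma sumn_take k : sumn (take k la) = \sum_(i < k) nth 0 la i.
Proof.
elim: k la => [|k IH] [|a s] //=; rewrite ?big_ord0 //.
  by rewrite big1 // => i _; rewrite nth_nil.
by rewrite big_ord_recl /= IH.
Qed.

Lemma card_row k : #|[set x | cell_row x == k]| = nth 0 la k.
Proof.
rewrite -[RHS]card_ord -cardsT.
have cellP (j : 'I_(nth 0 la k)) : exists x, (cell_row x == k) && (cell_col x == j).
  by have [x rx cx] := cell_ex (ltn_ord j); exists x; rewrite rx cx !eqxx.
pose f j := xchoose (cellP j); have fP j := xchooseP (cellP j).
rewrite -(card_imset _ (_ : injective f)); last first.
  by move=> i j eqf; case/andP: (fP i) (fP j) => _ /eqP; rewrite /f in eqf *;
    rewrite eqf => ci /andP[_ /eqP]; rewrite ci => /val_inj.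
apply: eq_card => x; rewrite inE; apply/eqP/imsetP=> [rx|[j _ ->]]; last first.
  by case/andP: (fP j) => /eqP.
have lt_cx : cell_col x < nth 0 la k by rewrite -rx col_lt.
exists (Ordinal lt_cx) => //; case/andP: (fP (Ordinal lt_cx)) => /eqP rf /eqP cf.
by apply: cell_inj; rewrite ?rf ?cf.
Qed.

Lemma card_row_lt k : #|[set x | cell_row x < k]| = sumn (take k la).
Proof.
rewrite sumn_take; elim: k => [|k IH].
  by rewrite big_ord0; apply/eqP; rewrite cards_eq0 -subset0; apply/subsetP=> x; rewrite inE.
rewrite big_ord_recr /= -IH -card_row -cardsUI.
rewrite [X in _ = _ + X](_ : _ = 0) ?addn0; last first.
  by apply/eqP; rewrite cards_eq0 -subset0; apply/subsetP=> x; rewrite !inE; lia.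
by apply: eq_card => x; rewrite !inE; lia.
Qed.

Definition column_injective (T : Type) (c : 'I_n -> T) :=
  forall x y, cell_col x = cell_col y -> c x = c y -> x = y.

Section ColumnInjective.
Variables (T : eqType) (c : 'I_n -> T).
Hypothesis injc : column_injective c.

(* Push the cells coloured by ks to the top of their columns: they then lie   *)
(* in the first [size ks] rows.                                               *)
Lemma column_injective_le ks :
  #|[set x | c x \in ks]| <= sumn (take (size ks) la).
Proof.
pose above x := [set y | [&& c y \in ks, cell_col y == cell_col x & cell_row y < cell_row x]].
have above_row x : #|above x| <= cell_row x.
  have inj_row : {in above x &, injective cell_row}.
    move=> y z; rewrite !inE => /and3P[_ /eqP cy _] /and3P[_ /eqP cz _] ryz.
    by apply: cell_inj; rewrite // cy cz.
  rewrite cardE -(size_map cell_row) -(size_iota 0 (cell_row x)); apply: uniq_leq_size.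
    rewrite map_inj_in_uniq ?enum_uniq // => y z; rewrite !mem_enum; exact: inj_row.
  by move=> r /mapP[y]; rewrite mem_enum inE mem_iota => /and3P[_ _ lt_y] ->.
have above_ks x : c x \in ks -> #|above x| < size ks.
  move=> kx; rewrite cardE -(size_map c).
  have -> : (size (map c (enum (above x)))).+1 = size (c x :: map c (enum (above x))) by [].
  apply: uniq_leq_size => /=.
    rewrite map_inj_in_uniq ?enum_uniq ?andbT => [|y z]; last first.
      rewrite !mem_enum !inE => /and3P[_ /eqP cy _] /and3P[_ /eqP cz _].
      by apply: injc; rewrite cy cz.
    apply/mapP=> -[y]; rewrite mem_enum inE => /and3P[_ /eqP cy ry] cxy.
    by rewrite (injc cy (esym cxy)) ltnn in ry.
  move=> k; rewrite inE => /orP[/eqP-> //|/mapP[y]].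
  by rewrite mem_enum inE => /and3P[ky _ _] ->.
have cellP x : exists y, (cell_row y == #|above x|) && (cell_col y == cell_col x).
  have lt_cx: cell_col x < nth 0 la #|above x|.
    exact: leq_trans (col_lt x) (nth_partition_le (above_row x)).
  by have [y ry cy] := cell_ex lt_cx; exists y; rewrite ry cy !eqxx.
pose f x := xchoose (cellP x); have fP x := xchooseP (cellP x).
rewrite -card_row_lt -(card_in_imset (_ : {in [set x | c x \in ks] &, injective f})).
  apply/subset_leq_card/subsetP=> y /imsetP[x]; rewrite inE => kx ->.
  by case/andP: (fP x) => /eqP rf _; rewrite inE rf above_ks.
move=> x y; rewrite !inE => kx ky eqf.
case/andP: (fP x) (fP y) => /eqP rx /eqP cx; rewrite -/(f y) -eqf.
rewrite /f rx cx => /andP[/eqP rxy /eqP cxy].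
have lt_above (z t : 'I_n) : c z \in ks -> cell_col z = cell_col t -> cell_row z < cell_row t ->
    #|above z| < #|above t|.
  move=> kz czt rzt; apply/proper_card/properP; split.
    by apply/subsetP=> u; rewrite !inE czt => /and3P[-> -> /=]; lia.
  by exists z; rewrite !inE ?kz ?czt ?eqxx ?rzt // ltnn !andbF.
have [lt_xy|lt_yx|rxy'] := ltngtP (cell_row x) (cell_row y).
- by have:= lt_above x y kx cxy lt_xy; rewrite rxy ltnn.
- by have:= lt_above y x ky (esym cxy) lt_yx; rewrite rxy ltnn.
- exact: cell_inj rxy' cxy.
Qed.

Lemma column_injective_size ks : (forall x, c x \in ks) -> size la <= size ks.
Proof.
move=> cks; have [/eqP|nz_la] := eqVneq (size la) 0; first by move/eqP->.
have cellP (r : 'I_(size la)) : exists y, (cell_row y == r) && (cell_col y == 0).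
  have lt_0r : 0 < nth 0 la r by rewrite nth_partition_gt0.
  by have [y ry cy] := cell_ex lt_0r; exists y; rewrite ry cy !eqxx.
pose f r := xchoose (cellP r); have fP r := xchooseP (cellP r).
rewrite -[X in X <= _]card_ord cardE -(size_map (c \o f)).
apply: uniq_leq_size => [|k /mapP[r _ ->]]; last exact: cks.
rewrite map_inj_uniq ?enum_uniq // => r s /= crs.
case/andP: (fP r) (fP s) => /eqP rr /eqP cr /andP[/eqP rs /eqP cs].
apply: val_inj; rewrite /= -rr -rs; congr cell_row.
by apply: injc; rewrite /f ?cr ?cs.
Qed.

End ColumnInjective.
End Partition.

(** * Straightening highest weight vectors *)

Section GroupSums.
Import GRing.Theory Num.Theory.
Local Open Scope ring_scope.
Variables (n d : nat) (rX : mx_representation rat [set: 'S_n] d).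
Implicit Types (K : {group 'S_n}) (v : 'rV[rat]_d).

Lemma repr_permM g h : rX (g * h)%g = rX g *m rX h.
Proof. by rewrite repr_mxM ?inE. Qed.

Definition sym_sum (K : {set 'S_n}) := \sum_(g in K) rX g.
Definition alt_sum (K : {set 'S_n}) := \sum_(g in K) (-1) ^+ odd_perm g *: rX g.

Lemma sym_sum_fixed K v :
  (forall g, g \in K -> v *m rX g = v) -> v *m sym_sum K = #|K|%:R *: v.
Proof.
move=> vK; rewrite mulmx_sumr (eq_bigr (fun=> v)) // sumr_const.
by rewrite scaler_nat.
Qed.

Lemma mul_sym_sum K h : h \in K -> rX h *m sym_sum K = sym_sum K.
Proof.
move=> Kh; rewrite mulmx_sumr [RHS](reindex_inj (mulgI h)) /=.
by apply: eq_big => [g|g _]; rewrite ?groupMl // repr_permM.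
Qed.

Lemma sym_sum_mul K h : h \in K -> sym_sum K *m rX h = sym_sum K.
Proof.
move=> Kh; rewrite mulmx_suml [RHS](reindex_inj (mulIg h)) /=.
by apply: eq_big => [g|g _]; rewrite ?groupMr // repr_permM.
Qed.

Lemma mul_alt_sum K h :
  h \in K -> rX h *m alt_sum K = (-1) ^+ odd_perm h *: alt_sum K.
Proof.
move=> Kh; rewrite mulmx_sumr scaler_sumr [RHS](reindex_inj (mulgI h)) /=.
apply: eq_big => [g|g _]; rewrite ?groupMl //.
rewrite repr_permM odd_permM signr_addb scalerA mulrA.
by rewrite -expr2 sqrr_sign mul1r scalemxAr.
Qed.

Lemma alt_sum_eq0 K v x y :
  x != y -> tperm x y \in K -> v *m rX (tperm x y) = v -> v *m alt_sum K = 0.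
Proof.
move=> nxy Kxy vxy; have: v *m alt_sum K = - (v *m alt_sum K).
  by rewrite -{1}vxy -mulmxA mul_alt_sum // odd_tperm nxy expr1 scaleN1r mulmxN.
move/eqP; rewrite -addr_eq0 -mulr2n -scaler_nat scaler_eq0 pnatr_eq0 /=.
by move/eqP.
Qed.

End GroupSums.

Section Straightening.
Import GRing.Theory Num.Theory.
Local Open Scope ring_scope.
Variables (n : nat) (la : seq nat).
Local Notation crow := (@cell_row n la).
Local Notation R := (row_group n la).

(* The highest weight vectors of weight la: the sum over the transpositions   *)
(* is the raising operator that moves the cell y to row i.                    *)
Definition highest_weight (d : nat) (rX : mx_representation rat [set: 'S_n] d)
    (v : 'rV_d) :=
  (forall g, g \in R -> v *m rX g = v) /\
  (forall i y, (i < crow y)%N ->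
     v *m (\sum_(x | (crow x == i) || (x == y)) rX (tperm x y)) = 0).

Lemma mem_row_group g : (g \in R) = [forall x, crow (g x) == crow x].
Proof. by rewrite inE. Qed.

(** The scalar is chosen before the module and the vector, so it is universal. The proof is by
    induction on the number of cells whose row g does not preserve: a raising relation expresses v g
    R^+ through permutations that preserve the rows of more cells. *)
Lemma straightening (g : 'S_n) : exists c : rat,
  forall (d : nat) (rX : mx_representation rat [set: 'S_n] d) (v : 'rV_d),
    highest_weight rX v -> v *m rX g *m sym_sum rX R = c *: v.
Proof.
pose good (h : 'S_n) := #|[set x | crow (h x) == crow x]|.
have [k le_k] := ubnP (n - good g).
elim: k => // k IH in g le_k *.
have [Rg|nRg] := boolP (g \in R).
  exists #|R|%:R => d rX v [vR _].
  by rewrite vR // sym_sum_fixed.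
have [x0 bad0]: exists x, crow (g x) != crow x.
  by move: nRg; rewrite mem_row_group negb_forall => /existsP.
case: (@arg_minnP _ x0 (fun x => crow (g x) != crow x) crow bad0) => x /= badx minx.
set i := crow x in minx.
(* g does not map row i to itself, so it maps some cell y outside row i to    *)
(* row i; by minimality of i, the cell y is in a later row.                   *)
have [y ryi rgy]: exists2 y, crow y != i & crow (g y) = i.
  have [/existsP[y /andP[ny /eqP ry]]|all_in] := boolP [exists y, (crow y != i) && (crow (g y) == i)].
    by exists y.
  have sub: [set g^-1%g z | z in [set z | crow z == i]] \subset [set z | crow z == i].
    apply/subsetP=> u /imsetP[z]; rewrite inE => rz ->; rewrite inE.
    apply/negPn/negP => nz; case/negP: all_in; apply/existsP; exists (g^-1%g z).
    by rewrite nz permKV rz.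
  have eq_im: [set g^-1%g z | z in [set z | crow z == i]] = [set z | crow z == i].
    apply/eqP; rewrite eqEcard sub card_imset; first exact: leqnn.
    exact: perm_inj.
  have: x \in [set z | crow z == i] by rewrite inE.
  rewrite -eq_im => /imsetP[z]; rewrite inE => /eqP rz xz.
  by rewrite xz permKV -xz rz eqxx in badx.
have lt_iy: (i < crow y)%N.
  rewrite ltn_neqAle eq_sym ryi; apply: minx; rewrite rgy.
  by rewrite eq_sym.
pose y' := g y.
pose P z := (crow z == i) || (z == y).
pose Q z := crow (g z) == i.
(* The new permutation sends z to [g y], so z now keeps its row i; the cells that kept their row
   under g differ from z and y and are not disturbed. *)
have better z : P z -> ~~ Q z -> exists c : rat,
    forall d (rX : mx_representation rat [set: 'S_n] d) (v : 'rV_d),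
    highest_weight rX v -> v *m rX (g * tperm (g z) y')%g *m sym_sum rX R = c *: v.
  move=> Pz nQz; apply: IH.
  have nzy : z != y by apply: contraNneq nQz => ->; rewrite /Q rgy.
  have rz : crow z = i by move: Pz; rewrite /P (negPf nzy) orbF => /eqP.
  have lt_good: (good g < good (g * tperm (g z) y')%g)%N.
    apply/proper_card/properP; split.
      apply/subsetP=> t; rewrite !inE permM => /eqP rt.
      rewrite tpermD ?rt // (inj_eq perm_inj).
        by apply: contraNneq nQz => zt; rewrite /Q -rz zt rt.
      by apply: contraNneq ryi => yt; rewrite -rgy yt rt.
    by exists z; rewrite !inE ?permM ?tpermL rz // /y' rgy.
  have le_n : (good (g * tperm (g z) y')%g <= n)%N.
    by rewrite -[X in (_ <= X)%N](card_ord n) max_card.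
  lia.
have /fin_all_exists[c cP] (z : 'I_n) : exists c : rat, P z -> ~~ Q z ->
    forall d (rX : mx_representation rat [set: 'S_n] d) (v : 'rV_d),
    highest_weight rX v -> v *m rX (g * tperm (g z) y')%g *m sym_sum rX R = c *: v.
  have [Pz|nPz] := boolP (P z); last by exists 0.
  have [Qz|nQz] := boolP (Q z); first by exists 0.
  by have [c cP] := better z Pz nQz; exists c.
pose N : rat := #|[pred z | P z && Q z]|%:R.
have nzN : N != 0.
  rewrite pnatr_eq0 -lt0n; apply/card_gt0P; exists y.
  by rewrite inE /P /Q eqxx orbT rgy eqxx.
exists (- (N^-1 * \sum_(z | P z && ~~ Q z) c z)) => d rX v hw.
have [vR /(_ i y lt_iy) raise0] := hw.
(* As (z y) g = g (gz gy), each term with gz in row i has its transposition absorbed by R^+ and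
   equals v g R^+. There are N > 0 such terms, y being one, so the relation can be solved for v g
   R^+; [cP] evaluates the other terms. *)
have: v *m (\sum_(z | P z) rX (tperm z y)) *m rX g *m sym_sum rX R = 0.
  by rewrite raise0 !mul0mx.
rewrite [v *m _]mulmx_sumr 2!mulmx_suml (bigID Q) /=.
rewrite (eq_bigr (fun=> v *m rX g *m sym_sum rX R)) => [|z /andP[_ /eqP Qz]]; last first.
  rewrite -mulmxA -mulmxA -(mulmxA v) (mulmxA (rX _)) -repr_permM conjgC tpermJ.
  rewrite repr_permM -mulmxA; congr (_ *m (_ *m _)); apply: (@mul_sym_sum _ _ rX R).
  by apply: (@tperm_stab _ _ crow); rewrite Qz rgy.
rewrite sumr_const -scaler_nat -/N.
rewrite (eq_bigr (fun z => c z *: v)) => [|z /andP[Pz nQz]]; last first.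
  rewrite -(cP z Pz nQz d rX v hw); congr (_ *m _).
  by rewrite -mulmxA -repr_permM conjgC tpermJ.
rewrite -scaler_suml => /eqP; rewrite addr_eq0 => /eqP Nv.
by rewrite -[LHS]scale1r -(mulVf nzN) -scalerA Nv scalerN scalerA scaleNr.
Qed.
End Straightening.

(** * Raising operators and fixed vectors in Specht modules *)

Section Raising.
Import GRing.Theory Num.Theory.
Local Open Scope ring_scope.
Variables (n d : nat) (rX : mx_representation rat [set: 'S_n] d).
Variables (T : eqType) (c : 'I_n -> T) (i : T) (y : 'I_n).

Definition recolor (x : 'I_n) := if x == y then i else c x.

(** Up to the scalar N, the raised vector is v symmetrised over [stab recolor]. An element h of that
    group with h y = x is (x y) preceded by an element that fixes y, hence lies in [stab c] and
    fixes v; so the symmetrisation is grouped by h y. *)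
Lemma raise_fixed (v : 'rV_d) :
  (forall g, g \in stab c -> v *m rX g = v) ->
  forall g, g \in stab recolor ->
    v *m (\sum_(x | (c x == i) || (x == y)) rX (tperm x y)) *m rX g =
    v *m (\sum_(x | (c x == i) || (x == y)) rX (tperm x y)).
Proof.
move=> vc; pose P x := (c x == i) || (x == y).
have PE x : P x = (recolor x == i).
  by rewrite /P /recolor; case: (x =P y) => _; rewrite ?eqxx ?orbT ?orbF.
pose N := #|[set h in stab recolor | h y == y]|.
have N_gt0: (0 < N)%N.
  by apply/card_gt0P; exists 1%g; rewrite inE group1 perm1 eqxx.
have recP x : P x -> tperm x y \in stab recolor.
  by rewrite PE => /eqP rx; apply: tperm_stab; rewrite rx /recolor eqxx.
have sumE: v *m sym_sum rX (stab recolor) = N%:R *: (v *m (\sum_(x | P x) rX (tperm x y))).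
  rewrite mulmx_sumr (partition_big (fun h : 'S_n => h y) P) => [|h /stabP hc]; last first.
    by rewrite PE hc /recolor eqxx.
  rewrite mulmx_sumr scaler_sumr; apply: eq_bigr => x Px.
  rewrite (eq_bigr (fun=> v *m rX (tperm x y))) => [|h /andP[hc /eqP hy]]; last first.
    rewrite -{1}(mulgK (tperm x y) h) tpermV repr_permM mulmxA vc //.
    have /stabP hxc: (h * tperm x y)%g \in stab recolor by rewrite groupM ?recP.
    have hxy: (h * tperm x y)%g y = y by rewrite permM hy tpermL.
    apply/stabP=> z; have [->|nzy] := eqVneq z y; first by rewrite hxy.
    have:= hxc z; rewrite /recolor (negPf nzy) ifN // -{2}hxy (inj_eq perm_inj).
    by [].
  rewrite sumr_const scaler_nat; congr (_ *+ _).
  rewrite /N -[RHS](card_imset _ (mulIg (tperm x y))); apply: eq_card => h.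
  apply/idP/imsetP=> [/andP[hc /eqP hy]|[k]].
    exists (h * tperm x y)%g; last by rewrite -{2}(tpermV x y) mulgK.
    by rewrite inE groupM ?recP //= permM hy tpermL.
  rewrite inE => /andP[kc /eqP ky] -> /=; rewrite unfold_in groupM ?recP //=.
  by rewrite permM ky tpermR.
move=> g gc; have nzN: N%:R != 0 :> rat by rewrite pnatr_eq0 -lt0n.
rewrite -[X in X *m _]scale1r -(mulVf nzN) -scalerA -sumE -scalemxAl -mulmxA.
by rewrite sym_sum_mul // sumE scalerA mulVf // scale1r.
Qed.

End Raising.

Section Specht.
Import GRing.Theory Num.Theory.
Local Open Scope ring_scope.
Variables (n : nat) (la : seq nat).
Hypothesis part_la : is_partition n la.
Local Notation crow := (@cell_row n la).
Local Notation ccol := (@cell_col n la).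
Local Notation R := (row_group n la).
Local Notation C := (column_group n la).
Local Notation M := (tabloid_repr n la).
Local Notation S := (specht_mx n la).
Local Notation w := (tabloid_vect (tabloid_of la (1 : 'S_n)%g)).
Local Notation e1 := (polytabloid la (1 : 'S_n)%g).

Lemma base_tabloidM g : w *m M g = tabloid_vect (tabloid_of la g).
Proof. by rewrite tabloid_vect_repr /tabloid_of coset_of_eltM mul1g. Qed.

Lemma tabloid_of_repr (A : tabloid n la) : tabloid_of la (repr (val A)) = A.
Proof. by apply: val_inj; exact/esym/coset_repr. Qed.

Lemma tabloid_vect_dot (A B : tabloid n la) :
  (tabloid_vect A *m (tabloid_vect B)^T) 0 0 = (A == B)%:R :> rat.
Proof.
rewrite /tabloid_vect trmx_delta mul_delta_mx_cond (inj_eq enum_rank_inj).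
by case: eqP => _; rewrite mxE.
Qed.

Lemma base_tabloid_dot g : (w *m M g *m w^T) 0 0 = (g \in R)%:R :> rat.
Proof.
rewrite base_tabloidM tabloid_vect_dot; congr (_ %:R); congr nat_of_bool.
rewrite -(inj_eq val_inj) /= rcoset1.
apply/eqP/idP => [<-|Rg]; first exact: (rcoset_refl R).
exact: (@rcoset_id _ R).
Qed.

Lemma base_tabloid_fixed g : g \in R -> w *m M g = w.
Proof.
move=> Rg; rewrite base_tabloidM; congr tabloid_vect; apply: val_inj => /=.
by rewrite rcoset1; exact: (@rcoset_id _ R).
Qed.

Lemma tabloid_sum (u : 'rV_#|{: tabloid n la}|) :
  u = \sum_A u 0 (enum_rank A) *: (w *m M (repr (val A))).
Proof.
rewrite {1}(row_sum_delta u) (reindex (@enum_rank (tabloid n la))) /=; last first.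
  exact/onW_bij/enum_rank_bij.
by apply: eq_bigr => A _; rewrite base_tabloidM tabloid_of_repr.
Qed.

Lemma tabloid_repr_tr g : (M g)^T = M g^-1%g.
Proof.
apply/matrixP=> i j; rewrite !mxE; congr (_ %:R); congr nat_of_bool.
by apply/eqP/eqP => <-; rewrite -coset_actM ?mulgV ?mulVg coset_act1.
Qed.

Lemma polytabloid1E : e1 = w *m alt_sum M C.
Proof.
rewrite /polytabloid conjsg1 mulmx_sumr; apply: eq_bigr => p _.
by rewrite -scalemxAr tabloid_vect_repr.
Qed.

Lemma polytabloid_mul t : polytabloid la t = e1 *m M t.
Proof. by rewrite polytabloid_repr mul1g. Qed.

Lemma polytabloid_sub t : (polytabloid la t <= S)%MS.
Proof. by apply: (sumsmx_sup t); rewrite // genmxE. Qed.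

Lemma alt_sum_tr : (alt_sum M C)^T = alt_sum M C.
Proof.
rewrite /alt_sum linear_sum /= (reindex_inj invg_inj) /=.
apply: eq_big => [g|g _]; first exact: (groupV C).
by rewrite linearZ /= tabloid_repr_tr invgK odd_permV.
Qed.

Lemma dot_eq0 (p : nat) (u : 'rV[rat]_p) : u *m u^T = 0 -> u = 0.
Proof.
move/matrixP/(_ 0 0); rewrite !mxE => /eqP; rewrite psumr_eq0 => [|i _]; last first.
  by rewrite mxE -expr2 sqr_ge0.
move/allP=> u0; apply/rowP=> i; have:= u0 i; rewrite mem_index_enum => /(_ isT) /=.
by rewrite !mxE mulf_eq0 orbb => /eqP.
Qed.

(* A vector of the Specht module is not orthogonal to all polytabloids, and a *)
(* transposition in both stab c and the column group of t makes the product   *)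
(* with that of t vanish.                                                     *)
Lemma specht_fixed_column_injective (T : eqType) (c : 'I_n -> T)
    (v : 'rV_#|{: tabloid n la}|) :
  (v <= S)%MS -> v != 0 -> (forall g, g \in stab c -> v *m M g = v) ->
  exists t : 'S_n, column_injective la (c \o t).
Proof.
move=> Sv nzv vc.
have [t nz_t]: exists t : 'S_n, v *m (polytabloid la t)^T != 0.
  apply/existsP; apply: contraR nzv => /existsPn v0; apply/eqP/dot_eq0.
  apply/sub_kermxP; apply: (submx_trans Sv); apply/sumsmx_subP=> t _.
  rewrite genmxE.
  apply/sub_kermxP; apply: trmx_inj; rewrite trmx_mul trmxK trmx0.
  by have:= v0 t; rewrite negbK => /eqP.
exists t => x y cxy /= ctxy; apply/eqP; apply: contraR nz_t => nxy.
rewrite polytabloid_mul polytabloid1E !trmx_mul alt_sum_tr tabloid_repr_tr.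
rewrite !mulmxA (@alt_sum_eq0 _ _ M C _ x y) ?mul0mx //.
  by apply: (@tperm_stab _ _ ccol).
rewrite -mulmxA -repr_permM conjgCV repr_permM mulmxA.
congr (_ *m _); apply: vc; rewrite tpermJ invgK.
exact: tperm_stab.
Qed.

(** The coefficient at the base tabloid is a signed count of pairs (s, h) with s h in the row group.
    Only s = 1 contributes, so the count is positive. *)
Lemma increasing_polytabloid (c : 'I_n -> nat) :
  (forall x y, ccol x = ccol y -> (crow x < crow y)%N -> (c x < c y)%N) ->
  e1 *m sym_sum M (stab c) != 0.
Proof.
move=> incr_c; apply: contraTneq (_ : (e1 *m sym_sum M (stab c) *m w^T) 0 0 != 0) => [->|].
  by rewrite mul0mx mxE.
(* Going down the rows: if s fixes all cells above a row, it moves the cells of this row weakly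
   down, so their colours do not decrease and one that moves gets a larger colour. But s h permutes
   the row and h preserves colours, so the sum of the colours over the row is unchanged. *)
have trivC s h : s \in C -> h \in stab c -> (s * h)%g \in R -> s = 1%g.
  move=> /(@stabP _ _ ccol) sC /stabP hc; rewrite mem_row_group => /forallP shR.
  apply/permP=> x; rewrite perm1.
  have [k le_k] := ubnP (crow x); elim: k => // k IH in x le_k *.
  have [/eqP //|nsx] := boolP (s x == x).
  have fix_lt y : (crow y < crow x)%N -> s y = y by move=> lt_y; apply: IH; lia.
  have ge_row y : crow y = crow x -> (crow y <= crow (s y))%N.
    move=> ryx; rewrite leqNgt; apply/negP => lt_sy.
    have := fix_lt (s y); rewrite -ryx => /(_ lt_sy)/perm_inj sy.
    by rewrite sy ltnn in lt_sy.
  have le_c y : crow y = crow x -> (c y <= c (s y))%N.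
    move=> ryx; have := ge_row y ryx; rewrite leq_eqVlt => /orP[/eqP rsy|lt_y].
      by rewrite -(cell_inj rsy (esym (sC y))).
    by apply/ltnW/incr_c; rewrite ?sC.
  have lt_c: (c x < c (s x))%N.
    apply: incr_c; rewrite ?sC // ltn_neqAle ge_row // andbT.
    apply: contraNneq nsx => rsx.
    by apply/eqP/esym/(cell_inj rsx)/esym/sC.
  have: (\sum_(y | crow y == crow x) c y < \sum_(y | crow y == crow x) c (s y))%N.
    rewrite (bigD1 x) //= [X in (_ < X)%N](bigD1 x) //= -addSn leq_add //.
    by apply: leq_sum => y /andP[/eqP ryx _]; apply: le_c.
  rewrite [X in (X < _)%N](reindex_inj (@perm_inj _ (s * h)%g)) /=.
  rewrite (eq_bigl (fun y => crow y == crow x)) => [|y]; last by rewrite (eqP (shR y)).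
  rewrite (eq_bigr (fun y => c (s y))) ?ltnn // => y _.
  by rewrite permM hc.
have ->: (e1 *m sym_sum M (stab c) *m w^T) 0 0 =
    \sum_(s in C) \sum_(h in stab c) (-1) ^+ odd_perm s * ((s * h)%g \in R)%:R.
  rewrite polytabloid1E [w *m _]mulmx_sumr 2!mulmx_suml summxE.
  apply: eq_bigr => s _; rewrite mulmx_sumr mulmx_suml summxE.
  apply: eq_bigr => h _.
  by rewrite -scalemxAr -!scalemxAl mxE -(base_tabloid_dot (s * h)) repr_permM !mulmxA.
rewrite (bigD1 (1 : 'S_n)%g) /=; last exact: (group1 C).
rewrite [X in _ + X](big1 _ (fun s => (s \in C) && (s != 1%g))); last first.
  move=> s /andP[Cs ns1]; apply: big1 => h hc.
  have [shR|] := boolP ((s * h)%g \in R); last by rewrite mulr0.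
  by rewrite (trivC s h) ?eqxx in ns1.
rewrite addr0 odd_perm1 psumr_eq0 => [|h _]; last by rewrite mul1r ler0n.
apply/allPn; exists 1%g; first by rewrite mem_index_enum.
by rewrite (group1 (stab_group c)) mulg1 mul1r (group1 R) oner_eq0.
Qed.

Lemma polytabloid1_neq0 : e1 != 0.
Proof.
have /increasing_polytabloid: forall x y, ccol x = ccol y ->
  (crow x < crow y)%N -> (crow x < crow y)%N by [].
by apply: contraNneq => ->; rewrite mul0mx.
Qed.

(** A nonzero raised vector would be fixed by the stabiliser of a colouring with more cells in its
    first i + 1 colours than la has in its first i + 1 rows, contrary to dominance. *)
Lemma specht_highest_weight v :
  (v <= S)%MS -> (forall g, g \in R -> v *m M g = v) -> highest_weight la M v.
Proof.
move=> Sv vR; split=> // i y lt_iy; apply/eqP.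
apply: contraT => /specht_fixed_column_injective inj_u.
have [||t inj_t] := inj_u _ (recolor crow i y).
- by rewrite mulmx_sumr summx_sub // => x _; rewrite mxmodule_trans ?specht_module ?inE.
- by move=> g gc; apply: (raise_fixed (c := crow)) gc.
have := column_injective_le part_la inj_t (iota 0 i.+1).
rewrite size_iota -(card_row_lt part_la) leqNgt => /negP[].
rewrite -[X in (_ < X)%N](card_imset _ (@perm_inj _ t)); apply: proper_card.
apply/properP; split.
  apply/subsetP=> x; rewrite inE => lt_x; apply/imsetP; exists (t^-1%g x); rewrite ?permKV //.
  rewrite inE mem_iota /= permKV /recolor.
  by case: ifP; rewrite // leqnn.
exists y; last by rewrite inE -leqNgt.
apply/imsetP; exists (t^-1%g y); rewrite ?permKV //.
by rewrite inE mem_iota /= permKV /recolor eqxx leqnn.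
Qed.

End Specht.

(** * Irreducibility of Specht modules *)

Section SpechtIrr.
Import GRing.Theory Num.Theory.
Local Open Scope ring_scope.
Variables (n : nat) (la : seq nat).
Hypothesis part_la : is_partition n la.
Local Notation crow := (@cell_row n la).
Local Notation ccol := (@cell_col n la).
Local Notation R := (row_group n la).
Local Notation C := (column_group n la).
Local Notation M := (tabloid_repr n la).
Local Notation S := (specht_mx n la).
Local Notation w := (tabloid_vect (tabloid_of la (1 : 'S_n)%g)).
Local Notation e1 := (polytabloid la (1 : 'S_n)%g).

Lemma tabloid_complement (U : 'M_#|{: tabloid n la}|) : mxmodule M U ->
  exists P, [/\ forall g, M g *m P = P *m M g, (P <= U)%MS & U *m P = U].
Proof.
move=> modU; have [K modK defK dxK] :=
  mx_Maschke_pchar M (pgroup_rat [group of [set: 'S_n]]) modU (submx1 _).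
exists (proj_mx U K); split.
- move=> g; have hom1: (1%:M <= dom_hom_mx M (proj_mx U K))%MS.
    by rewrite -defK proj_mx_hom //; apply/mxdirect_addsP.
  by have /hom_mxP/(_ g) := hom1; rewrite inE !mul1mx => ->.
- by rewrite -[X in (X <= _)%MS]mul1mx proj_mx_sub.
- by rewrite proj_mx_id //; apply/mxdirect_addsP.

Qed.


(* s is the projection of the tabloid of the identity to the Specht module.   *)
Lemma specht_generator : exists s,
  [/\ (s <= S)%MS, highest_weight la M s, s *m alt_sum M C = e1
    & forall x, (x <= S)%MS ->
        x = \sum_(A : tabloid n la) x 0 (enum_rank A) *: (s *m M (repr (val A)))].
Proof.
have [P [homP PS SP]] := tabloid_complement (specht_module n la).
have projP (x : 'rV_#|{: tabloid n la}|) : (x <= S)%MS -> x *m P = x.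
  by case/submxP=> D ->; rewrite -mulmxA SP.
have sS : (w *m P <= S)%MS by rewrite (submx_trans (submxMl _ _)).
have sR g : g \in R -> w *m P *m M g = w *m P.
  by move=> Rg; rewrite -mulmxA -homP mulmxA base_tabloid_fixed.
exists (w *m P); split=> //; first exact: specht_highest_weight.
  rewrite -(projP _ (polytabloid_sub _ _)) polytabloid1E -!mulmxA; congr (_ *m _).
  rewrite mulmx_sumr mulmx_suml; apply: eq_bigr => g _.
  by rewrite -scalemxAr -scalemxAl homP.
move=> x Sx; rewrite -{1}(projP x Sx) {1}(tabloid_sum x) mulmx_suml.
by apply: eq_bigr => A _; rewrite -scalemxAl -!mulmxA homP.
Qed.

(** Write x as a combination of translates of s and apply R^+: this multiplies x by the order of R,
    while straightening turns each translate into a multiple of s. *)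
Lemma specht_fixed_scalar : exists s,
  [/\ (s <= S)%MS, highest_weight la M s, s *m alt_sum M C = e1
    & forall x, (x <= S)%MS -> (forall g, g \in R -> x *m M g = x) ->
        exists a : rat, x = a *: s].
Proof.
have [s [sS hws sC genS]] := specht_generator; exists s; split=> // x Sx xR.
have /fin_all_exists[c cP] (g : 'S_n) := straightening la g.
have nzR : #|R|%:R != 0 :> rat by rewrite pnatr_eq0 -lt0n cardG_gt0.
exists (#|R|%:R^-1 * \sum_(A : tabloid n la) x 0 (enum_rank A) * c (repr (val A))).
apply: (scalerI nzR); rewrite scalerA mulVKf //.
have <- : x *m sym_sum M R = #|R|%:R *: x by exact: sym_sum_fixed.
rewrite {1}(genS x Sx) mulmx_suml scaler_suml.
by apply: eq_bigr => A _; rewrite -scalemxAl cP // scalerA.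
Qed.

(** The projection to U of the base tabloid is fixed by the row group, hence a multiple of s, and it
    is nonzero because the base tabloid generates the permutation module. So U contains s, then s
    C^-, and all polytabloids. *)
Lemma specht_irr : mx_irreducible (specht n la).
Proof.
apply/submod_mx_irr; split; first exact: specht_module.
  by apply: contraNneq (polytabloid1_neq0 part_la) => S0;
    rewrite -submx0 -S0 polytabloid_sub.
move=> U modU sUS nzU.
have [P [homP PU UP]] := tabloid_complement modU.
have [s [sS hws sC genS]] := specht_fixed_scalar.
have wPU: (w *m P <= U)%MS by rewrite (submx_trans (submxMl _ _)).
have [|a wPs] := genS (w *m P) (submx_trans wPU sUS).
  by move=> g Rg; rewrite -mulmxA -homP mulmxA base_tabloid_fixed.
have nza : a != 0.
  apply: contraNneq nzU => a0; rewrite a0 scale0r in wPs.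
  rewrite -UP (_ : P = 0) ?mulmx0 //; apply/row_matrixP=> i.
  rewrite rowE (tabloid_sum (delta_mx 0 i)) mulmx_suml row0 big1 // => A _.
  by rewrite -scalemxAl -mulmxA homP mulmxA wPs mul0mx scaler0.
have sU : (s <= U)%MS by rewrite -[s](scalerK nza) -wPs scalemx_sub.
apply/sumsmx_subP=> t _; rewrite genmxE polytabloid_mul -sC.
rewrite mxmodule_trans ?inE // mulmx_sumr summx_sub // => g _.
by rewrite -scalemxAr scalemx_sub // mxmodule_trans ?inE.
Qed.

Lemma rank_specht_row_fixed : \rank (rfix_mx (specht n la) R) = 1%N.
Proof.
have [s [sS [sR _] sC genS]] := specht_fixed_scalar.
have nzs : s != 0.
  by apply: contraNneq (polytabloid1_neq0 part_la) => s0; rewrite -sC s0 mul0mx.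
apply/eqP; rewrite eqn_leq; apply/andP; split.
  apply: leq_trans (_ : \rank (in_submod S s) <= 1)%N; last exact: rank_leq_row.
  apply/mxrankS/rV_subP=> v /rfix_mxP vR.
  have [|a va] := genS (val_submod v) (val_submodP v).
    move=> g Rg; rewrite -(val_submodJ (specht_module n la)) ?inE //.
    by congr val_submod; apply: vR.
  by rewrite -(val_submodK v) va linearZ scalemx_sub.
rewrite lt0n mxrank_eq0; apply/rfix_neq0P; exists (in_submod S s).
  by apply: contraNneq nzs => s0; rewrite -(in_submodK sS) s0 linear0.
by move=> g Rg; rewrite -in_submodJ ?inE // sR.
Qed.

(* The scalar by which C^- R^+ acts on highest weight vectors can be read off *)
(* in the Specht module itself, where it is nonzero.                          *)
Lemma highest_weight_alt_sum :
  forall (d : nat) (rX : mx_representation rat [set: 'S_n] d) (v : 'rV_d),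
    highest_weight la rX v -> v != 0 -> v *m alt_sum rX C != 0.
Proof.
have /fin_all_exists[c cP] (g : 'S_n) := straightening la g.
pose b : rat := \sum_(g in C) (-1) ^+ odd_perm g * c g.
have bP d (rX : mx_representation rat [set: 'S_n] d) (v : 'rV_d) :
    highest_weight la rX v -> v *m alt_sum rX C *m sym_sum rX R = b *: v.
  move=> hw; rewrite [v *m _]mulmx_sumr mulmx_suml scaler_suml.
  by apply: eq_bigr => g _; rewrite -scalemxAr -scalemxAl cP // scalerA.
have nzb : b != 0.
  have [s [sS hws sC _]] := specht_generator.
  have /(increasing_polytabloid part_la) : forall x y, ccol x = ccol y ->
    (crow x < crow y)%N -> (crow x < crow y)%N by [].
  by apply: contraNneq => b0; rewrite -sC (bP _ _ _ hws) b0 scale0r.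
move=> d rX v hw; apply: contraNneq => vC0.
have /eqP := bP _ _ _ hw; rewrite vC0 mul0mx eq_sym scaler_eq0 (negPf nzb).
by [].
Qed.

(** Since v is fixed by the row group, sending the tabloid of g to v g defines a homomorphism on the
    permutation module. It maps the polytabloid [e1] to v C^-, so it does not vanish on S^la. *)
Lemma highest_weight_intertwines (d : nat) (rX : mx_representation rat [set: 'S_n] d)
    (v : 'rV_d) :
  highest_weight la rX v -> v != 0 ->
  exists2 f, intertwines (specht n la) rX f & f != 0.
Proof.
move=> hw nzv; have [vR _] := hw.
pose f : 'M_(#|{: tabloid n la}|, d) := \matrix_i (v *m rX (repr (val (enum_val i)))).
have fP A : tabloid_vect A *m f = v *m rX (repr (val A)).
  by rewrite -rowE rowK enum_rankK.
have wf g : v *m rX (repr (val (tabloid_of la g))) = v *m rX g.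
  have: g \in (R :* repr (val (tabloid_of la g)))%g.
    by rewrite -coset_repr (rcoset_refl R).
  by case/rcosetP=> r Rr E; rewrite [in RHS]E repr_permM mulmxA (vR r Rr).
have homf g : M g *m f = f *m rX g.
  apply/row_matrixP=> i; rewrite !row_mul !rowE.
  have ->: delta_mx 0 i = tabloid_vect (enum_val i) by rewrite /tabloid_vect enum_valK.
  rewrite tabloid_vect_repr !fP -mulmxA -repr_permM -(wf (_ * _)%g).
  by rewrite /tabloid_of -coset_of_eltM -/(tabloid_of _ _) tabloid_of_repr.
have e1f : e1 *m f = v *m alt_sum rX C.
  rewrite polytabloid1E -mulmxA mulmx_suml.
  rewrite (eq_bigr (fun g => f *m ((-1) ^+ odd_perm g *: rX g))) => [|g _]; last first.
    by rewrite -scalemxAl homf scalemxAr.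
  by rewrite -mulmx_sumr mulmxA fP wf repr_mx1 mulmx1.
exists (val_submod 1%:M *m f) => [g _|].
  rewrite -[RHS]mulmxA -homf [RHS]mulmxA [LHS]mulmxA; congr (_ *m f).
  by rewrite -(val_submodJ (specht_module n la)) ?inE // mul1mx -val_submodE.
apply: contraNneq (highest_weight_alt_sum hw nzv) => f0.
rewrite -e1f -(in_submodK (polytabloid_sub _ _)) val_submodE -mulmxA.
by rewrite f0 mulmx0.
Qed.

End SpechtIrr.

(** * Every irreducible module is a Specht module *)

Section Colors.
Variables (n : nat).

Definition colors (T : Type) (c : 'I_n -> T) := [seq c x | x <- enum 'I_n].

Lemma size_colors (T : Type) (c : 'I_n -> T) : size (colors c) = n.
Proof. by rewrite size_map size_enum_ord. Qed.

Lemma count_colors (T : Type) (P : pred T) (c : 'I_n -> T) :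
  count P (colors c) = #|[set x | P (c x)]|.
Proof.
rewrite count_map -sum1_count -sum1_card big_enum_cond /=.
by apply: eq_bigl => x; rewrite inE.
Qed.

Lemma perm_colors (T : eqType) (c d : 'I_n -> T) :
  perm_eq (colors c) (colors d) -> exists t : 'S_n, c =1 d \o t.
Proof.
move=> cd; have /tuple_permP[t tE] : perm_eq (colors c) [tuple d x | x < n] by [].
exists t => x; have := congr1 (nth (c x) ^~ x) tE.
rewrite /colors (nth_map x) ?size_enum_ord ?nth_ord_enum // => ->.
by rewrite -tnth_nth !tnth_mktuple.
Qed.

Lemma perm_colors_comp (T : eqType) (c : 'I_n -> T) (t : 'S_n) :
  perm_eq (colors (c \o t)) (colors c).
Proof.
apply/allP=> k _ /=; rewrite !count_colors; apply/eqP.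
rewrite -(card_imset _ (@perm_inj _ t)); apply: eq_card => x.
apply/imsetP/idP => [[y + ->]|]; rewrite !inE // => cx.
by exists (t^-1%g x); rewrite ?inE /= permKV.
Qed.

End Colors.

Section Completeness.
Import GRing.Theory Num.Theory.
Local Open Scope ring_scope.
Variable n : nat.

Lemma rank_rfix_comp (d : nat) (rX : mx_representation rat [set: 'S_n] d)
    (T : eqType) (c : 'I_n -> T) (t : 'S_n) :
  \rank (rfix_mx rX (stab (c \o t))) = \rank (rfix_mx rX (stab c)).
Proof.
have <- : (stab c :^ t^-1)%g = stab (c \o t).
  by apply/setP=> s; rewrite stab_conj invgK.
rewrite (rfix_mx_conjsg rX) ?inE // ?subsetT // mxrankMfree // row_free_unit.
by apply: (repr_mx_unit rX); rewrite inE.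
Qed.

Lemma rfix_comp (d : nat) (rX : mx_representation rat [set: 'S_n] d)
    (T : eqType) (c : 'I_n -> T) (t : 'S_n) :
  (rfix_mx rX (stab (c \o t)) != 0) = (rfix_mx rX (stab c) != 0).
Proof. by rewrite -!mxrank_eq0 rank_rfix_comp. Qed.

Lemma eq_rfix_stab (d : nat) (rX : mx_representation rat [set: 'S_n] d)
    (T : eqType) (c c' : 'I_n -> T) :
  c =1 c' -> rfix_mx rX (stab c) = rfix_mx rX (stab c').
Proof. by move=> cc'; congr rfix_mx; apply: eq_stab => x y; rewrite !cc'. Qed.

Lemma specht_rfix_column_injective la (T : eqType) (c : 'I_n -> T) :
  rfix_mx (specht n la) (stab c) != 0 ->
  exists t : 'S_n, column_injective la (c \o t).
Proof.
case/rfix_neq0P=> v nzv vc.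
apply: (@specht_fixed_column_injective _ _ _ _ (val_submod v)).
- exact: val_submodP.
- by rewrite val_submod_eq0.
- move=> g gc; rewrite -(val_submodJ (specht_module n la)) ?inE //.
  by congr val_submod; apply: vc.
Qed.

Lemma specht_rfix_increasing la (c : 'I_n -> nat) : is_partition n la ->
  (forall x y, cell_col la x = cell_col la y -> (cell_row la x < cell_row la y)%N -> (c x < c y)%N) ->
  rfix_mx (specht n la) (stab c) != 0.
Proof.
move=> part_la /(increasing_polytabloid part_la) nzu; apply/rfix_neq0P.
set u := _ *m _ in nzu.
have Su : (u <= specht_mx n la)%MS.
  rewrite /u [X in (X <= _)%MS]mulmx_sumr summx_sub // => g _.
  by rewrite mxmodule_trans ?specht_module ?inE // polytabloid_sub.
exists (in_submod _ u).
  by apply: contraNneq nzu => u0; rewrite -(in_submodK Su) u0 linear0.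
move=> g gc; rewrite -(in_submodJ (specht_module n la)) ?inE //.
by congr in_submod; rewrite /u -mulmxA sym_sum_mul.
Qed.

Lemma specht_rfix_row la : is_partition n la ->
  rfix_mx (specht n la) (stab (@cell_row n la)) != 0.
Proof. by move=> part_la; apply: specht_rfix_increasing. Qed.

(** The sum of the squares of the class sizes. It grows when a point moves to a class at least as
    large as its own, which makes repeated raising terminate. *)
Definition monochromatic_pairs (T : eqType) (c : 'I_n -> T) :=
  #|[set xy : 'I_n * 'I_n | c xy.1 == c xy.2]|.

Lemma monochromatic_pairsE (T : eqType) (c : 'I_n -> T) :
  monochromatic_pairs c = (\sum_x \sum_y (c x == c y))%N.
Proof.
rewrite pair_big /= /monochromatic_pairs -sum1dep_card big_mkcond /=.
by apply: eq_bigr => x _; case: eqP.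
Qed.

Lemma monochromatic_pairs_recolor (T : eqType) (c : 'I_n -> T) (i : T) y :
  c y != i -> (#|[set x | c x == c y]| <= #|[set x | c x == i]|)%N ->
  (monochromatic_pairs c < monochromatic_pairs (recolor c i y))%N.
Proof.
move=> nyi le_yi; rewrite !monochromatic_pairsE.
have splitE (c' : 'I_n -> T) : (\sum_x \sum_z (c' x == c' z) =
    1 + (\sum_(z | z != y) (c' z == c' y)) + (\sum_(z | z != y) (c' z == c' y))
    + \sum_(x | x != y) \sum_(z | z != y) (c' x == c' z))%N.
  rewrite (bigD1 y) //= (bigD1 y) //= eqxx -!addnA; congr (_ + _)%N.
  rewrite (eq_bigr (fun z => (c' z == c' y) : nat)) => [|z _]; last by rewrite eq_sym.
  congr (_ + _)%N; rewrite -big_split /=; apply: eq_bigr => x nxy.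
  by rewrite (bigD1 y).
rewrite !splitE -!addnA ltn_add2l.
have recE z : z != y -> recolor c i y z = c z by rewrite /recolor => /negPf->.
have recy : recolor c i y y = i by rewrite /recolor eqxx.
have sumE k : (\sum_(z | z != y) (c z == k) = #|[set z | c z == k]| - (c y == k))%N.
  rewrite -sum1dep_card [in RHS]big_mkcond /= [in RHS](bigD1 y) //=.
  have -> : (if c y == k then 1 else 0)%N = (c y == k) by case: (c y == k).
  by rewrite addKn; apply: eq_bigr => z _; case: eqP.
have -> : (\sum_(z | z != y) (recolor c i y z == recolor c i y y) =
           \sum_(z | z != y) (c z == i))%N.
  by apply: eq_bigr => z nzy; rewrite recE // recy.
have -> : (\sum_(x | x != y) \sum_(z | z != y) (recolor c i y x == recolor c i y z) =
    \sum_(x | x != y) \sum_(z | z != y) (c x == c z))%N.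
  by apply: eq_bigr => x nxy; apply: eq_bigr => z nzy; rewrite !recE.
have card_y : (0 < #|[set z | c z == c y]|)%N.
  by apply/card_gt0P; exists y; rewrite inE.
rewrite !sumE eqxx (negPf nyi); lia.
Qed.

Lemma coloring_shape (T : eqType) (c : 'I_n -> T) : exists la (t : 'S_n),
  is_partition n la /\
  forall x y, (c (t x) == c (t y)) = (cell_row la x == cell_row la y).
Proof.
pose cnt k := #|[set x | c x == k]|.
pose ks := sort (fun k l => cnt l <= cnt k)%N (undup (colors c)).
have in_ks x : c x \in ks by rewrite mem_sort mem_undup map_f ?mem_enum.
have uks : uniq ks by rewrite sort_uniq undup_uniq.
pose la := map cnt ks.
have part_la : is_partition n la.
  apply/and3P; split.
  - rewrite /la sorted_map; apply: sort_sorted => k l /=; exact: leq_total.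
  - apply/mapP=> -[k]; rewrite mem_sort mem_undup => /mapP[x _ ->] /esym/eqP.
    by rewrite cards_eq0 => /eqP/setP/(_ x); rewrite !inE eqxx.
  - rewrite /la sumnE big_map -[X in _ == X](card_ord n) -sum1_card.
    rewrite (eq_bigr (fun k => \sum_x (c x == k))%N) => [|k _]; last first.
      rewrite /cnt -sum1dep_card big_mkcond /=.
      by apply: eq_bigr => x _; case: (c x == k).
    rewrite exchange_big /=; apply/eqP/eq_bigr => x _.
    rewrite -[RHS](_ : count_mem (c x) ks = 1%N); last by rewrite count_uniq_mem // in_ks.
    rewrite -sum1_count [RHS]big_mkcond /=; apply: eq_bigr => k _.
    by rewrite eq_sym; case: eqP.
pose f x := index (c x) ks.
have [t tE] : exists t : 'S_n, @cell_row n la =1 f \o t.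
  apply: perm_colors; apply/allP=> k _ /=; rewrite !count_colors; apply/eqP.
  rewrite (card_row part_la).
  have [lt_k|le_k] := ltnP k (size ks); last first.
    rewrite nth_default ?size_map //; apply/esym/eqP; rewrite cards_eq0.
    apply/eqP/setP=> x; rewrite !inE /f; apply/negP=> /eqP xk.
    by move: (in_ks x); rewrite -index_mem xk ltnNge le_k.
  have [x0 _] : exists x : 'I_n, true.
    have: nth 0%N la k \in la by rewrite mem_nth ?size_map.
    by case/mapP=> k'; rewrite mem_sort mem_undup => /mapP[x _ _]; exists x.
  rewrite (nth_map (c x0)) // /cnt; apply: eq_card => x; rewrite !inE /f.
  apply/eqP/eqP => [->|<-]; first by rewrite index_uniq.
  by rewrite nth_index.
exists la, t; split=> // x y; rewrite !tE /= /f.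
apply/eqP/eqP => [-> //|]; move/(congr1 (nth (c (t x)) ks)).
by rewrite !nth_index.
Qed.

(** Start from the colouring with all colours distinct, whose stabiliser is trivial. After sorting
    the classes by size, a fixed vector either is a highest weight vector, and then S^la maps onto
    the module, or has a nonzero raising, and then the raised colouring has more monochromatic
    pairs. *)
Lemma irr_specht (d : nat) (rX : mx_representation rat [set: 'S_n] d) :
  mx_irreducible rX ->
  exists2 la, is_partition n la & mx_rsim (specht n la) rX.
Proof.
move=> irrX.
have: rfix_mx rX (stab (id : 'I_n -> 'I_n)) != 0.
  have -> : stab (id : 'I_n -> 'I_n) = 1%g.
    apply/setP=> s; rewrite !inE; apply/forallP/eqP => [s1|-> x]; last by rewrite perm1.
    by apply/permP=> x; rewrite perm1; apply/eqP.
  case: irrX => _ nz1 _; case/rowV0Pn: nz1 => v _ nzv; apply/rfix_neq0P.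
  by exists v => // x /set1P->; rewrite repr_mx1 mulmx1.
have [k] := ubnP (n * n - monochromatic_pairs (id : 'I_n -> 'I_n)).
move: (id : 'I_n -> 'I_n) => /=.
suff: forall (T : eqType) (c : 'I_n -> T),
    (n * n - monochromatic_pairs c < k)%N -> rfix_mx rX (stab c) != 0 ->
    exists2 la, is_partition n la & mx_rsim (specht n la) rX.
  by move=> H c; apply: H.
elim: k => // k IH T c le_k nz_c.
have [la [t [part_la ct]]] := coloring_shape c.
have stabE : stab (c \o t) = stab (@cell_row n la) by apply: eq_stab.
have /rfix_neq0P[v nzv vR] : rfix_mx rX (stab (@cell_row n la)) != 0.
  by rewrite -stabE rfix_comp.
have [hw|nhw] := classic (highest_weight la rX v).
  have [f homf nzf] := highest_weight_intertwines part_la hw nzv.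
  exists la => //; apply: irr_intertwines_rsim homf nzf => //.
  exact: specht_irr.
have [i [y [lt_iy nzu]]] : exists i y, (i < cell_row la y)%N /\
    v *m (\sum_(x | (cell_row la x == i) || (x == y)) rX (tperm x y)) != 0.
  apply: NNPP => none; case: nhw; split=> [g Rg|i y lt_iy]; first exact: vR.
  by apply: NNPP => nz; case: none; exists i, y; split=> //; apply/eqP.
apply: (IH _ (recolor (@cell_row n la) i y)); last first.
  by apply/rfix_neq0P; eexists; first exact: nzu; apply: raise_fixed.
have lt_pairs: (monochromatic_pairs c < monochromatic_pairs (recolor (@cell_row n la) i y))%N.
  have -> : monochromatic_pairs c = monochromatic_pairs (@cell_row n la).
    rewrite !monochromatic_pairsE (reindex_inj (@perm_inj _ t)).
    by apply: eq_bigr => x _; rewrite (reindex_inj (@perm_inj _ t)); apply: eq_bigr => z _; rewrite ct.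
  apply: monochromatic_pairs_recolor; first by rewrite gtn_eqF.
  by rewrite !(card_row part_la) (nth_partition_le part_la) // ltnW.
have: (monochromatic_pairs (recolor (@cell_row n la) i y) <= n * n)%N.
  apply: leq_trans (max_card _) _; rewrite card_prod card_ord; exact: leqnn.
lia.
Qed.

End Completeness.

(** * Conjugate partitions *)

Section Conjugate.
Variable n : nat.
Implicit Types la mu : seq nat.

Lemma partition_ext la mu : is_partition n la -> is_partition n mu ->
  (forall i, nth 0 la i = nth 0 mu i) -> la = mu.
Proof.
move=> part_la part_mu eq_nth; apply: (eq_from_nth (x0 := 0)) => [|i _ //].
apply/eqP; rewrite eqn_leq; apply/andP; split.
  by rewrite leqNgt -(nth_partition_gt0 part_la) eq_nth nth_default.
by rewrite leqNgt -(nth_partition_gt0 part_mu) -eq_nth nth_default.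
Qed.

Lemma dominated_anti la mu : is_partition n la -> is_partition n mu ->
  dominated la mu -> dominated mu la -> la = mu.
Proof.
move=> part_la part_mu lm ml; apply: partition_ext => // i.
have sumE k : sumn (take k la) = sumn (take k mu).
  by apply/eqP; rewrite eqn_leq lm ml.
by have:= sumE i.+1; rewrite !sumn_take !big_ord_recr /= -!sumn_take sumE => /addnI.
Qed.

Lemma size_partition la : is_partition n la -> size la <= n.
Proof.
case/and3P=> _ la0 /eqP <-; elim: la la0 => //= a s IH.
by rewrite inE negb_or eq_sym -lt0n => /andP[? /IH]; lia.
Qed.

Lemma ltn_count_leq la i j : sorted geq la ->
  (i < count (leq j.+1) la) = (j < nth 0 la i).
Proof.
elim: la i => [|a s IH] i /=; first by rewrite nth_nil.
move=> sas; have ss := path_sorted sas; have [lt_ja|le_aj] := ltnP j a.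
  by case: i => [|i] /=; rewrite ?lt_ja // add1n ltnS IH.
have geq_tr : transitive geq by move=> x y z /=; lia.
have le_s : all (geq a) s := order_path_min geq_tr sas.
have -> : count (leq j.+1) s = 0.
  apply/eqP; rewrite eqn0Ngt -has_count -all_predC; apply: sub_all le_s => x /=; lia.
rewrite addn0 /=; apply/esym/negbTE; rewrite -leqNgt.
case: i => [|i] //=; have [lt_i|le_i] := ltnP i (size s); last by rewrite nth_default.
by have /(_ (mem_nth 0 lt_i)) := allP le_s (nth 0 s i); rewrite /=; lia.
Qed.

Lemma nth_conj la j : sorted geq la ->
  nth 0 (conj_partition la) j = count (leq j.+1) la.
Proof.
move=> sla; have [lt_j|le_j] := ltnP j (head 0 la).
  by rewrite (nth_map 0) ?size_iota // nth_iota.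
rewrite nth_default ?size_map ?size_iota //; apply/esym/eqP.
by rewrite eqn0Ngt ltn_count_leq // nth0 -leqNgt.
Qed.

Lemma ltn_nth_conj la i j : sorted geq la ->
  (i < nth 0 (conj_partition la) j) = (j < nth 0 la i).
Proof. by move=> sla; rewrite nth_conj // ltn_count_leq. Qed.

Lemma size_conj la : size (conj_partition la) = head 0 la.
Proof. by rewrite size_map size_iota. Qed.

Lemma sumn_take_conj la k : sorted geq la ->
  sumn (take k (conj_partition la)) = \sum_(x <- la) minn k x.
Proof.
move=> sla; rewrite sumn_take.
rewrite (eq_bigr (fun j : 'I_k => \sum_(x <- la) (j < x))) => [|j _]; last first.
  by rewrite nth_conj // -sum1_count big_mkcond; apply: eq_bigr => x _; case: ifP.
rewrite exchange_big; apply: eq_bigr => x _ /=.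
elim: k => [|k IH]; first by rewrite big_ord0 min0n.
by rewrite big_ord_recr /= IH; lia.
Qed.

Lemma head_ge la x : sorted geq la -> x \in la -> x <= head 0 la.
Proof.
case: la => // a s sas; rewrite inE => /orP[/eqP-> //|xs].
have geq_tr : transitive geq by move=> ? ? ? /=; lia.
exact: (allP (order_path_min geq_tr sas)).
Qed.

Lemma conj_is_partition la : is_partition n la -> is_partition n (conj_partition la).
Proof.
case/and3P=> sla la0 /eqP sum_la; apply/and3P; split.
- rewrite /conj_partition sorted_map; apply: (sub_sorted _ (iota_ltn_sorted 1 _)).
  by move=> i j /= lt_ij; apply: sub_count => x; lia.
- apply/negP=> /(nthP 0)[j]; rewrite size_conj nth_conj // => lt_j c0.
  by have := ltn_count_leq 0 j sla; rewrite c0 nth0 lt_j.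
- rewrite -[conj_partition la](take_size) sumn_take_conj // size_conj -sum_la sumnE.
  by apply/eqP; apply: eq_big_seq => x /(head_ge sla)/minn_idPr.
Qed.

Lemma conj_conj la : is_partition n la -> conj_partition (conj_partition la) = la.
Proof.
move=> part_la; have part_c := conj_is_partition part_la.
apply: partition_ext => //; first exact: conj_is_partition.
case/and3P: part_la part_c => sla _ _ /and3P[sc _ _] i.
have eqv j : (j < nth 0 (conj_partition (conj_partition la)) i) = (j < nth 0 la i).
  by rewrite !ltn_nth_conj.
apply/eqP; rewrite eqn_leq; apply/andP; split; rewrite leqNgt.
  by rewrite eqv ltnn.
by rewrite -eqv ltnn.
Qed.

(** The first k columns contain the sum of min(k, x) over the parts x. With p the number of parts of
    la that are at least k, this is p k plus the tail of la after p parts, and at most p k plus the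
    tail of mu for mu; dominance at p compares the tails. *)
Lemma dominated_conj la mu : is_partition n la -> is_partition n mu ->
  dominated la mu -> dominated (conj_partition mu) (conj_partition la).
Proof.
case/and3P=> sla _ /eqP sum_la /and3P[smu _ /eqP sum_mu] lm k.
rewrite !sumn_take_conj //; pose p := count (leq k) la.
have -> : \sum_(x <- la) minn k x = p * k + sumn (drop p la).
  rewrite /p; clear sum_la lm p; elim: la sla => [|a s IH] //=; first by rewrite big_nil.
  move=> sas; have ss := path_sorted sas; rewrite big_cons IH //.
  have [le_ka|lt_ak] := leqP k a; first by rewrite add1n mulSn addnA.
  have geq_tr : transitive geq by move=> ? ? ? /=; lia.
  have le_s : all (geq a) s := order_path_min geq_tr sas.
  have -> : count (leq k) s = 0.
    apply/eqP; rewrite eqn0Ngt -has_count -all_predC; apply: sub_all le_s => x /=; lia.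
  by rewrite !mul0n !drop0 /=; lia.
have le_mu : \sum_(x <- mu) minn k x <= p * k + sumn (drop p mu).
  rewrite -{1}(cat_take_drop p mu) big_cat leq_add //; last first.
    by rewrite sumnE; apply: leq_sum => x _; rewrite geq_minr.
  apply: leq_trans (_ : \sum_(x <- take p mu) k <= _).
    by apply: leq_sum => x _; rewrite geq_minl.
  rewrite big_const_seq count_predT iter_addn_0 mulnC leq_mul2r size_take.
  by apply/orP; right; case: ltnP.
apply: leq_trans le_mu _; rewrite leq_add2l.
have := lm p; have: sumn (take p la) + sumn (drop p la) = n by rewrite -sumn_cat cat_take_drop.
have: sumn (take p mu) + sumn (drop p mu) = n by rewrite -sumn_cat cat_take_drop.
lia.
Qed.

Lemma transpose_cells la : is_partition n la ->
  exists t : 'S_n, forall x, cell_row (conj_partition la) x = cell_col la (t x) /\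
                             cell_col (conj_partition la) x = cell_row la (t x).
Proof.
move=> part_la; have part_c := conj_is_partition part_la.
have sla: sorted geq la by case/and3P: part_la.
have cellP (x : 'I_n) : exists y : 'I_n, (cell_row la y == cell_col (conj_partition la) x) &&
                         (cell_col la y == cell_row (conj_partition la) x).
  have := col_lt part_c x; rewrite ltn_nth_conj //.
  by case/(cell_ex part_la)=> y ry cy; exists y; rewrite ry cy !eqxx.
pose f x := xchoose (cellP x); have fP x := xchooseP (cellP x).
have inj_f : injective f.
  move=> x y fxy; case/andP: (fP x) (fP y) => /eqP r1 /eqP c1 /andP[/eqP r2 /eqP c2].
  by apply: (@cell_inj _ (conj_partition la)); rewrite -?c1 -?c2 -?r1 -?r2;
    congr (_ _ _); exact: fxy.
exists (perm inj_f) => x; rewrite permE; case/andP: (fP x) => /eqP r1 /eqP c1.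
by rewrite /f c1 r1.
Qed.

End Conjugate.

(** * Sign twists and maximal summands *)

Section SignTwist.
Import GRing.Theory Num.Theory.
Local Open Scope ring_scope.
Variable n : nat.

Definition sign_mx (d : nat) (rX : mx_representation rat [set: 'S_n] d) (g : 'S_n) :=
  (-1) ^+ odd_perm g *: rX g.

Lemma sign_mx_repr (d : nat) (rX : mx_representation rat [set: 'S_n] d) :
  mx_repr [set: 'S_n] (sign_mx rX).
Proof.
split=> [|g h _ _]; rewrite /sign_mx; first by rewrite odd_perm1 scale1r repr_mx1.
by rewrite repr_permM odd_permM signr_addb -scalemxAl -scalemxAr scalerA.
Qed.

Definition sign_twist (d : nat) (rX : mx_representation rat [set: 'S_n] d) :=
  MxRepresentation (sign_mx_repr rX).

Lemma sign_twist_intertwines (e d : nat) (rU : mx_representation rat [set: 'S_n] e)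
    (rV : mx_representation rat [set: 'S_n] d) f :
  intertwines rU rV f -> intertwines (sign_twist rU) (sign_twist rV) f.
Proof. by move=> homf g Gg; rewrite -scalemxAl -scalemxAr homf. Qed.

Lemma sign_twist_rsim (e d : nat) (rU : mx_representation rat [set: 'S_n] e)
    (rV : mx_representation rat [set: 'S_n] d) :
  mx_rsim rU rV -> mx_rsim (sign_twist rU) (sign_twist rV).
Proof. by case=> f ed freef homf; exists f => //; apply: sign_twist_intertwines. Qed.

Lemma sign_twist_irr (d : nat) (rX : mx_representation rat [set: 'S_n] d) :
  mx_irreducible rX -> mx_irreducible (sign_twist rX).
Proof.
move/mx_irrP=> [d_gt0 irrX]; apply/mx_irrP; split=> // U modU; apply: irrX.
apply/mxmoduleP=> g Gg; have /mxmoduleP/(_ g Gg) := modU.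
by rewrite -scalemxAr eqmx_scale // signr_eq0.
Qed.

End SignTwist.

(** * Weights of Specht modules and their twists, and maximal summands *)

Section Dominance.
Import GRing.Theory Num.Theory.
Local Open Scope ring_scope.
Variable n : nat.

Lemma specht_rfix_le la (T : eqType) (c : 'I_n -> T) ks : is_partition n la ->
  rfix_mx (specht n la) (stab c) != 0 ->
  (#|[set x | c x \in ks]| <= sumn (take (size ks) la))%N.
Proof.
move=> part_la /specht_rfix_column_injective[t inj_t].
apply: leq_trans (column_injective_le part_la inj_t ks).
rewrite -!count_colors (seq.permP (perm_colors_comp _ t)); exact: leqnn.
Qed.

Lemma specht_rfix_size la (T : eqType) (c : 'I_n -> T) ks : is_partition n la ->
  rfix_mx (specht n la) (stab c) != 0 -> (forall x, c x \in ks) ->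
  (size la <= size ks)%N.
Proof.
move=> part_la /specht_rfix_column_injective[t inj_t] cks.
by apply: (column_injective_size part_la inj_t) => x; apply: cks.
Qed.

Definition below (c : 'I_n -> nat) k := #|[set x | (c x < k)%N]|.

Lemma below_row la k : is_partition n la -> below (@cell_row n la) k = sumn (take k la).
Proof. by move=> part_la; rewrite /below (card_row_lt part_la). Qed.

Lemma specht_rfix_below la (c : 'I_n -> nat) k : is_partition n la ->
  rfix_mx (specht n la) (stab c) != 0 -> (below c k <= sumn (take k la))%N.
Proof.
move=> part_la fix_c; have := specht_rfix_le (iota 0 k) part_la fix_c.
rewrite size_iota; apply: leq_trans; apply/subset_leq_card/subsetP=> x.
by rewrite !inE mem_iota.
Qed.

Lemma below_comp (c : 'I_n -> nat) (t : 'S_n) k : below (c \o t) k = below c k.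
Proof.
have := seq.permP (perm_colors_comp c t) (fun i => (i < k)%N).
by rewrite !count_colors.
Qed.

Lemma below_col la k : is_partition n la ->
  below (@cell_col n la) k = sumn (take k (conj_partition la)).
Proof.
move=> part_la; have [t tP] := transpose_cells part_la.
rewrite -(below_row _ (conj_is_partition part_la)) -(below_comp _ t).
by apply: eq_card => x; rewrite !inE; case: (tP x) => ->.
Qed.

Lemma sign_twist_specht_fixed la : is_partition n la ->
  rfix_mx (sign_twist (specht n la)) (stab (@cell_col n la)) != 0.
Proof.
move=> part_la; set e1 := polytabloid la (1 : 'S_n)%g.
have Se1 : (e1 <= specht_mx n la)%MS := polytabloid_sub la _.
apply/rfix_neq0P; exists (in_submod _ e1).
  apply: contraNneq (polytabloid1_neq0 part_la) => e0.
  by rewrite -/e1 -(in_submodK Se1) e0 linear0.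
move=> g gC; rewrite -scalemxAr -(in_submodJ (specht_module n la)) ?inE //.
rewrite -linearZ /=; congr in_submod.
have -> : e1 *m tabloid_repr n la g = (-1) ^+ odd_perm g *: e1.
  rewrite /e1 polytabloid1E -mulmxA scalemxAr; congr (_ *m _).
  apply: trmx_inj; rewrite trmx_mul linearZ /= tabloid_repr_tr alt_sum_tr.
  by rewrite (@mul_alt_sum _ _ _ (column_group n la)) ?groupV ?odd_permV.
by rewrite scalerA -expr2 sqrr_sign scale1r.
Qed.

(** Take a tabloid with nonzero coefficient in v. A transposition of two entries of equal colour in
    one row of it fixes the tabloid but negates v, which would force that coefficient to be zero. *)
Lemma sign_twist_specht_row_injective la (T : eqType) (c : 'I_n -> T) :
  rfix_mx (sign_twist (specht n la)) (stab c) != 0 ->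
  exists t : 'S_n, forall x y, cell_row la x = cell_row la y -> c (t x) = c (t y) -> x = y.
Proof.
case/rfix_neq0P=> v nzv vc.
have {vc} Vc g : g \in stab c ->
    (-1) ^+ odd_perm g *: (val_submod v *m tabloid_repr n la g) = val_submod v.
  move=> gc; rewrite -(val_submodJ (specht_module n la)) ?inE // -linearZ /=.
  by congr val_submod; have := vc g gc; rewrite -scalemxAr.
rewrite -val_submod_eq0 in nzv; set V := val_submod v in nzv Vc.
have [A nzA] : exists A, V *m (tabloid_vect A)^T != 0.
  apply/existsP; apply: contraR nzv => /existsPn V0; apply/eqP/rowP=> j.
  have := V0 (enum_val j); rewrite negbK /tabloid_vect enum_valK.
  rewrite trmx_delta => /eqP/matrixP/(_ 0 0).
  by rewrite -colE !mxE.
exists (repr (val A)) => x y rxy cxy; apply/eqP; apply: contraR nzA => nxy.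
set t := repr (val A) in cxy *; pose p := tperm (t x) (t y).
have pA : tabloid_vect A *m tabloid_repr n la p = tabloid_vect A.
  rewrite -(tabloid_of_repr A) -base_tabloidM -/t -mulmxA -repr_permM.
  rewrite /p -tpermJ -conjgC repr_permM mulmxA base_tabloid_fixed //.
  by apply: (@tperm_stab _ _ (@cell_row n la)).
have VA : V *m (tabloid_vect A)^T = - (V *m (tabloid_vect A)^T).
  rewrite -{1}(Vc p (tperm_stab cxy)) odd_tperm (inj_eq perm_inj) nxy expr1 scaleN1r.
  by rewrite mulNmx -mulmxA -[X in _ = - (_ *m X^T)]pA trmx_mul tabloid_repr_tr tpermV.
move/eqP: VA; rewrite -addr_eq0 -mulr2n -scaler_nat scaler_eq0 pnatr_eq0 /=.
by [].
Qed.

(** The twist is irreducible, hence some S^ka. The column weight of la occurs in it, so ka dominates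
    la'; and the row weight of ka occurs in it, giving a colouring injective on the rows of la, that
    is on the columns of la', so la' dominates ka. *)
Lemma sign_twist_specht la : is_partition n la ->
  mx_rsim (sign_twist (specht n la)) (specht n (conj_partition la)).
Proof.
move=> part_la; have part_c := conj_is_partition part_la.
have [ka part_ka sim] := irr_specht (sign_twist_irr (specht_irr part_la)).
suff <- : ka = conj_partition la by apply: mx_rsim_sym.
apply: (dominated_anti part_ka part_c) => k; last first.
  rewrite -below_col //; apply: specht_rfix_below => //.
  rewrite (rfix_neq0_rsim (subsetT _) sim).
  exact: sign_twist_specht_fixed.
have [t inj_t] : exists t : 'S_n, forall x y, cell_row la x = cell_row la y ->
    cell_row ka (t x) = cell_row ka (t y) -> x = y.
  apply: sign_twist_specht_row_injective.
  rewrite -(rfix_neq0_rsim (subsetT _) sim).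
  exact: specht_rfix_row.
have [s sP] := transpose_cells part_la.
have inj_c : column_injective (conj_partition la) (@cell_row n ka \o (s * t)%g).
  move=> x y cxy /=; rewrite !permM => rxy; apply: (@perm_inj _ s).
  by apply: inj_t rxy; case: (sP x) (sP y) => _ <- [_ <-].
rewrite -below_row // -(below_comp _ (s * t)%g).
have := column_injective_le part_c inj_c (iota 0 k).
rewrite size_iota; apply: leq_trans; apply/subset_leq_card/subsetP=> x.
by rewrite !inE mem_iota.
Qed.

Section Summands.
Variables (d : nat) (rX : mx_representation rat [set: 'S_n] d).

Lemma summand_rfix la (T : eqType) (c : 'I_n -> T) :
  is_summand (specht n la) rX -> rfix_mx (specht n la) (stab c) != 0 ->
  rfix_mx rX (stab c) != 0.
Proof.
by case/summand_intertwines=> f homf freef; apply: rfix_intertwines homf freef; apply: subsetT.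
Qed.

Lemma rfix_summand (T : eqType) (c : 'I_n -> T) :
  rfix_mx rX (stab c) != 0 ->
  exists la, [/\ is_partition n la, is_summand (specht n la) rX
                & rfix_mx (specht n la) (stab c) != 0].
Proof.
case/(@rfix_irr _ _ _ _ (stab_group c))=> [|e [rU [f [irrU homf freef fixU]]]].
  exact: subsetT.
have [la part_la sim] := irr_specht irrU; exists la; split=> //; last first.
  by rewrite (rfix_neq0_rsim (subsetT _) sim).
have irr_la := specht_irr part_la.
case: sim => B _ freeB homB.
apply: (intertwines_summand (f := B *m f) irr_la).
  by move=> g Gg; rewrite mulmxA homB // -mulmxA homf // mulmxA.
rewrite -mxrank_eq0 mxrankMfree // (eqP freeB) -lt0n.
by case/mx_irrP: irr_la.
Qed.

Definition summand la := is_partition n la /\ is_summand (specht n la) rX.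

Lemma maximal_summand_above la : summand la ->
  exists2 ka, dominated la ka &
    summand ka /\ forall ka', summand ka' -> dominated ka ka' -> ka' = ka.
Proof.
(* The sum of the partial sums strictly increases along dominance and is bounded, so climbing from
   la ends at a maximal summand. *)
pose psi la := (\sum_(k < n.+1) sumn (take k la))%N.
have psi_le ka : is_partition n ka -> (psi ka <= n.+1 * n)%N.
  move=> part_ka; rewrite -[X in (_ <= X * _)%N]card_ord -sum_nat_const.
  apply: leq_sum => k _; rewrite -(below_row k part_ka).
  by rewrite -[X in (_ <= X)%N]card_ord max_card.
have [k] := ubnP (n.+1 * n - psi la)%N.
elim: k => // k IH in la *; move=> le_k sla; have [part_la _] := sla.
have [maxla|nmax] := classic (forall ka', summand ka' -> dominated la ka' -> ka' = la).
  by exists la => // k'.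
have [ka [ska la_ka neq]] : exists ka, [/\ summand ka, dominated la ka & ka <> la].
  apply: NNPP => none; case: nmax => ka ska la_ka.
  by apply: NNPP => neq; case: none; exists ka.
have [part_ka _] := ska.
have lt_psi : (psi la < psi ka)%N.
  rewrite ltn_neqAle leq_sum ?andbT; last by move=> i _; apply: la_ka.
  apply: contra_notN neq => /eqP psiE; apply: (dominated_anti part_ka part_la) => // i.
  have eq_of_sums a b s u : (a <= b -> s <= u -> a + s = b + u -> a == b)%N by lia.
  have eqT (i' : 'I_n.+1) : sumn (take i' la) = sumn (take i' ka).
    apply/eqP; move: psiE; rewrite /psi (bigD1 i') //= [in RHS](bigD1 i') //=.
    have := la_ka i'.
    have : (\sum_(j < n.+1 | j != i') sumn (take j la) <=
            \sum_(j < n.+1 | j != i') sumn (take j ka))%N.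
      by apply: leq_sum => j _; apply: la_ka.
    by move=> le_s le_i; apply: eq_of_sums le_s.
  have [lt_i|le_i] := ltnP i n.+1; first by rewrite (eqT (Ordinal lt_i)).
  have le_size mu : is_partition n mu -> (size mu <= i)%N.
    by move/size_partition/leq_trans; apply; apply: ltnW.
  by rewrite !take_oversize ?le_size // (sumn_partition part_la) (sumn_partition part_ka).
have [||m ka_m mmax] := IH ka; [have := psi_le ka part_ka; lia|by []|].
exists m => // i; exact: leq_trans (la_ka i) (ka_m i).
Qed.

(** Every summand lies below a maximal one, so a unique maximal summand is the greatest one, and its
    row colouring is the maximum weight. Conversely, a summand containing the maximum weight
    dominates the row weight of every other summand. *)
Lemma unique_maximal_summandP :
  (exists! la, summand la /\ forall la', summand la' -> dominated la la' -> la' = la)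
  <->
  (exists2 c0, rfix_mx rX (stab c0) != 0 &
     forall c : 'I_n -> nat, rfix_mx rX (stab c) != 0 ->
       forall k, (below c k <= below c0 k)%N).
Proof.
split=> [[la0 [[sla0 max0] uniq0]]|[c0 fix0 max0]].
  have [part0 sum0] := sla0; exists (@cell_row n la0).
    exact: summand_rfix sum0 (specht_rfix_row part0).
  move=> c /rfix_summand[la [part_la sum_la fix_la]] k.
  have [|ka la_ka max_ka] := @maximal_summand_above la; first by [].
  rewrite below_row // (uniq0 ka max_ka).
  exact: leq_trans (specht_rfix_below k part_la fix_la) (la_ka k).
have [la0 [part0 sum0 fix_la0]] := rfix_summand fix0.
have dom0 la : summand la -> dominated la la0.
  case=> part_la sum_la k; rewrite -(below_row k part_la).
  apply: leq_trans (specht_rfix_below k part0 fix_la0).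
  exact/max0/(summand_rfix sum_la)/specht_rfix_row.
exists la0; split=> [|la [sla maxla]].
  split=> // la' sla'; have [part' _] := sla' => le0'.
  by apply: (dominated_anti part' part0) => //; apply: dom0.
by rewrite (maxla la0) //; apply: dom0.
Qed.

End Summands.
End Dominance.

(** * Fixed vectors in induced modules *)

Section Induced.
Import GRing.Theory Num.Theory.
Local Open Scope ring_scope.
Variables (gT : finGroupType) (H : {group gT}) (d : nat).
Variable rV : mx_representation rat H d.
Local Notation T := (right_coset H).
Local Notation ind := (induced_repr rV).

Definition component (u : 'rV[rat]_#|{: T * 'I_d}|) (A : T) : 'rV_d :=
  \row_i u 0 (enum_rank (A, i)).

Lemma component_act u A g :
  component (u *m ind g) (coset_act A g) =
  component u A *m rV (repr (val A) * g * (repr (val (coset_act A g)))^-1)%g.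
Proof.
have memE (B C : T) : (repr (sval B) * g * (repr (sval C))^-1 \in H)%g = (coset_act B g == C).
  exact: (mem_coset_repr B C g).
have [Ag AgE] : exists B, B = coset_act A g by exists (coset_act A g).
rewrite -AgE; apply/rowP=> j; rewrite !mxE (reindex (@enum_rank (T * 'I_d)%type)) /=.
  rewrite sum_pair (bigD1 A) //= [X in _ + X]big1 => [|B nBA]; last first.
    rewrite big1 // => i _; rewrite !mxE !enum_rankK /= memE.
    rewrite (_ : (_ == _) = false) ?mulr0 //; apply: contraNF nBA => /eqP.
    move/(congr1 (fun C => coset_act C g^-1%g)).
    by rewrite AgE -!coset_actM mulgV !coset_act1 => ->.
  rewrite addr0; apply: eq_bigr => i _; rewrite !mxE !enum_rankK /= memE.
  by rewrite -AgE eqxx.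
exact/onW_bij/enum_rank_bij.
Qed.

Lemma component_eq0 u : (forall A, component u A = 0) -> u = 0.
Proof.
move=> u0; apply/rowP=> k; rewrite -[k]enum_valK; case: (enum_val k) => A i.
by have /rowP/(_ i) := u0 A; rewrite !mxE.
Qed.

Lemma component_sum I (r : seq I) (P : pred I) F A :
  component (\sum_(i <- r | P i) F i) A = \sum_(i <- r | P i) component (F i) A.
Proof.
by apply/rowP=> j; rewrite !mxE !summxE; apply: eq_bigr => i _; rewrite !mxE.
Qed.

(** Mackey's criterion. A nonzero component of a K-fixed vector at the coset of g is fixed by H meet
    g K g^-1. Conversely, place such a vector at that coset and sum over K. *)
Lemma rfix_induced (K : {group gT}) :
  rfix_mx ind K != 0 <-> exists g, rfix_mx rV (H :&: K :^ g^-1)%g != 0.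
Proof.
split=> [/rfix_neq0P[u nzu uK]|[g /rfix_neq0P[w nzw wK]]].
  have [A nzA] : exists A, component u A != 0.
    apply/existsP; apply: contraR nzu => /existsPn u0.
    by apply/eqP/component_eq0 => A; have := u0 A; rewrite negbK => /eqP.
  exists (repr (val A)); apply/rfix_neq0P; exists (component u A) => // h.
  set a := repr (val A); rewrite inE => /andP[Hh]; rewrite mem_conjgV => Kh.
  have Ah : coset_act A (h ^ a)%g = A.
    apply: val_inj; rewrite /= [val A]coset_repr -/a -rcosetM conjgE !mulgA mulgV mul1g.
    by rewrite rcosetM rcoset_id.
  have := component_act u A (h ^ a)%g; rewrite Ah uK // -/a => {2}->.
  by rewrite conjgE !mulgA mulgV mul1g mulgK.
pose A0 := coset_of_elt H g; pose a0 := repr (val A0).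
have [h Hh a0E] : exists2 h, h \in H & a0 = (h * g)%g.
  by apply/rcosetP; rewrite -(rcoset_repr H g); apply: rcoset_refl.
pose x0 := w *m rV h^-1%g.
have nzx0 : x0 != 0.
  apply: contraNneq nzw => x00.
  by rewrite -[w](repr_mxK rV (groupVr Hh)) -/x0 x00 mul0mx.
pose u0 : 'rV[rat]_#|{: T * 'I_d}| :=
  \row_k (if (enum_val k).1 == A0 then x0 0 (enum_val k).2 else 0).
have u0E A : component u0 A = if A == A0 then x0 else 0.
  by apply/rowP=> i; rewrite !mxE enum_rankK /=; case: ifP; rewrite ?mxE.
pose u := \sum_(k in K) u0 *m ind k.
have uK k : k \in K -> u *m ind k = u.
  move=> Kk; rewrite /u mulmx_suml [RHS](reindex_inj (mulIg k)).
  apply: eq_big => [l|l _]; first by rewrite groupMr.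
  by rewrite -mulmxA -repr_mxM ?inE.
apply/rfix_neq0P; exists u => //.
suff: component u A0 != 0.
  by apply: contraNneq => ->; apply/eqP/rowP=> i; rewrite !mxE.
(* The elements of K that stabilise the coset bring back the same vector and the others contribute
   nothing, so the component of the sum is a positive multiple of [x0]. *)
have uE k : k \in K ->
    component (u0 *m ind k) A0 = (coset_act A0 k == A0)%:R *: x0.
  move=> Kk; have [/eqP A0k|nA0k] := boolP (coset_act A0 k == A0).
    have := component_act u0 A0 k; rewrite A0k u0E eqxx -/a0 scale1r => ->.
    have Hx : (a0 * k * a0^-1)%g \in H by rewrite mem_coset_repr A0k.
    have xE : (a0 * k * a0^-1 = h * (k ^ g^-1) * h^-1)%g.
      by rewrite a0E conjgE invgK invMg !mulgA.
    have Hkg : (k ^ g^-1)%g \in H by rewrite xE groupMr ?groupV // groupMl in Hx.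
    rewrite xE (repr_mxM rV (groupM Hh Hkg) (groupVr Hh)) (repr_mxM rV Hh Hkg).
    rewrite /x0 !mulmxA repr_mxKV // (wK (k ^ g^-1)%g) //.
    by rewrite inE Hkg memJ_conjg.
  have [B BE] : exists B, B = coset_act A0 k^-1%g by eexists.
  have Bk : coset_act B k = A0 by rewrite BE -coset_actM mulVg coset_act1.
  have nBA0 : B != A0 by apply: contraNneq nA0k => BA0; rewrite -{1}BA0 Bk.
  by have := component_act u0 B k; rewrite Bk u0E (negPf nBA0) mul0mx scale0r.
rewrite component_sum (eq_bigr _ uE) -scaler_suml scaler_eq0 negb_or nzx0 andbT.
rewrite -natr_sum pnatr_eq0 -lt0n (bigD1 1%g) //.
by rewrite coset_act1 eqxx.
Qed.

End Induced.

(** * Fixed vectors in generalized Foulkes modules *)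

Section Contraction.
Import GRing.Theory Num.Theory.
Local Open Scope ring_scope.
Variables (m n d e : nat).
Hypothesis m_gt0 : (0 < m)%N.
Variables (rW : mx_representation rat [set: 'S_m] d).
Variables (rZ : mx_representation rat [set: 'S_n] e).
Local Notation idx := ({ffun 'I_n -> 'I_d} * 'I_e)%type.
Implicit Types (u : 'rV[rat]_#|{: idx}|) (phi : 'I_n -> 'cV[rat]_d).

(** Pairs the i-th tensor factor with the functional [phi i], leaving a vector of the outer
    module. *)
Definition contraction u phi : 'rV_e :=
  \row_q \sum_(a : {ffun 'I_n -> 'I_d}) (\prod_i phi i (a i) 0) * u 0 (enum_rank (a, q)).

Lemma contraction_act u phi f s :
  contraction (u *m oslash rW rZ (wreath_perm f s)) phi =
  contraction u (fun i => rW (f i) *m phi (s i)) *m rZ s.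
Proof.
apply/rowP=> q; rewrite !mxE.
under eq_bigr => b _ do
  (rewrite mxE (reindex (@enum_rank idx)) /=; last exact/onW_bij/enum_rank_bij).
under eq_bigr => b _ do rewrite sum_pair mulr_sumr.
rewrite exchange_big /=.
under [RHS]eq_bigr => p _ do rewrite mxE mulr_suml.
rewrite [RHS]exchange_big /=; apply: eq_bigr => a _.
under eq_bigr => b _ do rewrite mulr_sumr.
rewrite exchange_big /=; apply: eq_bigr => p _.
under [in RHS]eq_bigr => i _ do rewrite mxE.
rewrite bigA_distr_bigA /= -!mulrA mulr_suml.
rewrite (reindex (fun b : {ffun 'I_n -> 'I_d} => [ffun i => b (s^-1 i)%g])) /=; last first.
  exists (fun b : {ffun 'I_n -> 'I_d} => [ffun i => b (s i)]) => b _;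
  by apply/ffunP=> i; rewrite !ffunE ?permKV ?permK.
apply: eq_bigr => b _; rewrite !mxE !enum_rankK /= wreath_baseE wreath_topE m_gt0.
rewrite big_split /= [X in X * _ = _](reindex_inj (@perm_inj _ s)) /=.
under eq_bigr => i _ do rewrite ffunE permK.
under [X in _ * (_ * (X * _)) = _]eq_bigr => i _ do rewrite ffunE permK.
ring.
Qed.

Lemma contraction_mul u (L : 'I_n -> 'M[rat]_d) (b : 'I_n -> 'cV[rat]_d) :
  contraction u (fun i => L i *m b i) =
  \sum_(p : {ffun 'I_n -> 'I_d})
    (\prod_i b i (p i) 0) *: contraction u (fun i => col (p i) (L i)).
Proof.
apply/rowP=> q; rewrite !mxE summxE.
transitivity (\sum_(a : {ffun 'I_n -> 'I_d}) \sum_(p : {ffun 'I_n -> 'I_d})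
    (\prod_i (L i (a i) (p i) * b i (p i) 0)) * u 0 (enum_rank (a, q))).
  apply: eq_bigr => a _; under [in LHS]eq_bigr => i _ do rewrite mxE.
  by rewrite bigA_distr_bigA mulr_suml.
rewrite exchange_big /=; apply: eq_bigr => p _; rewrite !mxE mulr_sumr.
apply: eq_bigr => a _; rewrite big_split /= [RHS]mulrA; congr (_ * _).
by rewrite mulrC; congr (_ * _); apply: eq_bigr => i _; rewrite mxE.
Qed.

Lemma contraction_family u (J : finType) (Q : 'I_n -> pred J) (psi : 'I_n -> J -> 'cV[rat]_d) :
  contraction u (fun i => \sum_(j | Q i j) psi i j) =
  \sum_(f in family Q) contraction u (fun i => psi i (f i)).
Proof.
apply/rowP=> q; rewrite !mxE summxE.
under [RHS]eq_bigr => f _ do rewrite mxE.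
rewrite [RHS]exchange_big /=; apply: eq_bigr => a _.
under eq_bigr => i _ do rewrite summxE.
by rewrite bigA_distr_big_dep mulr_suml.
Qed.

Lemma contraction_neq0 u : u != 0 -> exists phi, contraction u phi != 0.
Proof.
move=> nzu; have [[a p] nz] : exists ap : idx, u 0 (enum_rank ap) != 0.
  apply/existsP; apply: contraR nzu => /existsPn u0; apply/eqP/rowP=> k.
  by have := u0 (enum_val k); rewrite negbK enum_valK mxE => /eqP.
exists (fun i => delta_mx (a i) 0); apply: contraNneq nz => /rowP/(_ p).
rewrite !mxE (bigD1 a) //= big1 ?mul1r => [|i _]; last by rewrite mxE !eqxx.
rewrite big1 ?addr0 => [-> //|b nba].
have [i nbai] : exists i, b i != a i.
  by apply/existsP; apply: contraR nba => /existsPn ab; apply/eqP/ffunP=> i;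
    apply/eqP; have := ab i; rewrite negbK.
by rewrite (bigD1 i) //= mxE (negPf nbai) /= !mul0r.
Qed.

Lemma contraction_sum I (r : seq I) (P : pred I) F phi :
  contraction (\sum_(i <- r | P i) F i) phi = \sum_(i <- r | P i) contraction (F i) phi.
Proof.
apply/rowP=> q; rewrite summxE !mxE.
under eq_bigr => a _ do rewrite summxE mulr_sumr.
by rewrite exchange_big /=; apply: eq_bigr => i _; rewrite mxE.
Qed.

Definition pure_tensor (B : 'I_n -> 'rV[rat]_d) (z : 'rV[rat]_e) : 'rV_#|{: idx}| :=
  \row_k let ap : idx := enum_val k in (\prod_i B i 0 (ap.1 i)) * z 0 ap.2.

Lemma contraction_pure B z phi :
  contraction (pure_tensor B z) phi = (\prod_i (B i *m phi i) 0 0) *: z.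
Proof.
apply/rowP=> q; rewrite !mxE.
under [in RHS]eq_bigr => i _ do rewrite mxE.
rewrite bigA_distr_bigA mulr_suml; apply: eq_bigr => a _.
rewrite mxE enum_rankK /= mulrA -big_split /=; congr (_ * _).
by apply: eq_bigr => i _; rewrite mulrC.
Qed.

End Contraction.

(** * Fixed vectors of block stabilisers in the wreath product *)

Section WreathFixed.
Import GRing.Theory Num.Theory.
Local Open Scope ring_scope.
Variables (m n d e : nat).
Hypothesis m_gt0 : (0 < m)%N.
Variables (rW : mx_representation rat [set: 'S_m] d).
Variables (rZ : mx_representation rat [set: 'S_n] e).
Variable C : 'I_n -> m.-tuple nat.
Hypothesis sortedC : forall i, sorted leq (C i).

Definition block_coloring (D : 'I_n -> m.-tuple nat) (x : 'I_(m * n)) : nat :=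
  tnth (D (cell_inv x).2) (cell_inv x).1.

Lemma block_coloringE D k i : block_coloring D (cell k i) = tnth (D i) k.
Proof. by rewrite /block_coloring cellK. Qed.

Lemma colors_tnth (t : m.-tuple nat) : colors (tnth t) = t.
Proof. by rewrite -[RHS](map_tnth_enum t). Qed.

(** Sorting makes blocks with the same multiset of colours carry the same tuple, so the stabiliser
    splits into block stabilisers and permutations of equal blocks. *)
Lemma wreath_perm_stab f s :
  (wreath_perm f s \in stab (block_coloring C)) =
  (s \in stab C) && [forall i, f i \in stab (tnth (C i))].
Proof.
apply/stabP/andP=> [fs|[/stabP sC /forallP fC] x]; last first.
  rewrite -[x]cell_invK wreath_permE !block_coloringE sC.
  by have /stabP -> := fC (cell_inv x).2.
have fsC k i : tnth (C (s i)) (f i k) = tnth (C i) k.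
  by have := fs (cell k i); rewrite wreath_permE !block_coloringE.
have sC i : C (s i) = C i.
  apply/val_inj/(sorted_eq leq_trans anti_leq); rewrite ?sortedC //.
  have -> : val (C i) = colors (tnth (C (s i)) \o f i).
    by rewrite -[LHS]colors_tnth; apply: eq_map => k /=; rewrite fsC.
  by rewrite -[X in perm_eq X]colors_tnth perm_sym perm_colors_comp.
split; first by apply/stabP.
by apply/forallP=> i; apply/stabP=> k; rewrite -[in LHS]sC fsC.
Qed.

Local Notation F i := (stab_group (tnth (C i))).

Lemma rank_sym_sum (D : 'I_m -> nat) :
  \rank (sym_sum rW (stab D)) = \rank (rfix_mx rW (stab D)).
Proof.
apply/eqP; rewrite eqn_leq; apply/andP; split; apply/mxrankS.
  by apply/rfix_mxP=> g gD; rewrite sym_sum_mul.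
apply/rV_subP=> v /rfix_mxP vD; have nzD : #|stab D|%:R != 0 :> rat.
  by rewrite pnatr_eq0 -lt0n cardG_gt0.
rewrite -[v](scalerK nzD) -(sym_sum_fixed vD) scalemx_sub // submxMl //.
Qed.

(** Base group elements fixing u can be moved onto the functionals, so averaging the functionals
    only multiplies the contraction by the number of such elements. *)
Lemma contraction_average (u : 'rV_#|{: {ffun 'I_n -> 'I_d} * 'I_e}|) phi :
  (forall g, g \in (wreath_group m n :&: stab (block_coloring C))%g ->
     u *m oslash rW rZ g = u) ->
  contraction u phi != 0 ->
  contraction u (fun i => sym_sum rW (F i) *m phi i) != 0.
Proof.
move=> uC nzu; pose Q i := [pred g : 'S_m | g \in F i].
suff -> : contraction u (fun i => sym_sum rW (F i) *m phi i) =
    #|[pred f in family Q]|%:R *: contraction u phi.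
  rewrite scaler_eq0 negb_or nzu andbT pnatr_eq0 -lt0n.
  apply/card_gt0P; exists [ffun=> 1%g]; apply/familyP=> i; rewrite ffunE.
  exact: group1.
transitivity (contraction u (fun i => \sum_(g | Q i g) rW g *m phi i)).
  apply/rowP=> q; rewrite !mxE; apply: eq_bigr => a _; congr (_ * _).
  by apply: eq_bigr => i _; rewrite mulmx_suml.
rewrite contraction_family scaler_nat -sumr_const; apply: eq_bigr => f /familyP fF.
have gC : wreath_perm f 1 \in (wreath_group m n :&: stab (block_coloring C))%g.
  rewrite inE wreath_perm_stab group1 andTb; apply/andP; split.
    by apply/wreathP; exists f, 1%g.
  by apply/forallP=> i; apply: fF.
rewrite -{2}(uC _ gC) contraction_act // repr_mx1 mulmx1.
by apply/rowP=> q; rewrite !mxE; apply: eq_bigr => a _; congr (_ * _);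
  apply: eq_bigr => i _; rewrite perm1.
Qed.

(** After averaging, the functionals lie in the images of the symmetrisers. Multilinearity then
    yields one column index per block with nonzero contraction; this contraction is fixed by the top
    permutations that preserve contents and indices. *)
Lemma oslash_rfix_labels :
  rfix_mx (oslash rW rZ) (wreath_group m n :&: stab (block_coloring C))%g != 0 ->
  exists a : 'I_n -> nat,
    (forall i, (a i < \rank (rfix_mx rW (stab (tnth (C i)))))%N) /\
    rfix_mx rZ (stab (fun i => (C i, a i))) != 0.
Proof.
case/rfix_neq0P=> u nzu uC.
have [phi0 /(contraction_average uC)] := contraction_neq0 nzu.
pose A i := sym_sum rW (F i).
(* A rank factorisation of the symmetriser: only the first [\rank (A i)] columns of [L i] are
   nonzero, which bounds the chosen indices. *)
pose L i := col_ebase (A i) *m (pid_mx (\rank (A i)) : 'M_d).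
have -> : contraction u (fun i => A i *m phi0 i) =
    contraction u (fun i => L i *m (row_ebase (A i) *m phi0 i)).
  apply/rowP=> q; rewrite !mxE; apply: eq_bigr => a _; congr (_ * _).
  by apply: eq_bigr => i _; rewrite mulmxA mulmx_ebase.
rewrite contraction_mul => nzs.
have [p nzp] : exists p : {ffun 'I_n -> 'I_d}, contraction u (fun i => col (p i) (L i)) != 0.
  apply/existsP; apply: contraR nzs => /existsPn p0; rewrite big1 // => p _.
  by have := p0 p; rewrite negbK => /eqP->; rewrite scaler0.
exists (fun i => p i); split=> [i|].
  rewrite -rank_sym_sum ltnNge; apply: contra nzp => le_rp.
  apply/eqP/rowP=> q; rewrite !mxE big1 // => a _; rewrite (bigD1 i) //=.
  rewrite !mxE big1 ?mul0r // => k _; rewrite !mxE.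
  case: eqP => [->|_] /=; last by rewrite mulr0.
  by rewrite ltnNge le_rp mulr0.
apply/rfix_neq0P; exists (contraction u (fun i => col (p i) (L i))) => // s /stabP sC.
have Cs i : C (s i) = C i by case: (sC i).
have ps i : p (s i) = p i by case: (sC i) => _ /val_inj.
have gC : wreath_perm [ffun=> 1%g] s \in (wreath_group m n :&: stab (block_coloring C))%g.
  rewrite inE wreath_perm_stab; apply/and3P; split.
  - by apply/wreathP; do 2 eexists.
  - by apply/stabP.
  - by apply/forallP=> i; rewrite ffunE group1.
rewrite -[in RHS](uC _ gC) contraction_act //; congr (_ *m _).
apply/rowP=> q; rewrite !mxE; apply: eq_bigr => a _; congr (_ * _).
by apply: eq_bigr => i _; rewrite ffunE repr_mx1 mul1mx ps /L /A /= Cs.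
Qed.

(** Symmetrise the pure tensor of the basis vectors numbered [a i] with z, and contract with the
    dual basis. A group element contributes z if its top permutation preserves the indices and 0
    otherwise, so nothing cancels. *)
Lemma oslash_labels_rfix (a : 'I_n -> nat) :
  (forall i, (a i < \rank (rfix_mx rW (stab (tnth (C i)))))%N) ->
  rfix_mx rZ (stab (fun i => (C i, a i))) != 0 ->
  rfix_mx (oslash rW rZ) (wreath_group m n :&: stab (block_coloring C))%g != 0.
Proof.
move=> lt_a /rfix_neq0P[z nzz zC].
pose X i := rfix_mx rW (stab (tnth (C i))).
have lt_ad i : (a i < d)%N := leq_trans (lt_a i) (rank_leq_row _).
pose p i := Ordinal (lt_ad i).
pose B i := row (p i) (pid_mx (\rank (X i)) *m row_ebase (X i)).
pose phi i := col (p i) (invmx (row_ebase (X i))).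
have BX i : (B i <= X i)%MS.
  have full : row_full (col_ebase (X i)) by rewrite row_full_unit col_ebase_unit.
  have := eqmxMfull (pid_mx (\rank (X i)) *m row_ebase (X i)) full.
  by rewrite mulmxA mulmx_ebase => E; rewrite (submx_trans (row_sub _ _)) // E.
have Bphi i j : C i = C j -> (B i *m phi j) 0 0 = (p i == p j)%:R.
  move=> Cij; transitivity ((pid_mx (\rank (X i)) *m row_ebase (X i) *m
      invmx (row_ebase (X i))) (p i) (p j)).
    by rewrite /phi /X -Cij [LHS]mxE [RHS]mxE; apply: eq_bigr => k _; rewrite !mxE.
  by rewrite mulmxK ?row_ebase_unit // mxE /= lt_a andbT.
pose K := (wreath_group m n :&: stab_group (block_coloring C))%G.
pose u := \sum_(k in K) pure_tensor B z *m oslash rW rZ k.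
have uK g : g \in K -> u *m oslash rW rZ g = u.
  move=> Kg; have Wg := subsetP (subsetIl _ _) _ Kg.
  rewrite /u mulmx_suml [RHS](reindex_inj (mulIg g)).
  apply: eq_big => [k|k Kk]; first by rewrite groupMr.
  by rewrite -mulmxA -repr_mxM // (subsetP (subsetIl _ _) _ Kk).
apply/rfix_neq0P; exists u => //.
suff: contraction u phi != 0.
  apply: contraNneq => ->; apply/eqP/rowP=> q; rewrite !mxE big1 // => b _.
  by rewrite mxE mulr0.
have uE k : k \in K -> contraction (pure_tensor B z *m oslash rW rZ k) phi =
    [forall i, p (wreath_top k i) == p i]%:R *: z.
  rewrite inE => /andP[/wreathP[f [s ->]]]; rewrite wreath_perm_stab.
  case/andP=> /stabP sC /forallP fC; rewrite contraction_act // contraction_pure.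
  rewrite wreath_topE m_gt0 -scalemxAl.
  have -> : \prod_i (B i *m (rW (f i) *m phi (s i))) 0 0 = \prod_i (p i == p (s i))%:R :> rat.
    apply: eq_bigr => i _; rewrite mulmxA (rfix_mxP _ (BX i)) ?fC //.
    by apply: Bphi; rewrite sC.
  case: forallP => [ps|nps]; last first.
    have [i npi] : exists i, p (s i) != p i.
      by apply/existsP; apply: contra_notT nps => /existsPn ps i; have := ps i; rewrite negbK.
    by rewrite (bigD1 i) //= eq_sym (negPf npi) !mul0r !scale0r.
  rewrite big1 => [|i _]; last by rewrite eq_sym ps.
  rewrite zC //; apply/stabP=> i; rewrite sC; congr (_, _).
  by have /eqP/(congr1 val) := ps i.
rewrite contraction_sum (eq_bigr _ uE) -scaler_suml scaler_eq0 negb_or nzz andbT.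
rewrite -natr_sum pnatr_eq0 -lt0n (bigD1 1%g) ?(group1 K) //= -wreath_perm1.
rewrite wreath_topE m_gt0 (_ : [forall i, _] = true) //.
by apply/forallP=> i; rewrite perm1.
Qed.

Lemma rank_block_rfix (w : 'S_(m * n)) (K : {group 'S_(m * n)}) :
  w \in wreath_group m n ->
  (rfix_mx (oslash rW rZ) ((wreath_group m n :&: K) :^ w)%g != 0) =
  (rfix_mx (oslash rW rZ) (wreath_group m n :&: K)%g != 0).
Proof.
move=> Ww; rewrite -!mxrank_eq0 (rfix_mx_conjsg (oslash rW rZ)) ?subsetIl //.
by rewrite mxrankMfree // row_free_unit (repr_mx_unit (oslash rW rZ)).
Qed.

End WreathFixed.

Section FoulkesFixed.
Import GRing.Theory Num.Theory.
Local Open Scope ring_scope.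
Variables (m n d e : nat).
Hypothesis m_gt0 : (0 < m)%N.
Variables (rW : mx_representation rat [set: 'S_m] d).
Variables (rZ : mx_representation rat [set: 'S_n] e).

(* A plethystic tableau: the i-th block carries the multiset of colours C i   *)
(* together with the index a i of a basis vector of the space of fixed        *)
(* vectors of weight C i in the inner module.                                 *)
Definition plethystic_tableau (C : 'I_n -> m.-tuple nat) (a : 'I_n -> nat) :=
  [/\ forall i, sorted leq (C i),
      forall i, (a i < \rank (rfix_mx rW (stab (tnth (C i)))))%N
    & rfix_mx rZ (stab (fun i => (C i, a i))) != 0].

Lemma below_block (C : 'I_n -> m.-tuple nat) k :
  below (block_coloring C) k = (\sum_i count (fun x => (x < k)%N) (C i))%N.
Proof.
rewrite /below -sum1dep_card (reindex (fun ki : 'I_m * 'I_n => cell ki.1 ki.2)) /=; last first.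
  by exists (@cell_inv m n) => [[k' i]|x] _; rewrite ?cellK ?cell_invK.
rewrite big_mkcond sum_pair exchange_big /=; apply: eq_bigr => i _.
under eq_bigr => k' _ do rewrite /= block_coloringE.
by rewrite -[in RHS](colors_tnth (C i)) count_colors -sum1dep_card [RHS]big_mkcond.
Qed.

(** Mackey's criterion provides an arrangement of the colours in the blocks; the base group then
    sorts each block. *)
Lemma foulkes_rfixP (c : 'I_(m * n) -> nat) :
  rfix_mx (induced_repr (oslash rW rZ)) (stab c) != 0 <->
  exists (C : 'I_n -> m.-tuple nat) (a : 'I_n -> nat) (t : 'S_(m * n)),
    plethystic_tableau C a /\ block_coloring C =1 c \o t.
Proof.
have stabE (t : 'S_(m * n)) : (stab c :^ t^-1)%g = stab (c \o t).
  by apply/setP=> s; rewrite stab_conj invgK.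
rewrite (rfix_induced _ (stab_group c)) /=; split=> [[g]|[C [a [t [[sC lt_a fZ] Ct]]]]]; last first.
  exists t; rewrite stabE (eq_stab (c' := block_coloring C)) => [|x y]; last by rewrite !Ct.
  exact: oslash_labels_rfix fZ.
rewrite stabE => fixg; pose c1 i k := c (g (cell k i)).
have sortP i : exists (D : m.-tuple nat) (f : 'S_m),
    sorted leq D /\ forall k, c1 i (f k) = tnth D k.
  have sz : size (sort leq (colors (c1 i))) == m by rewrite size_sort size_colors.
  pose D := Tuple sz; have [|f fE] := @perm_colors _ _ (tnth D) (c1 i).
    by rewrite colors_tnth perm_sort perm_refl.
  by exists D, f; split=> // ; apply: sort_sorted leq_total _.
have [C CP] := fin_all_exists sortP; have [f fP] := fin_all_exists CP.
pose w := wreath_perm [ffun i => f i] 1.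
have Cw : block_coloring C =1 c \o (w * g)%g.
  move=> x; rewrite -[x]cell_invK block_coloringE /= permM wreath_permE ffunE perm1.
  by case: (fP (cell_inv x).2) => _ <-.
have sortedC i : sorted leq (C i) by case: (fP i).
have Ww : w \in wreath_group m n by apply/wreathP; do 2 eexists.
have fixC : rfix_mx (oslash rW rZ) (wreath_group m n :&: stab (block_coloring C))%g != 0.
  rewrite -(rank_block_rfix rW rZ (stab_group (block_coloring C)) Ww) conjIg conjGid //.
  rewrite (_ : (stab_group _ :^ w)%g = stab (c \o g)) //; apply/setP=> s.
  rewrite stab_conj (eq_stab (c' := c \o g)) // => x y /=.
  by rewrite !Cw /= !permM !permKV.
have [a [lt_a fZ]] := oslash_rfix_labels m_gt0 sortedC fixC.
by exists C, a, (w * g)%g; split.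
Qed.

End FoulkesFixed.

(** * The weight spaces of the inner module *)

Section Recolor.
Variables (m : nat).
Implicit Types (c : 'I_m -> nat).

Lemma card_recolor (P : pred nat) c i y :
  #|[set x | P (recolor c i y x)]| + P (c y) = #|[set x | P (c x)]| + P i.
Proof.
rewrite -!sum1dep_card big_mkcond [in RHS]big_mkcond /=.
rewrite (bigD1 y) //= [in RHS](bigD1 y) //= /recolor eqxx.
rewrite (eq_bigr (fun x => if P (c x) then 1 else 0)) => [|x /negPf->] //.
by case: (P i); case: (P (c y)); lia.
Qed.

Lemma below_recolor c i y k :
  below (recolor c i y) k + (c y < k) = below c k + (i < k).
Proof. exact: (card_recolor (fun x => x < k)). Qed.

Lemma sort_colorsP c : size (sort leq (colors c)) == m.
Proof. by rewrite size_sort size_colors. Qed.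

Definition content c : m.-tuple nat := Tuple (sort_colorsP c).

Lemma content_sorted c : sorted leq (content c).
Proof. exact: sort_sorted leq_total _. Qed.

Lemma perm_content c : perm_eq (content c) (colors c).
Proof. by rewrite perm_sort. Qed.

Definition count_lt (C : m.-tuple nat) k := count (fun x => x < k) C.

Lemma count_lt_content c k : count_lt (content c) k = below c k.
Proof. by rewrite /count_lt (seq.permP (perm_content c)) count_colors. Qed.

Lemma sorted_count_mem (C D : m.-tuple nat) : sorted leq C -> sorted leq D ->
  (forall k, count_mem k C = count_mem k D) -> C = D.
Proof.
move=> sC sD CD; apply/val_inj/(sorted_eq leq_trans anti_leq) => //.
by apply/allP=> k _ /=; rewrite CD.
Qed.

Lemma count_mem_lt (C : m.-tuple nat) k : count_mem k C + count_lt C k = count_lt C k.+1.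
Proof.
rewrite /count_lt -count_predUI [X in _ + X](_ : _ = 0) ?addn0.
  by apply: eq_count => x /=; rewrite ltnS [RHS]leq_eqVlt.
by apply/eqP; rewrite -leqn0 leqNgt -has_count; apply/hasP=> -[x _] /= /andP[/eqP->]; rewrite ltnn.
Qed.

Lemma sorted_count_lt (C D : m.-tuple nat) : sorted leq C -> sorted leq D ->
  (forall k, count_lt C k = count_lt D k) -> C = D.
Proof.
move=> sC sD CD; apply: sorted_count_mem => // k.
by have := count_mem_lt C k; rewrite !CD -count_mem_lt => /addIn.
Qed.

End Recolor.

Section InnerModule.
Import GRing.Theory.
Local Open Scope ring_scope.
Variables (m d : nat) (mu : seq nat).
Hypothesis part_mu : is_partition m mu.
Variable rW : mx_representation rat [set: 'S_m] d.
Hypothesis sim_mu : mx_rsim rW (specht m mu).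
Local Open Scope nat_scope.
Local Notation crow := (@cell_row m mu).
Local Notation ccol := (@cell_col m mu).

Definition kostka_number (C : m.-tuple nat) := \rank (rfix_mx rW (stab (tnth C))).
Definition top_content := content crow.
Local Notation kostka := kostka_number.
Local Notation top := top_content.

Lemma kostka_rank (C : m.-tuple nat) c : perm_eq C (colors c) ->
  kostka C = \rank (rfix_mx (specht m mu) (stab c)).
Proof.
move=> Cc; rewrite /kostka_number (rank_rfix_rsim (subsetT _) sim_mu).
have [|t tE] := @perm_colors _ _ (tnth C) c; first by rewrite colors_tnth.
rewrite -(rank_rfix_comp _ c t); congr (\rank (rfix_mx _ _)).
by apply: eq_stab => x y; rewrite !tE.
Qed.

Lemma kostka_content c : kostka (content c) = \rank (rfix_mx (specht m mu) (stab c)).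
Proof. exact/kostka_rank/perm_content. Qed.

Lemma kostka_top : kostka top = 1.
Proof. by rewrite kostka_content (rank_specht_row_fixed part_mu). Qed.

Lemma kostka_increasing c :
  (forall x y, ccol x = ccol y -> (crow x < crow y) -> (c x < c y)) ->
  0 < kostka (content c).
Proof. by move=> incr; rewrite kostka_content lt0n mxrank_eq0 specht_rfix_increasing. Qed.

Lemma kostka_le (C : m.-tuple nat) ks : 0 < kostka C ->
  count (mem ks) C <= sumn (take (size ks) mu).
Proof.
rewrite (kostka_rank (c := tnth C)) ?colors_tnth // lt0n mxrank_eq0 => fixC.
by rewrite -{1}(colors_tnth C) count_colors specht_rfix_le.
Qed.

Lemma kostka_count_lt (C : m.-tuple nat) k : 0 < kostka C ->
  count_lt C k <= sumn (take k mu).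
Proof.
move=> /(kostka_le (iota 0 k)); rewrite size_iota; apply: leq_trans.
by apply: sub_count => x /=; rewrite mem_iota.
Qed.

Lemma count_lt_top k : count_lt top k = sumn (take k mu).
Proof. by rewrite count_lt_content below_row. Qed.

Lemma corner_ex i : nth 0 mu i.+1 < nth 0 mu i ->
  exists2 x, crow x = i & forall y, ccol y = ccol x -> crow y <= i.
Proof.
move=> lt_i; have [|x rx cx] := @cell_ex _ _ part_mu i (nth 0 mu i).-1; first by lia.
exists x => // y; rewrite cx => cy; rewrite leqNgt; apply/negP => lt_iy.
have := col_lt part_mu y; have := nth_partition_le part_mu lt_iy; lia.
Qed.

Lemma corner_increasing k z : crow z <= k ->
  (forall y, ccol y = ccol z -> crow y <= crow z) ->
  forall x y, ccol x = ccol y -> crow x < crow y -> recolor crow k z x < recolor crow k z y.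
Proof.
move=> le_zk bot x y cxy lt_xy; rewrite /recolor.
have [xz|_] := eqVneq x z; last by case: eqP => [yz|//]; rewrite -yz in le_zk; lia.
by have := bot y; rewrite -cxy xz => /(_ erefl); rewrite -xz; lia.
Qed.


End InnerModule.

Lemma sumn_take_rect a b k : sumn (take k (nseq b.+1 a)) = minn k b.+1 * a.
Proof.
rewrite sumn_take; elim: k => [|k IH]; first by rewrite big_ord0 min0n.
have -> : minn k.+1 b.+1 = minn k b.+1 + (k < b.+1) by lia.
by rewrite big_ord_recr IH nth_nseq /= mulnDl; case: ifP; rewrite ?mul1n ?mul0n.
Qed.

Section Rectangle.
Import GRing.Theory.
Local Open Scope ring_scope.
Variables (m d : nat) (a b : nat).
Local Notation mu := (nseq b.+1 a).
Hypothesis part_mu : is_partition m mu.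
Variable rW : mx_representation rat [set: 'S_m] d.
Hypothesis sim_mu : mx_rsim rW (specht m mu).
Local Open Scope nat_scope.
Local Notation crow := (@cell_row m mu).
Local Notation ccol := (@cell_col m mu).
Local Notation kostka := (@kostka_number m d rW).
Local Notation top := (top_content m mu).

Lemma rect_size : m = b.+1 * a.
Proof. by rewrite -(sumn_partition part_mu) sumn_nseq mulnC. Qed.

Lemma crow_rect x : crow x <= b.
Proof. by have := row_lt part_mu x; rewrite size_nseq. Qed.

(* The full strength of dominance is needed: it bounds the multiplicity of    *)
(* each single colour.                                                        *)
Lemma kostka_rect_top (C : m.-tuple nat) : sorted leq C -> 0 < kostka C ->
  count_lt C b.+1 = m -> C = top.
Proof.
move=> sC KC Cb.
have le_a k : count_mem k C <= a.
  apply: leq_trans (_ : count (mem [:: k]) C <= _).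
    by apply: sub_count => x /= /eqP->; rewrite inE.
  apply: leq_trans (kostka_le part_mu sim_mu [:: k] KC) _.
  by rewrite sumn_take_rect /= (minn_idPl _) // mul1n.
have sumC k : count_lt C k = \sum_(i < k) count_mem (i : nat) C.
  elim: k => [|k IH].
    rewrite big_ord0; apply/eqP; rewrite -leqn0 leqNgt -has_count.
    by apply/hasP=> -[x _] /=; rewrite ltn0.
  by rewrite big_ord_recr /= -IH addnC count_mem_lt.
have eq_a k : k <= b -> count_mem k C = a.
  move=> le_kb; apply/eqP; rewrite eqn_leq le_a leqNgt; apply/negP => lt_a.
  have le_kb' : k < b.+1 by [].
  have: count_lt C b.+1 < b.+1 * a.
    rewrite sumC -[X in _ < X * _]card_ord -sum_nat_const.
    rewrite (bigD1 (Ordinal le_kb')) //= [X in _ < X](bigD1 (Ordinal le_kb')) //=.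
    by rewrite -addSn leq_add // leq_sum.
  by rewrite Cb -rect_size ltnn.
apply: (sorted_count_lt sC (content_sorted _)) => k; rewrite count_lt_top //.
rewrite sumn_take_rect; have [le_kb|lt_bk] := leqP k b.+1.
  rewrite sumC (eq_bigr (fun=> a)) => [|i _]; last by rewrite eq_a //; have := ltn_ord i; lia.
  by rewrite sum_nat_const card_ord.
have := kostka_count_lt part_mu sim_mu k KC; rewrite sumn_take_rect (minn_idPr _) ?(ltnW lt_bk) //.
have: count_lt C b.+1 <= count_lt C k by apply: sub_count => x /=; lia.
by have := rect_size; rewrite Cb; lia.
Qed.

(* The raising operator from this weight space to that of mu, a line, is      *)
(* injective: a vector in its kernel would be a highest weight vector, hence  *)
(* generate a Specht module other than S^mu.                                  *)
Lemma kostka_rect_lower x0 : crow x0 = b -> kostka (content (recolor crow b.+1 x0)) <= 1.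
Proof.
move=> rx0; have a_gt0 : 0 < a.
  by have := ltn_ord x0; rewrite [X in _ < X]rect_size; case: (a) => //; rewrite muln0.
rewrite (kostka_content sim_mu).
(* If a = 1, the recoloured cells still have distinct colours, so the stabiliser is that of mu.
   Otherwise mu with its last corner moved to a new row is a partition [la]. *)
have [lt_1a|le_a1] := ltnP 1 a; last first.
  have a1 : a = 1 by lia.
  have injr x y : (crow x == crow y) = (x == y).
    apply/eqP/eqP => [rxy|-> //]; apply: cell_inj rxy _.
    by have := col_lt part_mu x; have := col_lt part_mu y; rewrite !nth_nseq !ltnS !crow_rect; lia.
  rewrite (_ : stab _ = stab crow) ?(rank_specht_row_fixed part_mu) //.
  apply: eq_stab => x y; rewrite injr /recolor.
  case: (eqVneq x x0) => [->|nx]; case: (eqVneq y x0) => [yE|ny]; rewrite ?eqxx //.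
  - by rewrite gtn_eqF // ltnS crow_rect.
  - by rewrite yE (negPf nx) ltn_eqF // ltnS crow_rect.
pose la := rcons (rcons (nseq b a) a.-1) 1.
have nth_la i : nth 0 la i = if i < b then a else if i == b then a.-1 else (i == b.+1).
  rewrite /la !nth_rcons size_rcons size_nseq nth_nseq ltnS.
  by case: ltngtP => // ; case: eqP.
have part_la : is_partition m la.
  apply/and3P; split.
  - apply/(sortedP 0) => i _; rewrite !nth_la /=.
    by do 4?[case: ifP => ?]; lia.
  - by rewrite /la mem_rcons inE mem_rcons inE mem_nseq; lia.
  - by rewrite /la !sumn_rcons sumn_nseq; apply/eqP; rewrite [RHS]rect_size; lia.
have [|t tE] := @perm_colors _ _ (@cell_row m la) (recolor crow b.+1 x0).
  apply/allP=> k _ /=; rewrite !count_colors (card_row part_la); apply/eqP.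
  have := card_recolor (pred1 k) crow b.+1 x0; rewrite /= (card_row part_mu) nth_nseq rx0 nth_la.
  by move: #|_| => N; do 4?[case: ifP => ?]; lia.
rewrite -(rank_rfix_comp _ _ t) -(eq_rfix_stab _ tE) {t tE}.
have [|y0 ry0 _] := @cell_ex _ _ part_la b.+1 0; first by rewrite nth_la; do 2?[case: ifP => ?]; lia.
pose X := specht m mu; pose V := rfix_mx X (stab (@cell_row m la)).
pose E := (\sum_(x | (cell_row la x == b) || (x == y0)) X (tperm x y0))%R.
(* Raising into a row i < b would give colour i more than mu_1 = a cells, hence yields 0; the only
   other raising operator is E. *)
have VE0 : (V :&: kermx E)%MS = 0%R.
  apply/eqP/rowV0P => v; rewrite sub_capmx => /andP[/rfix_mxP vV /sub_kermxP vE].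
  apply/eqP; apply: contraT => nzv.
  have hw : highest_weight la X v.
    split=> // i y lt_iy; apply/eqP; apply: contraT => nzu.
    have fixu : rfix_mx X (stab (recolor (cell_row la) i y)) != 0%R.
      by apply/rfix_neq0P; eexists; first exact: nzu; apply: raise_fixed.
    have := specht_rfix_le [:: i] part_mu fixu.
    have := card_recolor (pred1 i) (cell_row la) i y.
    rewrite /= (card_row part_la) nth_la eqxx (gtn_eqF lt_iy) addn0 addn1.
    have := row_lt part_la y; rewrite /la !size_rcons size_nseq -/la => lt_y.
    rewrite (eq_card (B := [set x | recolor (cell_row la) i y x \in [:: i]])) => [->|x]; last first.
      by rewrite !inE.
    rewrite take0 addn0; case: ifP => [_|ge_ib _]; first by rewrite ltnn.
    case/negP: nzu; apply/eqP.
    have ib : i = b by lia.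
    have ry : cell_row la y = cell_row la y0 by rewrite ry0; lia.
    have -> : y = y0.
      apply: (cell_inj ry); have := col_lt part_la y; have := col_lt part_la y0.
      by rewrite ry ry0 nth_la; do 2?[case: ifP => ?]; lia.
    by rewrite ib.
  have [f homf nzf] := highest_weight_intertwines part_la hw nzv.
  have sim := irr_intertwines_rsim (specht_irr part_la) (specht_irr part_mu) homf nzf.
  have: rfix_mx (specht m la) (stab crow) != 0%R.
    rewrite -mxrank_eq0 (rank_rfix_rsim (subsetT _) sim).
    by rewrite (rank_specht_row_fixed part_mu).
  move/(specht_rfix_below b.+1 part_la); rewrite (below_row _ part_mu) sumn_take_rect minnn.
  have := sumn_partition part_la; rewrite /la sumn_rcons -[in take _ _]cats1.
  by rewrite take_size_cat ?size_rcons ?size_nseq //; have := rect_size; lia.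
have <- : \rank (rfix_mx X (stab crow)) = 1 by apply: rank_specht_row_fixed.
have [|t tE] := @perm_colors _ _ (recolor (cell_row la) b y0) crow.
  apply/allP=> k _ /=; rewrite !count_colors (card_row part_mu); apply/eqP.
  have := card_recolor (pred1 k) (cell_row la) b y0.
  rewrite /= (card_row part_la) ry0 nth_la -[a :: nseq b a]/(nseq b.+1 a) nth_nseq.
  by move: #|_| => N; do 4?[case: ifP => ?]; lia.
rewrite -(rank_rfix_comp _ crow t) -(eq_rfix_stab _ tE) -(mxrank_mul_ker V E) VE0.
rewrite mxrank0 addn0; apply/mxrankS/row_subP => i; rewrite row_mul.
apply/rfix_mxP; apply: raise_fixed => g gla.
exact: (rfix_mxP _ (row_sub i V)).
Qed.

End Rectangle.

(** * Maximum plethystic tableaux *)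

Section MaximalTableaux.
Import GRing.Theory.
Local Open Scope ring_scope.
Variables (m n d e : nat) (mu nu : seq nat).
Hypothesis m_gt1 : (1 < m)%N.
Hypothesis part_mu : is_partition m mu.
Hypothesis part_nu : is_partition n nu.
Variable rW : mx_representation rat [set: 'S_m] d.
Variable rZ : mx_representation rat [set: 'S_n] e.
Hypothesis sim_mu : mx_rsim rW (specht m mu).
Hypothesis sim_nu : mx_rsim rZ (specht n nu).
Local Notation fixZ b := (rfix_mx rZ (stab b) != 0).
Local Open Scope nat_scope.
Local Notation crow := (@cell_row m mu).
Local Notation ccol := (@cell_col m mu).
Local Notation kostka := (@kostka_number m d rW).
Local Notation top := (top_content m mu).
Local Notation lower k x := (content (recolor crow k x)).
Local Notation tableau := (plethystic_tableau rW rZ).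

Definition total_lt (C : 'I_n -> m.-tuple nat) k := \sum_i count_lt (C i) k.

Lemma fixZE (T : eqType) (b : 'I_n -> T) :
  fixZ b = (rfix_mx (specht n nu) (stab b) != 0%R).
Proof. exact: rfix_neq0_rsim (subsetT _) sim_nu. Qed.

Lemma fixZ_class (T : eqType) (b : 'I_n -> T) v : fixZ b ->
  #|[set i | b i == v]| <= head 0 nu.
Proof.
rewrite fixZE => /(specht_rfix_le [:: v] part_nu) /=.
rewrite (eq_card (B := [set i | b i == v])) => [|i]; last by rewrite !inE.
by case: (nu) => [|a s] //=; rewrite take0 addn0.
Qed.

Lemma fixZ_size (T : eqType) (b : 'I_n -> T) ks : fixZ b -> (forall i, b i \in ks) ->
  size nu <= size ks.
Proof. by rewrite fixZE; apply: specht_rfix_size. Qed.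

Lemma fixZ_row (T : eqType) (b : 'I_n -> T) :
  (forall i j, (b i == b j) = (cell_row nu i == cell_row nu j)) -> fixZ b.
Proof.
by move=> /eq_stab bE; rewrite fixZE bE; apply: specht_rfix_row.
Qed.

Lemma count_lt_lower k x k' :
  count_lt (lower k x) k' + (crow x < k') = sumn (take k' mu) + (k < k').
Proof. by rewrite count_lt_content below_recolor below_row. Qed.

Lemma tableau_rows (D : nat -> m.-tuple nat) :
  (forall r, r < size nu -> sorted leq (D r) /\ 0 < kostka (D r)) ->
  (forall r s, r < size nu -> s < size nu -> D r = D s -> r = s) ->
  tableau (fun i => D (cell_row nu i)) (fun=> 0).
Proof.
move=> DP injD; split=> [i|i|]; try by case: (DP _ (row_lt part_nu i)).
apply: fixZ_row => i j; rewrite xpair_eqE andbT; apply/eqP/eqP => [|-> //].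
by apply: injD; apply: row_lt.
Qed.

Lemma count_lt_le C a i k : tableau C a -> count_lt (C i) k <= sumn (take k mu).
Proof.
by case=> _ lt_a _; apply: (kostka_count_lt part_mu sim_mu); apply: leq_ltn_trans (lt_a i).
Qed.

Lemma tableau_top C a i : tableau C a -> C i = top -> a i = 0.
Proof.
case=> _ lt_a _ Ci; have := lt_a i; rewrite Ci -/(kostka _) (kostka_top part_mu sim_mu); lia.
Qed.

Lemma card_top C a : tableau C a -> #|[set i | C i == top]| <= head 0 nu.
Proof.
move=> tab; case: (tab) => _ _ fixa; apply: leq_trans (fixZ_class (top, 0) fixa).
apply/subset_leq_card/subsetP => i; rewrite !inE => /eqP Ci.
by rewrite Ci (tableau_top tab Ci).
Qed.

Definition maximum (C0 : 'I_n -> m.-tuple nat) :=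
  forall C a, tableau C a -> forall k, total_lt C k <= total_lt C0 k.

(* Trading all occurrences of an entry for an unused one does not change      *)
(* which blocks have equal entries, so it gives another tableau.              *)
Lemma maximum_swap C0 a0 i1 (U : m.-tuple nat) :
  tableau C0 a0 -> maximum C0 -> sorted leq U -> 0 < kostka U ->
  (forall i, C0 i != U) -> forall k, count_lt U k <= count_lt (C0 i1) k.
Proof.
move=> [sC lt_a fixa] max0 sU KU unused k.
pose v := (C0 i1, a0 i1); pose hit i := (C0 i, a0 i) == v.
pose C i := if hit i then U else C0 i; pose a i := if hit i then 0 else a0 i.
have tab : tableau C a.
  split=> [i|i|]; rewrite /C /a; try by case: (hit i).
  rewrite (eq_stab (c' := fun i => (C0 i, a0 i))) // => i j.
  case: (boolP (hit i)) (boolP (hit j)) => [/eqP hi|nhi] [/eqP hj|nhj].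
  - by rewrite hi hj !eqxx.
  - by rewrite hi [RHS]eq_sym -/(hit j) (negPf nhj) xpair_eqE [X in X && _]eq_sym (negPf (unused j)).
  - by rewrite hj -/(hit i) (negPf nhi) xpair_eqE (negPf (unused i)).
  - by [].
have := max0 _ _ tab k; rewrite /total_lt (bigID hit) [X in _ <= X](bigID hit) /=.
rewrite [X in _ + X](eq_bigr (fun i => count_lt (C0 i) k)) => [|i /negPf nh]; last first.
  by rewrite /C nh.
rewrite leq_add2r (eq_bigr (fun=> count_lt U k)) => [|i hi]; last by rewrite /C hi.
rewrite [X in _ <= X](eq_bigr (fun=> count_lt (C0 i1) k)) => [|i /eqP[-> _] //].
rewrite !sum_nat_const leq_pmul2l //; apply/card_gt0P; exists i1.
by rewrite unfold_in /= !eqxx.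
Qed.

(** The weight space of [top] is a line, so all blocks with this content share one label, and a
    label occurs at most nu_1 times. *)
Lemma not_all_top C0 a0 : tableau C0 a0 -> head 0 nu < n -> exists i, C0 i != top.
Proof.
move=> tab lt_n; apply/existsP; apply: contraTT lt_n => /existsPn all_top.
rewrite -leqNgt -[X in X <= _](card_ord n) -cardsT.
apply: leq_trans (card_top tab); apply/subset_leq_card/subsetP=> i _; rewrite inE.
by have := all_top i; rewrite negbK.
Qed.

Lemma maximum_prefix C0 a0 C k : tableau C0 a0 -> maximum C0 -> (exists a, tableau C a) ->
  (forall i, count_lt (C i) k = sumn (take k mu)) ->
  forall i, count_lt (C0 i) k = sumn (take k mu).
Proof.
move=> tab0 max0 [a tab] full i; apply/eqP; rewrite eqn_leq (count_lt_le _ _ tab0) leqNgt.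
apply/negP => lt_i; have := max0 _ _ tab k; apply/negP; rewrite -ltnNge.
rewrite /total_lt (bigD1 i) //= [X in _ < X](bigD1 i) //= full -addSn leq_add //.
by apply: leq_sum => j _; rewrite full (count_lt_le _ _ tab0).
Qed.

(** Row r of nu carries mu with the corner box x moved from row j to row j + r; row 0 thus carries
    [top]. *)
Lemma lower_tableau j x : crow x = j -> (forall y, ccol y = ccol x -> crow y <= j) ->
  tableau (fun i => lower (j + cell_row nu i) x) (fun=> 0).
Proof.
move=> rx bot; apply: (tableau_rows (D := fun r => lower (j + r) x)) => [r _|r s _ _].
  split; first exact: content_sorted.
  apply: (kostka_increasing part_mu sim_mu); rewrite -rx in bot *.
  exact: corner_increasing (leq_addr _ _) bot.
move=> eqD; have H k : (j + r < k) = (j + s < k) :> nat.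
  by have := count_lt_lower (j + r) x k; rewrite eqD count_lt_lower => /addnI.
have := H (j + r).+1; have := H (j + s).+1; lia.
Qed.

Lemma size_nu_ge2 : nu <> row_partition n -> 1 < size nu.
Proof.
rewrite /row_partition; have := sumn_partition part_nu.
have : 0 \notin nu by case/and3P: part_nu.
case: (nu) => [|a [|b s]] //= nz0; first by move=> <-.
by rewrite addn0 => <-; move: nz0; rewrite inE; case: a.
Qed.

Lemma head_nu_lt : 1 < size nu -> head 0 nu < n.
Proof.
have : 0 \notin nu by case/and3P: part_nu.
rewrite -(sumn_partition part_nu); case: (nu) => [|a [|b s]] //=.
by rewrite !inE; lia.
Qed.

Lemma row_partition_maximum : nu = row_partition n ->
  exists2 C0, (exists a, tableau C0 a) & maximum C0.
Proof.
move=> nuE; exists (fun=> top).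
  exists (fun=> 0); split=> [i|i|]; first exact: content_sorted.
    by rewrite -/(kostka _) (kostka_top part_mu sim_mu).
  apply: fixZ_row => i j; rewrite eqxx; apply/esym/eqP.
  have := row_lt part_nu i; have := row_lt part_nu j.
  by rewrite nuE size_nseq; case: (0 < n) => /=; lia.
move=> C a tab k; apply: leq_sum => i _.
by rewrite (count_lt_top part_mu) (count_lt_le _ _ tab).
Qed.

Lemma sum_lower_rows : \sum_(i < n) (0 < cell_row nu i) + head 0 nu = n.
Proof.
rewrite -nth0 -(card_row part_nu) -sum1dep_card [X in _ + X]big_mkcond -big_split /=.
rewrite -[RHS](card_ord n) -sum1_card; apply: eq_bigr => i _.
by case: (cell_row nu i).
Qed.

Lemma sum_not_top C l : tableau C l -> n <= \sum_(i < n) (C i != top) + head 0 nu.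
Proof.
move=> tab; apply: leq_trans (leq_add (leqnn _) (card_top tab)).
rewrite -sum1dep_card [X in _ + X]big_mkcond -big_split /=.
rewrite -[X in X <= _](card_ord n) -sum1_card; apply: leq_sum => i _.
by case: eqP.
Qed.

Section RectangleTableaux.
Variables (a b : nat).
Hypothesis mu_rect : mu = nseq b.+1 a.

Lemma rect_ab : m = b.+1 * a.
Proof. by have := sumn_partition part_mu; rewrite mu_rect sumn_nseq mulnC. Qed.

Lemma rect_sumn_take k : sumn (take k mu) = minn k b.+1 * a.
Proof.
by rewrite mu_rect sumn_take_rect.
Qed.

Lemma rect_corner : exists2 x, crow x = b & forall y, ccol y = ccol x -> crow y <= b.
Proof.
apply: (corner_ex part_mu); have := rect_ab; rewrite mu_rect !nth_nseq ltnn ltnS leqnn.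
case: (a) => //; rewrite muln0; lia.
Qed.

Lemma rect_count_lt C l i : tableau C l -> C i != top -> count_lt (C i) b.+1 < m.
Proof.
move=> tab; apply: contraNT; rewrite -leqNgt => le_m.
have [sC lt_l _] := tab; apply/eqP.
have KC : 0 < kostka (C i) := leq_ltn_trans (leq0n _) (lt_l i).
have part' := part_mu; have sim' := sim_mu; rewrite mu_rect in part' sim' *.
apply: (kostka_rect_top part' sim') => //; apply/eqP; rewrite eqn_leq le_m andbT.
by rewrite /count_lt -[X in _ <= X](size_tuple (C i)) count_size.
Qed.

Section TwoRows.
Variable x : 'I_m.
Hypothesis rx : crow x = b.
Hypothesis bot : forall y, ccol y = ccol x -> crow y <= b.
Local Notation second := (lower b.+1 x).

Lemma count_lt_second k : count_lt second k + (k == b.+1) = sumn (take k mu).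
Proof.
have := count_lt_lower b.+1 x k; rewrite rx; have : (k == b.+1) + (b.+1 < k) = (b < k) by lia.
lia.
Qed.

Lemma sumn_take_rect_ge k : b < k -> sumn (take k mu) = m.
Proof. by move=> lt_bk; rewrite rect_sumn_take (minn_idPr _) // -rect_ab. Qed.

Lemma rect_count_le C l i : tableau C l -> count_lt (C i) b.+1 + (C i != top) <= m.
Proof.
move=> tab; have [->|nCi] := eqVneq (C i) top; last by rewrite addn1 (rect_count_lt tab).
by rewrite (count_lt_top part_mu) sumn_take_rect_ge // addn0.
Qed.

Lemma count_lt_row (i : 'I_n) :
  count_lt (lower (b + cell_row nu i) x) b.+1 + (0 < cell_row nu i) = m.
Proof.
have := count_lt_lower (b + cell_row nu i) x b.+1; rewrite rx sumn_take_rect_ge //.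
by case: (cell_row nu i) => [|r] /=; lia.
Qed.

Lemma sum_rect_rows C l : tableau C l ->
  n * m <= \sum_(i < n) count_lt (lower (b + cell_row nu i) x) b.+1 + \sum_(i < n) (C i != top).
Proof.
move=> tab; rewrite -(leq_add2r (head 0 nu)) -addnA.
apply: leq_trans (leq_add (leqnn _) (sum_not_top tab)).
rewrite -[X in _ <= _ + X]sum_lower_rows addnA leq_add2r -big_split /=.
by rewrite (eq_bigr _ (fun i _ => count_lt_row i)) sum_nat_const card_ord.
Qed.

(** The partial counts of [second] fall short of those of mu only at k = b + 1, by one. There every
    entry other than [top] falls short by at least one, and at least n - nu_1 blocks carry such an
    entry. *)
Lemma rect_two_rows_maximum : size nu = 2 ->
  exists2 C0, (exists l, tableau C0 l) & maximum C0.
Proof.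
move=> size2; have tab2 := lower_tableau rx bot.
exists (fun i => lower (b + cell_row nu i) x); first by exists (fun=> 0).
move=> C l tab k; have size_gt1 : 1 < size nu by rewrite size2.
have row2 (i : 'I_n) : cell_row nu i = 0 \/ cell_row nu i = 1.
  by have := row_lt part_nu i; rewrite size2; lia.
have lowE (i : 'I_n) : count_lt (lower (b + cell_row nu i) x) k =
    sumn (take k mu) - ((k == b.+1) && (cell_row nu i == 1)).
  have := count_lt_lower (b + cell_row nu i) x k; rewrite rx.
  by case: (row2 i) => ->; rewrite ?addn0 ?addn1; have := count_lt_second k; lia.
have [kb|nkb] := eqVneq k b.+1; last first.
  by apply: leq_sum => i _; rewrite lowE (negPf nkb) subn0 (count_lt_le _ _ tab).
rewrite kb -(leq_add2r (\sum_(i < n) (C i != top))); apply: leq_trans (sum_rect_rows tab).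
rewrite -big_split -[X in _ <= X * _](card_ord n) -sum_nat_const; apply: leq_sum => i _.
exact: rect_count_le tab.
Qed.

(** Both weight spaces are lines, so only two labels occur; a weight of S^nu uses at least as many
    colours as nu has parts. *)
Lemma rect_only_two_entries C l : tableau C l ->
  (forall i, C i = top \/ C i = second) -> size nu <= 2.
Proof.
move=> tab two; case: (tab) => _ lt_l fixl.
apply: (fixZ_size (ks := [:: (top, 0); (second, 0)]) fixl) => i; rewrite !inE !xpair_eqE.
case: (two i) => Ci; first by rewrite Ci (tableau_top tab Ci) !eqxx.
have := lt_l i; rewrite {1}Ci => lt_li; suff -> : l i = 0 by rewrite Ci !eqxx orbT.
have: kostka second <= 1.
  have part' := part_mu; have sim' := sim_mu; have rx' := rx.
  move: x rx'; rewrite mu_rect in part' sim' * => y ry.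
  exact: (kostka_rect_lower part' sim' ry).
by rewrite /kostka_number; lia.
Qed.

Lemma rect_lower_entry C l (C0 : m.-tuple nat) : tableau C l -> (exists i, C i = C0) -> C0 != top ->
  (forall k, k != b.+1 -> sumn (take k mu) <= count_lt C0 k) ->
  m.-1 <= count_lt C0 b.+1 -> C0 = second.
Proof.
move=> tab [i <-] nCi full low; have [sC _ _] := tab.
apply: (sorted_count_lt (sC i) (content_sorted _)) => k.
have := count_lt_second k; have := count_lt_le i k tab.
have [-> |nk] := eqVneq k b.+1; last by have := full k nk; lia.
have := rect_count_lt tab nCi; rewrite sumn_take_rect_ge //; lia.
Qed.

Lemma rect_maximum_tall C0 l0 : 0 < b -> tableau C0 l0 -> maximum C0 -> size nu <= 2.
Proof.
move=> b_gt0 tab0 max0; apply: (rect_only_two_entries tab0) => i.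
have [->|nCi] := eqVneq (C0 i) top; [by left|right].
have a_gt0 : 0 < a by have := rect_ab; case: (a) => //; rewrite muln0; lia.
have full : forall i, count_lt (C0 i) b = sumn (take b mu).
  apply: (maximum_prefix (C := fun i => lower (b + cell_row nu i) x) tab0 max0).
    by exists (fun=> 0); apply: lower_tableau.
  by move=> j; have := count_lt_lower (b + cell_row nu j) x b; rewrite rx; lia.
have [|x' rx' cx'] := @cell_ex _ _ part_mu b.-1 (ccol x).
  by have := col_lt part_mu x; rewrite rx => /leq_trans; apply; apply: (nth_partition_le part_mu); lia.
have nxx : x != x' by apply/eqP => xx; move: rx'; rewrite -xx rx; lia.
(* The corner x drops to a new row and x', directly above it, takes its place: in total one box
   passes from row b - 1 to row b + 1. *)
pose U := content (recolor (recolor crow b.+1 x) b x').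
have UE k : count_lt U k + (b.-1 < k) = sumn (take k mu) + (b.+1 < k).
  have := below_recolor (recolor crow b.+1 x) b x' k; rewrite -count_lt_content -/U.
  rewrite {1}/recolor eq_sym (negPf nxx) rx'.
  by have := count_lt_lower b.+1 x k; rewrite count_lt_content rx; lia.
have KU : 0 < kostka U.
  apply: (kostka_increasing part_mu sim_mu) => p q cpq lt_pq; rewrite /recolor.
  have := row_lt part_mu q; rewrite mu_rect size_nseq -mu_rect => le_qb.
  have [px'|_] := eqVneq p x'.
    have qx : q = x by apply: (@cell_inj m mu); [rewrite rx; move: lt_pq; rewrite px' rx'; lia
                                        | rewrite -cpq px' cx'].
    by rewrite qx (negPf nxx) eqxx.
  have [px|_] := eqVneq p x; first by move: lt_pq; rewrite px rx; lia.
  case: eqP => [qx'|_]; first by move: lt_pq; rewrite qx' rx'; lia.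
  by case: eqP => [qx|_]; first by move: lt_pq; rewrite qx rx; lia.
have unused j : C0 j != U.
  apply/eqP => CU; have := UE b; rewrite -CU full.
  have: a <= sumn (take b mu) by rewrite rect_sumn_take (minn_idPl _) // leq_pmull.
  by lia.
have le_U := maximum_swap i tab0 max0 (content_sorted _) KU unused.
apply: (rect_lower_entry tab0 _ nCi); first by exists i.
  move=> k nk; have [->|nkb] := eqVneq k b; first by rewrite full.
  have arith u s t : u + (b.-1 < k) = s + (b.+1 < k) -> u <= t -> s <= t.
    by move: nk nkb => /eqP nk /eqP nkb; lia.
  exact: arith (UE k) (le_U k).
have := UE b.+1; rewrite sumn_take_rect_ge // ltnn addn0.
have -> : (b.-1 < b.+1) = true by lia.
have arith u t : u + 1 = m -> u <= t -> m.-1 <= t by lia.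
by move=> UEb; apply: arith UEb (le_U b.+1).
Qed.

Lemma rect_maximum_flat C0 l0 : b = 0 -> 1 < size nu -> tableau C0 l0 -> maximum C0 -> size nu <= 2.
Proof.
move=> b0 size_gt1 tab0 max0; apply: (rect_only_two_entries tab0) => i.
have [->|nCi] := eqVneq (C0 i) top; [by left|right].
(* The tableau of one-box moves loses at k = 1 only the unavoidable n - nu_1 boxes, so in a maximum
   tableau each entry other than [top] loses exactly one. *)
have tightC j : count_lt (C0 j) 1 + (C0 j != top) = m.
  have le_m i' : count_lt (C0 i') 1 + (C0 i' != top) <= m.
    by have := rect_count_le i' tab0; rewrite b0.
  apply/eqP; rewrite eqn_leq le_m leqNgt; apply/negP => lt_m.
  have := max0 _ _ (lower_tableau rx bot) 1; rewrite -(leq_add2r (\sum_(i < n) (C0 i != top))).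
  have := sum_rect_rows tab0; rewrite b0 => /leq_trans le_nm /le_nm.
  apply/negP; rewrite -ltnNge -big_split -[X in _ < X * _](card_ord n) -sum_nat_const.
  rewrite (bigD1 j) //= [X in _ < X](bigD1 j) //= -addSn leq_add //.
  exact: leq_sum.
have [y nyx] : exists y, y != x.
  have [<-|] := eqVneq (Ordinal m_gt1) x; last by exists (Ordinal m_gt1).
  by exists (Ordinal (ltnW m_gt1)).
pose U := content (recolor (recolor crow 1 x) 1 y).
have row0 z : crow z = 0 by have := row_lt part_mu z; rewrite mu_rect size_nseq b0; lia.
have UE k : count_lt U k + (0 < k) + (0 < k) = sumn (take k mu) + (1 < k) + (1 < k).
  have := below_recolor (recolor crow 1 x) 1 y k; rewrite -count_lt_content -/U.
  rewrite {1}/recolor (negPf nyx) row0.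
  by have := count_lt_lower 1 x k; rewrite count_lt_content row0; lia.
have KU : 0 < kostka U.
  by apply: (kostka_increasing part_mu sim_mu) => p q _; rewrite !row0.
have S1 : sumn (take 1 mu) = m by apply: sumn_take_rect_ge; rewrite b0.
have unused j : C0 j != U.
  apply/eqP => CU; have := UE 1; have := tightC j; rewrite CU S1; lia.
have le_U := maximum_swap i tab0 max0 (content_sorted _) KU unused.
apply: (rect_lower_entry tab0 _ nCi); first by exists i.
  move=> k; rewrite b0 => /eqP nk.
  have arith u s t : u + (0 < k) + (0 < k) = s + (1 < k) + (1 < k) -> u <= t -> s <= t by lia.
  exact: arith (UE k) (le_U k).
have arith t : t.+1 = m -> m.-1 <= t by lia.
by rewrite b0; apply: arith; have := tightC i; rewrite nCi addn1.
Qed.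

End TwoRows.
End RectangleTableaux.

Lemma corners_not_maximum i j C0 l0 : i < j ->
  nth 0 mu i.+1 < nth 0 mu i -> nth 0 mu j.+1 < nth 0 mu j ->
  1 < size nu -> tableau C0 l0 -> ~ maximum C0.
Proof.
move=> lt_ij cor_i cor_j size_gt1 tab0 max0.
have [x rx botx] := corner_ex part_mu cor_i; have [y ry boty] := corner_ex part_mu cor_j.
have full : forall h, count_lt (C0 h) i.+1 = sumn (take i.+1 mu).
  apply: (maximum_prefix (C := fun h => lower (j + cell_row nu h) y) tab0 max0).
    by exists (fun=> 0); apply: lower_tableau.
  by move=> h; have := count_lt_lower (j + cell_row nu h) y i.+1; rewrite ry; lia.
have [h nCh] := not_all_top tab0 (head_nu_lt size_gt1).
pose U := lower i.+1 x.
have UE k : count_lt U k + (i < k) = sumn (take k mu) + (i.+1 < k).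
  by have := count_lt_lower i.+1 x k; rewrite rx.
have KU : 0 < kostka U.
  apply: (kostka_increasing part_mu sim_mu); rewrite /U -rx in botx *.
  exact: corner_increasing (leqnSn _) botx.
have S_gt0 : 0 < sumn (take i.+1 mu).
  by rewrite sumn_take big_ord_recr /=; lia.
have unused g : C0 g != U.
  by apply/eqP => CU; have := UE i.+1; rewrite -CU full; lia.
have le_U := maximum_swap h tab0 max0 (content_sorted _) KU unused.
case/eqP: nCh; have [sC _ _] := tab0.
apply: (sorted_count_lt (sC h) (content_sorted _)) => k; rewrite (count_lt_top part_mu).
have [->|/eqP nk] := eqVneq k i.+1; first exact: full.
have arith u s t : u + (i < k) = s + (i.+1 < k) -> u <= t -> t <= s -> t = s by lia.
exact: arith (UE k) (le_U k) (count_lt_le h k tab0).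
Qed.

Lemma rectangular_or_corners : rectangular mu \/
  exists i j, [/\ i < j, nth 0 mu i.+1 < nth 0 mu i & nth 0 mu j.+1 < nth 0 mu j].
Proof.
have size_gt0 : 0 < size mu.
  by have := sumn_partition part_mu; case: (mu) => //=; lia.
pose j := (size mu).-1.
have cor_j : nth 0 mu j.+1 < nth 0 mu j.
  by rewrite prednK // nth_default // (nth_partition_gt0 part_mu) prednK.
have [[i [lt_ij cor_i]]|none] := classic (exists i, i < j /\ nth 0 mu i.+1 < nth 0 mu i).
  by right; exists i, j.
left; exists (head 0 mu), (size mu).
have head_gt0 : 0 < head 0 mu by rewrite -nth0 (nth_partition_gt0 part_mu).
split=> //; apply: (eq_from_nth (x0 := 0)) => [|i lt_i]; first by rewrite size_nseq.
rewrite nth_nseq lt_i -nth0; elim: i lt_i => // i IH lt_i.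
rewrite -(IH (ltnW lt_i)); apply/eqP; rewrite eqn_leq (nth_partition_le part_mu) // leqNgt.
by apply/negP => cor_i; case: none; exists i; split=> //; lia.
Qed.

Theorem maximum_tableau_iff :
  (exists2 C0, (exists l, tableau C0 l) & maximum C0) <->
  (nu = row_partition n \/ (rectangular mu /\ size nu = 2)).
Proof.
split=> [[C0 [l0 tab0] max0]|[]].
- have [|nrow] := classic (nu = row_partition n); [by left|right].
  have size_gt1 := size_nu_ge2 nrow.
  have [rect|[i [j [lt_ij cor_i cor_j]]]] := rectangular_or_corners; last first.
    by case: (corners_not_maximum lt_ij cor_i cor_j size_gt1 tab0 max0).
  split=> //; case: rect => a [[|b] [_ // _ mu_rect]].
  have [x rx bot] := rect_corner mu_rect.
  apply/eqP; rewrite eqn_leq size_gt1 andbT.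
  have [b0|b_gt0] := posnP b.
    exact: (rect_maximum_flat mu_rect rx bot b0 size_gt1 tab0 max0).
  exact: (rect_maximum_tall mu_rect rx bot b_gt0 tab0 max0).
- exact: row_partition_maximum.
- case=> -[a [[|b] [_ // _ mu_rect]]] size2.
  have [x rx bot] := rect_corner mu_rect.
  exact: (rect_two_rows_maximum mu_rect rx bot size2).
Qed.

End MaximalTableaux.

(** * Sign twists of Foulkes modules *)

Section Signs.
Import GRing.Theory.
Local Open Scope ring_scope.

Lemma odd_perm_embed (U T : finType) (iota : U -> T) (g : {perm U}) (P : {perm T}) :
  injective iota -> (forall u, P (iota u) = iota (g u)) ->
  (forall x, (forall u, x != iota u) -> P x = x) -> odd_perm P = odd_perm g.
Proof.
move=> inj_iota; have [ts -> _] := prod_tpermP g.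
elim: ts P => [|[a b] ts IH] P Pin Pout.
  rewrite big_nil odd_perm1 (_ : P = 1%g) ?odd_perm1 //; apply/permP=> x; rewrite perm1.
  have [/existsP[u /eqP->]|/existsPn nx] := boolP [exists u, x == iota u].
    by rewrite Pin big_nil perm1.
  by apply: Pout => u; apply: nx.
rewrite big_cons odd_permM odd_tperm /=.
have <- := IH (tperm (iota a) (iota b) * P)%g.
- by rewrite odd_permM odd_tperm (inj_eq inj_iota) addbA addbb.
- move=> u; rewrite permM -(inj_tperm _ _ _ inj_iota) Pin big_cons permM.
  by rewrite tpermK.
- by move=> x nx; rewrite permM tpermD ?Pout // eq_sym nx.
Qed.

Lemma sign_perm_fibers (T : finType) q (pi : T -> 'I_q) (Ps : 'I_q -> {perm T}) (P : {perm T}) :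
  (forall j x, pi x != j -> Ps j x = x) -> (forall j x, pi x = j -> pi (Ps j x) = j) ->
  (forall x, P x = Ps (pi x) x) ->
  (-1) ^+ odd_perm P = \prod_j (-1) ^+ odd_perm (Ps j) :> rat.
Proof.
move=> Pout Pin PE.
(* Q applies [Ps j] on the first k fibres only and is extended by one fibre at a time. *)
suff /(_ q (leqnn q)) [Q QE QS]: forall k, (k <= q)%N -> exists2 Q : {perm T},
    forall x, Q x = if (pi x < k)%N then Ps (pi x) x else x &
    (-1) ^+ odd_perm Q = \prod_(j < q | (j < k)%N) (-1) ^+ odd_perm (Ps j) :> rat.
  rewrite (_ : P = Q); last by apply/permP=> x; rewrite PE QE ltn_ord.
  by rewrite QS; apply: eq_bigl => j; rewrite ltn_ord.
elim=> [_|k IH lt_kq].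
  by exists 1%g => [x|]; rewrite ?perm1 ?odd_perm1 ?big1.
have [Q QE QS] := IH (ltnW lt_kq); pose j := Ordinal lt_kq.
exists (Q * Ps j)%g => [x|].
  rewrite permM QE [in RHS]ltnS [in RHS]leq_eqVlt; have [lt_x|ge_x] := ltnP (pi x) k.
    by rewrite orbT Pout // Pin // -val_eqE /= ltn_eqF.
  rewrite orbF; have [xk|nxk] := eqVneq (pi x : nat) k.
    by rewrite (_ : pi x = j) //; apply: val_inj.
  by rewrite Pout // -val_eqE.
rewrite odd_permM signr_addb QS [RHS](bigD1 j) //= [RHS]mulrC; congr (_ * _).
by apply: eq_bigl => i; rewrite -val_eqE /=; lia.
Qed.

Variables (m n : nat).

Lemma cell_inj2 (k k' : 'I_m) (i i' : 'I_n) : cell k i = cell k' i' -> k = k' /\ i = i'.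
Proof. by move/(congr1 (@cell_inv m n)); rewrite !cellK => -[]. Qed.

Lemma sign_wreath_base (f : {ffun 'I_n -> 'S_m}) :
  (-1) ^+ odd_perm (wreath_perm f 1) = \prod_i (-1) ^+ odd_perm (f i) :> rat.
Proof.
pose Ps i := wreath_perm [ffun j => if j == i then f i else 1%g] 1.
have PsE i k j : Ps i (cell k j) = cell (if j == i then f i k else k) j.
  by rewrite wreath_permE ffunE perm1; case: eqP => // _; rewrite perm1.
rewrite (@sign_perm_fibers _ _ (fun x => (cell_inv x).2) Ps).
- apply: eq_bigr => i _; congr (_ ^+ nat_of_bool _).
  apply: (odd_perm_embed (iota := fun k => cell k i)) => [k k' /cell_inj2[]//|k|x nx].
    by rewrite PsE eqxx.
  rewrite -[x]cell_invK PsE ifN //; apply/eqP => xi.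
  by have := nx (cell_inv x).1; rewrite -xi cell_invK eqxx.
- by move=> i x nx; rewrite -{1}[x]cell_invK PsE (negPf nx) cell_invK.
- by move=> i x xi; rewrite -{1}[x]cell_invK PsE cellK.
- by move=> x; rewrite -{1 3}[x]cell_invK PsE eqxx wreath_permE perm1.
Qed.

(** A block permutation acts as m disjoint copies of s, one for each position within a block. *)
Lemma sign_wreath_top (s : 'S_n) :
  (-1) ^+ odd_perm (wreath_perm [ffun=> 1 : 'S_m] s)%g = ((-1) ^+ odd_perm s) ^+ m :> rat.
Proof.
pose F (k : 'I_m) (x : 'I_(m * n)) :=
  if (cell_inv x).1 == k then cell (cell_inv x).1 (s (cell_inv x).2) else x.
have FE k k' i : F k (cell k' i) = cell k' (if k' == k then s i else i).
  by rewrite /F cellK /=; case: eqP.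
have injF k : injective (F k).
  move=> x y; rewrite -[x]cell_invK -[y]cell_invK !FE => /cell_inj2[<-].
  by case: eqP => _ => [/perm_inj|] ->.
pose Ps k := perm (@injF k).
have PsE k k' i : Ps k (cell k' i) = cell k' (if k' == k then s i else i).
  by rewrite permE FE.
rewrite (@sign_perm_fibers _ _ (fun x => (cell_inv x).1) Ps).
- rewrite -[X in _ ^+ X](card_ord m) -prodr_const; apply: eq_bigr => k _.
  congr (_ ^+ nat_of_bool _).
  apply: (odd_perm_embed (iota := fun i => cell k i)) => [i i' /cell_inj2[]//|i|x nx].
    by rewrite PsE eqxx.
  rewrite -[x]cell_invK PsE ifN //; apply/eqP => xi.
  by have := nx (cell_inv x).2; rewrite -xi cell_invK eqxx.
- by move=> i x nx; rewrite -{1}[x]cell_invK PsE (negPf nx) cell_invK.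
- by move=> i x xi; rewrite -{1}[x]cell_invK PsE cellK.
- by move=> x; rewrite -{1 3}[x]cell_invK PsE eqxx wreath_permE ffunE perm1.
Qed.

Lemma sign_wreath (f : {ffun 'I_n -> 'S_m}) (s : 'S_n) :
  (-1) ^+ odd_perm (wreath_perm f s) =
    (\prod_i (-1) ^+ odd_perm (f i)) * ((-1) ^+ odd_perm s) ^+ m :> rat.
Proof.
rewrite -sign_wreath_base -sign_wreath_top -signr_addb -odd_permM wreath_permM mul1g.
congr (_ ^+ odd_perm (wreath_perm _ _)).
by apply/ffunP=> i; rewrite !ffunE mulg1.
Qed.

End Signs.

Section TwistedFoulkes.
Import GRing.Theory.
Local Open Scope ring_scope.

Lemma sign_twistE N d (rX : mx_representation rat [set: 'S_N] d) g i j :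
  sign_twist rX g i j = (-1) ^+ odd_perm g * rX g i j.
Proof. exact: mxE. Qed.

Variables (m n d e : nat).
Hypothesis m_gt0 : (0 < m)%N.
Variables (rW : mx_representation rat [set: 'S_m] d).
Variables (rZ : mx_representation rat [set: 'S_n] e).

(** The top group contributes the sign to the power m, so the outer module is twisted only for odd
    m. *)
Definition twist_outer := if odd m then sign_twist rZ else rZ.

Lemma oslash_twist g : g \in wreath_group m n ->
  oslash (sign_twist rW) twist_outer g = (-1) ^+ odd_perm g *: oslash rW rZ g.
Proof.
case/wreathP=> f [s ->]; apply/matrixP=> x y; rewrite !mxE wreath_baseE wreath_topE m_gt0.
rewrite sign_wreath (eq_bigr (fun i => (-1) ^+ odd_perm (f i) *
  rW (f i) ((enum_val x).1 i) ((enum_val y).1 (s i)))) => [|i _]; last exact: sign_twistE.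
rewrite big_split /=.
have -> : twist_outer s (enum_val x).2 (enum_val y).2 =
    ((-1) ^+ odd_perm s) ^+ m * rZ s (enum_val x).2 (enum_val y).2.
  rewrite /twist_outer -exprM mulnC exprM -signr_odd; case: (odd m).
    by rewrite [LHS]sign_twistE expr1.
  by rewrite expr0 expr1n mul1r.
ring.
Qed.

(** Twisting commutes with induction: rescaling each basis vector by the sign of its coset
    representative is an isomorphism. *)
Lemma rfix_twisted_foulkes (K : {set 'S_(m * n)}) :
  (rfix_mx (sign_twist (induced_repr (oslash rW rZ))) K != 0) =
  (rfix_mx (induced_repr (oslash (sign_twist rW) twist_outer)) K != 0).
Proof.
apply: rfix_neq0_rsim; first exact: subsetT.
pose sg (A : right_coset (wreath_group m n)) : rat := (-1) ^+ odd_perm (repr (val A)).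
pose D := diag_mx (\row_k sg (enum_val k).1 : 'rV[rat]_#|{: right_coset (wreath_group m n) *
  'I_#|{: {ffun 'I_n -> 'I_d} * 'I_e}|}|).
exists D => //.
  rewrite row_free_unit unitmxE det_diag unitfE.
  by apply/prodf_neq0 => k _; rewrite mxE signr_eq0.
move=> g _; apply/matrixP=> x y; rewrite mul_mx_diag mul_diag_mx !mxE.
rewrite /sg; set a := repr (val (enum_val x).1); set b := repr (val (enum_val y).1); cbv zeta.
case: ifP => [Hh|_]; last by rewrite !mulr0 mul0r.
have -> : oslash (sign_twist rW) twist_outer (a * g * b^-1)%g (enum_val x).2 (enum_val y).2 =
    (-1) ^+ odd_perm (a * g * b^-1)%g * oslash rW rZ (a * g * b^-1)%g (enum_val x).2 (enum_val y).2.
  by rewrite oslash_twist // mxE.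
rewrite !odd_permM odd_permV (signr_addb _ (odd_perm a (+) odd_perm g) (odd_perm b)).
rewrite (signr_addb _ (odd_perm a) (odd_perm g)) !mulrA -expr2 sqrr_sign mul1r.
by rewrite -!mulrA; congr (_ * _); rewrite mulrC.
Qed.

End TwistedFoulkes.

Section SummandTwist.
Import GRing.Theory Num.Theory.
Local Open Scope ring_scope.
Variables (n d : nat) (rX : mx_representation rat [set: 'S_n] d).

Lemma summand_sign_twist la : summand rX la -> summand (sign_twist rX) (conj_partition la).
Proof.
case=> part_la /summand_intertwines[f homf freef].
have part_c := conj_is_partition part_la; split=> //.
have [B _ freeB homB] := mx_rsim_sym (sign_twist_specht part_la).
apply: (intertwines_summand (f := B *m f)); first exact: specht_irr.
  move=> g Gg; rewrite mulmxA homB // -!mulmxA; congr (_ *m _).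
  exact: (sign_twist_intertwines homf).
rewrite -mxrank_eq0 mxrankMfree // (eqP freeB) -lt0n.
by case/mx_irrP: (specht_irr part_c).
Qed.

Lemma summand_sign_twistK la : summand (sign_twist rX) la -> summand rX (conj_partition la).
Proof.
case=> part_la /summand_intertwines[f homf freef].
have part_c := conj_is_partition part_la; split=> //.
have [B _ freeB homB] := mx_rsim_sym (sign_twist_specht part_la).
apply: (intertwines_summand (f := B *m f)); first exact: specht_irr.
  move=> g Gg; rewrite mulmxA homB // -!mulmxA; congr (_ *m _).
  have := homf g Gg; rewrite -scalemxAr -scalemxAl => ->.
  by rewrite scalerA -expr2 sqrr_sign scale1r.
rewrite -mxrank_eq0 mxrankMfree // (eqP freeB) -lt0n.
by case/mx_irrP: (specht_irr part_c).
Qed.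

Lemma unique_minimal_summandE :
  (exists! la, summand rX la /\ forall la', summand rX la' -> dominated la' la -> la' = la)
  <->
  (exists! la, summand (sign_twist rX) la /\
     forall la', summand (sign_twist rX) la' -> dominated la la' -> la' = la).
Proof.
have to_max la : summand rX la /\
    (forall la', summand rX la' -> dominated la' la -> la' = la) ->
    summand (sign_twist rX) (conj_partition la) /\
    forall la', summand (sign_twist rX) la' -> dominated (conj_partition la) la' ->
      la' = conj_partition la.
  case=> sla minla; split=> [|la' sla' le_la]; first exact: summand_sign_twist.
  have [[part_la _] [part_la' _]] := (sla, sla').
  rewrite -(minla _ (summand_sign_twistK sla')) ?(conj_conj part_la') //.
  by rewrite -(conj_conj part_la); apply: (dominated_conj (conj_is_partition part_la) part_la').
have to_min la : summand (sign_twist rX) la /\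
    (forall la', summand (sign_twist rX) la' -> dominated la la' -> la' = la) ->
    summand rX (conj_partition la) /\ forall la', summand rX la' -> dominated la' (conj_partition la) ->
      la' = conj_partition la.
  case=> sla maxla; split=> [|la' sla' le_la]; first exact: summand_sign_twistK.
  have [[part_la _] [part_la' _]] := (sla, sla').
  rewrite -(maxla _ (summand_sign_twist sla')) ?(conj_conj part_la') //.
  by rewrite -(conj_conj part_la); apply: (dominated_conj part_la' (conj_is_partition part_la)).
split=> -[la [ext_la uniq_la]]; exists (conj_partition la).
  split=> [|ka ext_ka]; first exact: to_max.
  by rewrite (uniq_la _ (to_min _ ext_ka)) (conj_conj (proj1 (proj1 ext_ka))).
split=> [|ka ext_ka]; first exact: to_min.
by rewrite (uniq_la _ (to_max _ ext_ka)) (conj_conj (proj1 (proj1 ext_ka))).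
Qed.

End SummandTwist.

(** * From maximum tableaux to extremal summands *)

Lemma foulkes_maximum m n d e mu nu
    (rW : mx_representation rat [set: 'S_m] d) (rZ : mx_representation rat [set: 'S_n] e) :
  1 < m -> is_partition m mu -> is_partition n nu ->
  mx_rsim rW (specht m mu) -> mx_rsim rZ (specht n nu) ->
  (exists2 c0, rfix_mx (induced_repr (oslash rW rZ)) (stab c0) != 0%R &
     forall c : 'I_(m * n) -> nat,
       rfix_mx (induced_repr (oslash rW rZ)) (stab c) != 0%R ->
       forall k, below c k <= below c0 k) <->
  (nu = row_partition n \/ (rectangular mu /\ size nu = 2)).
Proof.
move=> m_gt1 part_mu part_nu sim_mu sim_nu; have m_gt0 := ltnW m_gt1.
rewrite -(maximum_tableau_iff m_gt1 part_mu part_nu sim_mu sim_nu).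
have below_tab (C : 'I_n -> m.-tuple nat) (c : 'I_(m * n) -> nat) (t : 'S_(m * n)) k :
    block_coloring C =1 c \o t -> below c k = total_lt C k.
  move=> Cc; rewrite -(below_comp c t) /total_lt /count_lt -below_block; apply: eq_card => x.
  by rewrite !inE Cc.
split=> [[c0 /(foulkes_rfixP m_gt0)[C0 [a0 [t0 [tab0 C0c]]]] max0]|[C0 [a0 tab0] max0]].
  exists C0; first by exists a0.
  move=> C a tab k; rewrite -(below_tab _ _ _ _ C0c).
  have Cid : block_coloring C =1 block_coloring C \o (1 : 'S_(m * n))%g.
    by move=> x; rewrite /= perm1.
  rewrite -(below_tab _ _ _ _ Cid); apply/max0/(foulkes_rfixP m_gt0).
  by exists C, a, 1%g.
have id_comp C : @block_coloring m n C =1 block_coloring C \o (1 : 'S_(m * n))%g.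
  by move=> x; rewrite /= perm1.
exists (block_coloring C0); first by apply/(foulkes_rfixP m_gt0); exists C0, a0, 1%g.
move=> c /(foulkes_rfixP m_gt0)[C [a [t [tab Cc]]]] k.
by rewrite (below_tab _ _ _ _ Cc) (below_tab _ _ _ _ (id_comp C0)); apply: max0 tab k.
Qed.

Section Shapes.

Lemma conj_nseq a b : 0 < b -> conj_partition (nseq b a) = nseq a b.
Proof.
move=> b_gt0; have sorted_ab : sorted geq (nseq b a).
  by apply/(sortedP 0) => i; rewrite size_nseq => lt_i; rewrite !nth_nseq lt_i (ltnW lt_i) /=.
apply: (eq_from_nth (x0 := 0)).
  by rewrite size_conj size_nseq; case: b b_gt0 {sorted_ab}.
move=> i; rewrite size_conj => lt_i; rewrite nth_conj // nth_nseq count_nseq.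
have -> : (i < a) by case: b b_gt0 lt_i {sorted_ab}.
by rewrite mul1n.
Qed.

Lemma rectangular_conj mu : rectangular mu -> rectangular (conj_partition mu).
Proof.
by case=> a [b [a_gt0 b_gt0 ->]]; exists b, a; split=> //; apply: conj_nseq.
Qed.

Lemma conj_row_partition n : conj_partition (row_partition n) = nseq n 1.
Proof.
rewrite /row_partition; case: n => [|n] //=.
by rewrite -[[:: n.+1]]/(nseq 1 n.+1) conj_nseq.
Qed.

Lemma conj_column n : conj_partition (nseq n 1) = row_partition n.
Proof. by rewrite /row_partition; case: n => [|n] //; rewrite conj_nseq. Qed.

(** Conjugation turns having exactly two parts into having first part 2, which leaves a run of 2s
    followed by a run of 1s. *)
Lemma head2_partition n ka : is_partition n ka ->
  head 0 ka = 2 <-> exists c d, 1 <= c /\ ka = nseq c 2 ++ nseq d 1.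
Proof.
case/and3P=> ska ka0 _; split=> [|[[|c] [d [c_gt0 ->]]] //].
case: ka ska ka0 => [|a s] //= sas ka0 a2; rewrite {}a2 in sas ka0 *.
suff [c [d ->]] : exists c d, s = nseq c 2 ++ nseq d 1 by exists c.+1, d.
elim: s sas ka0 => [|k s IH] /=; first by exists 0, 0.
case/andP=> le_k sks; rewrite !inE !negb_or => /and3P[_ nk s0].
have [k2|k1] : k = 2 \/ k = 1 by lia.
  rewrite k2 in sks; have [||c [d ->]] := IH; first by [].
    by rewrite inE negb_or.
  by exists c.+1, d; rewrite k2.
exists 0, (size s).+1; rewrite k1 /=; congr (_ :: _); rewrite k1 in sks.
elim: s sks s0 {IH} => //= h s IH /andP[le_h shs]; rewrite inE negb_or => /andP[nh s0].
have h1 : h = 1 by lia.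
by rewrite h1; congr (_ :: _); apply: IH; rewrite // -h1.
Qed.

End Shapes.

(** The maximal case is applied to mu' and to the twisted outer label, which is the conjugate of
    kappa; rectangularity is invariant under conjugation. *)
Lemma foulkes_unique_minimal (m n d e : nat) (mu nu : seq nat)
    (rW : mx_representation rat [set: 'S_m] d)
    (rZ : mx_representation rat [set: 'S_n] e) :
  1 < m -> is_partition m mu -> is_partition n nu ->
  mx_rsim rW (specht m mu) -> mx_rsim rZ (specht n nu) ->
  let kappa := if odd m then nu else conj_partition nu in
  let rX := induced_repr (oslash rW rZ) in
  (exists! la, summand rX la /\ forall la', summand rX la' -> dominated la' la -> la' = la)
  <->
  (kappa = nseq n 1 \/
    (rectangular mu /\ exists c d, 1 <= c /\ kappa = nseq c 2 ++ nseq d 1)).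
Proof.
move=> m_gt1 part_mu part_nu sim_mu sim_nu kappa rX.
apply: (iff_trans (unique_minimal_summandE rX)).
apply: (iff_trans (unique_maximal_summandP _)).
have part_c := conj_is_partition part_mu; have part_d := conj_is_partition part_nu.
pose nu' := if odd m then conj_partition nu else nu.
have part_nu' : is_partition n nu' by rewrite /nu'; case: (odd m).
have part_ka : is_partition n kappa by rewrite /kappa; case: (odd m).
have kappaE : conj_partition nu' = kappa.
  by rewrite /nu' /kappa; case: (odd m); rewrite ?(conj_conj part_nu).
have nu'E : conj_partition kappa = nu' by rewrite -kappaE (conj_conj part_nu').
have sim_mu' := mx_rsim_trans (sign_twist_rsim sim_mu) (sign_twist_specht part_mu).
have sim_nu' : mx_rsim (twist_outer m rZ) (specht n nu').
  rewrite /twist_outer /nu'; case: (odd m) => //.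
  exact: mx_rsim_trans (sign_twist_rsim sim_nu) (sign_twist_specht part_nu).
have [max_shape shape_max] :=
  foulkes_maximum m_gt1 part_c part_nu' sim_mu' sim_nu'.
have twistE K := rfix_twisted_foulkes (ltnW m_gt1) rW rZ K.
have rect_conj : rectangular (conj_partition mu) <-> rectangular mu.
  split; last exact: rectangular_conj.
  by move/rectangular_conj; rewrite (conj_conj part_mu).
have size_nu' : size nu' = head 0 kappa by rewrite -nu'E size_conj.
have head2 := head2_partition part_ka.
split=> [[c0 fix0 max0]|shape].
  have [|nu'_row|[rect_c size2]] := max_shape.
  - exists c0; first by rewrite -twistE.
    by move=> c; rewrite -twistE; apply: max0.
  - by left; rewrite -kappaE nu'_row conj_row_partition.
  - by right; split; [apply/rect_conj | apply/head2; rewrite -size_nu'].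
have [|c0 fix0 max0] := shape_max.
  case: shape => [ka_col|[rect two]]; [left|right].
    by rewrite -nu'E ka_col conj_column.
  by split; [apply/rect_conj | rewrite size_nu'; apply/head2].
exists c0; first by rewrite twistE.
by move=> c; rewrite twistE; apply: max0.
Qed.

Theorem corollary9p10 (m n : nat) (mu nu : seq nat) :
  2 <= m -> is_partition m mu -> is_partition n nu ->
  let kappa := if odd m then nu else conj_partition nu in
  ((exists! la, maximal_summand m n mu nu la) <->
     (nu = row_partition n \/ (rectangular mu /\ size nu = 2)))
  /\
  ((exists! la, minimal_summand m n mu nu la) <->
     (kappa = nseq n 1 \/
      (rectangular mu /\
       exists c d, 1 <= c /\ kappa = nseq c 2 ++ nseq d 1))).
Proof.
move=> m_gt1 part_mu part_nu kappa; split.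
  apply: (iff_trans (unique_maximal_summandP (foulkes m n mu nu))).
  by apply: foulkes_maximum => //; apply: mx_rsim_refl.
by apply: foulkes_unique_minimal => //; apply: mx_rsim_refl.
Qed.
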